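(* For every $n\in\omega$ we have $\mathcal{H}_n=\mathcal{H}_n'$.
   Context: A permutation group is a subgroup $G$ of $\operatorname{Sym}(X)$ for some set $X=\operatorname{Dom}(G)$; it is closed if it is closed in $\operatorname{Sym}(X)$ in the topology of pointwise convergence. Two permutation groups $G,H$ are isomorphic if there is a bijection $e\colon\operatorname{Dom}(G)\to\operatorname{Dom}(H)$ with $eGe^{-1}=H$. For permutation groups $G_i$ with pairwise disjoint domains $X_i$, $\prod_iG_i$ is the group of all permutations of $\bigcup_iX_i$ that fix each $X_i$ setwise and act on it as an element of $G_i$. $\operatorname{id}(X)$ is the trivial permutation group on $X$. For $Y\subset X$, $G_{((Y))}$ denotes the restriction to $Y$ of the subgroup of $G$ fixing every element of $X\setminus Y$. A congruence of $G$ is a $G$-invariant equivalence relation $E$ on $X$, and $G/E$ is the permutation group induced by $G$ on the $E$-classes. The classes $\mathcal{H}_n$. An $\omega$-partition of $G\le\operatorname{Sym}(X)$ is a triple $(K,\nabla,\Delta)$ such that: (1) $K\subset X$ is finite and fixed setwise by $G$; (2) $\Delta\subset\nabla$ are congruences of $G|_{X\setminus K}$; (3) $\nabla$ has finitely many classes; (4) every $\nabla$-class is a union of $\aleph_0$ many $\Delta$-classes; (5) $G_{((C))}/\Delta=\operatorname{Sym}(C/\Delta)$ for every $\nabla$-class $C$. (If $X=K$ then $\nabla=\Delta=\emptyset$ and (2)-(5) hold trivially.) Its components are the groups $G_{((Y))}$ for $\Delta$-classes $Y$. Put $\mathcal{H}_{-1}=\emptyset$, and for $n\ge0$ a closed permutation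 group $G$ is in $\mathcal{H}_n$ iff $G$ has an $\omega$-partition all of whose components are in $\mathcal{H}_{n-1}$. The construction $\mathcal{G}(H;N_0,\dots,N_k)$. Let $k\ge 0$, let $Y_0,\dots,Y_k$ be pairwise disjoint sets with $Y_0$ finite and $Y_1,\dots,Y_k$ nonempty, and $Y:=\bigcup_{i=0}^kY_i$. Let $\Omega:=(Y_0\times\{0\})\cup\bigcup_{i=1}^k(Y_i\times\omega)$. Let $\nabla$ be the equivalence relation on $\Omega$ with classes $Y_0\times\{0\}$ and $Y_i\times\omega$ ($1\le i\le k$), and $\Delta$ the one with classes $Y_0\times\{0\}$ and $Y_i\times\{n\}$ ($1\le i\le k$, $n\in\omega$). Let $p\colon\Omega\to Y$, $p(a,n)=a$. For $\vec n=(n_0,n_1,\dots,n_k)\in\{0\}\times\omega^k$ let $\ell_{\vec n}\colon Y\to\Omega$, $\ell_{\vec n}(a)=(a,n_i)$ for $a\in Y_i$. If $\sigma\in\operatorname{Sym}(\Omega)$ fixes $Y_0\times\{0\}$ setwise and preserves $\nabla$ and $\Delta$, put $\rho_{\vec n}(\sigma):=p\circ\sigma\circ\ell_{\vec n}\in\operatorname{Sym}(Y)$. Let $N_0=\operatorname{id}(Y_0)$, let $N_i$ be a permutation group on $Y_i$ for $1\le i\le k$, $N:=\prod_{i=0}^kN_i$, and let $H$ be a permutation group on $Y$ that fixes $Y_0$ setwise and has $N$ as a normal subgroup. Then $\mathcal{G}(H;N_0,\dots,N_k)$ is the group of all $\sigma\in\operatorname{Sym}(\Omega)$ such that (a) $\sigma$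 fixes $Y_0\times\{0\}$ setwise; (b) $\sigma$ preserves $\nabla$ and $\Delta$; (c) $\rho_{\vec n}(\sigma)\in H$ for all $\vec n\in\{0\}\times\omega^k$; (d) for all $\vec n,\vec m\in\{0\}\times\omega^k$ the permutations $\rho_{\vec n}(\sigma)$ and $\rho_{\vec m}(\sigma)$ are equal modulo $N$. The classes $\mathcal{H}'_n$: $\mathcal{H}'_0$ is the class of all permutation groups on finite sets; for $n\ge1$, $G\in\mathcal{H}'_n$ iff $G$ is isomorphic to $\mathcal{G}(H;N_0,\dots,N_k)$ for some $k\ge0$, some pairwise disjoint sets $Y_0,\dots,Y_k$ with $Y_0$ finite and $Y_1,\dots,Y_k$ nonempty, $N_0=\operatorname{id}(Y_0)$, some permutation groups $N_i$ on $Y_i$ ($1\le i\le k$), and some permutation group $H$ on $\bigcup_{i=0}^kY_i$ that fixes $Y_0$ setwise and has $\prod_{i=0}^kN_i$ as a normal subgroup, with $N_1,\dots,N_k,H\in\mathcal{H}'_{n-1}$. *)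

(* Defs.v *)
From mathcomp Require Import all_boot.
From mathcomp Require Import all_classical topology.
From Stdlib Require Import RelationClasses.

Set Implicit Arguments.
Unset Strict Implicit.
Unset Printing Implicit Defensive.

Local Open Scope classical_set_scope.

(* A permutation group with domain X is given by its set of elements
   G : set (X -> X).  A subset D : set X is used as a domain through the
   coercion [set_type]. *)

Definition Sym (X : Type) : set (X -> X) := [set f | bijective f].
Arguments Sym X _ : clear implicits.

Definition id_group (X : Type) : set (X -> X) := [set idfun].
Arguments id_group X _ : clear implicits.

Record perm_group (X : Type) (G : set (X -> X)) : Prop := PermGroup {
  perm_group_sub : G `<=` Sym X;
  perm_group_id : G idfun;
  perm_group_comp : forall f g, G f -> G g -> G (f \o g);
  perm_group_inv : forall f g, G f -> cancel f g -> cancel g f -> G g }.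

(* In the library's [subspace A] topology, the closed sets contained in A are
   exactly the relatively closed ones. *)
Definition closed_group (X : Type) (G : set (X -> X)) : Prop :=
  closed (G : set (subspace
    (Sym X : set {ptws {classic X} -> discrete_topology {classic X}}))).

Definition isomorphic_group (X X' : Type)
    (G : set (X -> X)) (G' : set (X' -> X')) : Prop :=
  exists (e : X -> X') (e' : X' -> X),
    [/\ cancel e e', cancel e' e & [set e \o g \o e' | g in G] = G'].

Definition fixes_setwise (X : Type) (g : X -> X) (A : set X) : Prop :=
  g @` A = A.

Definition preserves (X : Type) (g : X -> X) (E : X -> X -> Prop) : Prop :=
  forall x y, E x y <-> E (g x) (g y).

Definition normal_subgroup (X : Type) (N H : set (X -> X)) : Prop :=
  [/\ perm_group N, N `<=` H &
      forall h h' f, H h -> cancel h h' -> cancel h' h -> N f ->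
        N (h \o f \o h')].

(* The restriction G|_Y, when the elements of G fix Y setwise. *)
Definition group_restr (X : Type) (G : set (X -> X)) (Y : set X) :
    set (Y -> Y) :=
  [set h | exists2 g, G g & forall y : Y, val (h y) = g (val y)].
Arguments group_restr {X} G Y _.

(* The group G_((Y)). *)
Definition local_group (X : Type) (G : set (X -> X)) (Y : set X) :
    set (Y -> Y) :=
  group_restr [set g | G g /\ forall x, ~ Y x -> g x = x] Y.
Arguments local_group {X} G Y _.

Definition rel_restr (X : Type) (E : X -> X -> Prop) (D : set X) :
    D -> D -> Prop :=
  fun x y => E (val x) (val y).
Arguments rel_restr {X} E D _ _.

Definition congruence (X : Type) (G : set (X -> X)) (E : X -> X -> Prop) :
    Prop :=
  Equivalence E /\ forall g, G g -> preserves g E.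

(* An equivalence relation on a subset of X is seen as a relation on X that
   holds only inside this subset; its classes are then the E-classes of the
   x with E x x. *)
Definition classes (X : Type) (E : X -> X -> Prop) : set (set X) :=
  [set [set y | E x y] | x in [set x | E x x]].

Definition group_quotient (X : Type) (G : set (X -> X)) (E : X -> X -> Prop) :
    set (classes E -> classes E) :=
  [set h | exists2 g, G g & forall A : classes E, val (h A) = g @` val A].
Arguments group_quotient {X} G E _.

Record omega_partition (X : Type) (G : set (X -> X)) (K : set X)
    (nabla Delta : X -> X -> Prop) : Prop := OmegaPartition {
  op_finite_kernel : finite_set K;
  op_fixes_kernel : forall g, G g -> fixes_setwise g K;
  op_Delta_sub_nabla : forall x y, Delta x y -> nabla x y;
  op_nabla_field : forall x y, nabla x y -> ~ K x /\ ~ K y;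
  op_nabla_congruence :
    congruence (group_restr G (~` K)) (rel_restr nabla (~` K));
  op_Delta_congruence :
    congruence (group_restr G (~` K)) (rel_restr Delta (~` K));
  op_finite_nabla : finite_set (classes nabla);
  op_countable : forall C, classes nabla C ->
    (classes (rel_restr Delta C) #= [set: nat])%card;
  op_full : forall C, classes nabla C ->
    group_quotient (local_group G C) (rel_restr Delta C) =
    Sym (classes (rel_restr Delta C)) }.

(* [class_H_upto m] is the class H_(m-1), so that m = 0 is the empty class
   H_(-1). *)
Fixpoint class_H_upto (m : nat) (X : Type) (G : set (X -> X)) : Prop :=
  if m is n.+1 then
    [/\ perm_group G, closed_group G &
        exists (K : set X) (nabla Delta : X -> X -> Prop),
          omega_partition G K nabla Delta /\
          forall Y, classes Delta Y -> class_H_upto n (local_group G Y)]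
  else False.

Definition class_H (n : nat) (X : Type) (G : set (X -> X)) : Prop :=
  class_H_upto n.+1 G.

(* A family of pairwise disjoint sets Y_i is a family of types, and its union
   is the sigma type of the family. *)
Definition prod_group (I : Type) (Y : I -> Type)
    (N : forall i, set (Y i -> Y i)) : set ({i & Y i} -> {i & Y i}) :=
  [set f | bijective f /\
     forall i, exists2 g, N i g & forall a, f (Tagged Y a) = Tagged Y (g a)].
Arguments prod_group {I Y} N _.

Definition Omega (k : nat) (Y : 'I_k.+1 -> Type) : set ({i & Y i} * nat) :=
  [set w | tag w.1 = ord0 -> w.2 = 0].
Arguments Omega {k} Y _.

Definition Omega_proj (k : nat) (Y : 'I_k.+1 -> Type) (w : Omega Y) :
    {i & Y i} :=
  (val w).1.

Definition Omega_kernel (k : nat) (Y : 'I_k.+1 -> Type) : set (Omega Y) :=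
  [set w | tag (val w).1 = ord0].
Arguments Omega_kernel {k} Y _.

Definition Omega_nabla (k : nat) (Y : 'I_k.+1 -> Type) (w w' : Omega Y) :
    Prop :=
  tag (val w).1 = tag (val w').1.
Arguments Omega_nabla {k} Y _ _.

Definition Omega_Delta (k : nat) (Y : 'I_k.+1 -> Type) (w w' : Omega Y) :
    Prop :=
  tag (val w).1 = tag (val w').1 /\ (val w).2 = (val w').2.
Arguments Omega_Delta {k} Y _ _.

Definition index_vectors (k : nat) : set ('I_k.+1 -> nat) :=
  [set v | v ord0 = 0].
Arguments index_vectors k _ : clear implicits.

Lemma section_subproof (k : nat) (Y : 'I_k.+1 -> Type) (v : index_vectors k)
    (a : {i & Y i}) :
  (a, val v (tag a)) \in Omega Y.
Proof. by apply/mem_set => /= ->; exact: set_mem (valP v). Qed.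

Definition Omega_section (k : nat) (Y : 'I_k.+1 -> Type) (v : index_vectors k)
    (a : {i & Y i}) : Omega Y :=
  exist _ (a, val v (tag a)) (section_subproof v a).

Definition rho (k : nat) (Y : 'I_k.+1 -> Type) (v : index_vectors k)
    (s : Omega Y -> Omega Y) : {i & Y i} -> {i & Y i} :=
  @Omega_proj k Y \o s \o Omega_section v.

(* f lies in the coset g N; this is only used for N normal, when left and right
   cosets agree. *)
Definition equal_modulo (X : Type) (N : set (X -> X)) (f g : X -> X) : Prop :=
  exists2 h, N h & f = g \o h.

Definition group_G (k : nat) (Y : 'I_k.+1 -> Type)
    (H : set ({i & Y i} -> {i & Y i})) (N : forall i, set (Y i -> Y i)) :
    set (Omega Y -> Omega Y) :=
  [set s | [/\ bijective s,
               fixes_setwise s (Omega_kernel Y),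
               preserves s (Omega_nabla Y) /\
               preserves s (Omega_Delta Y),
               forall v : index_vectors k, H (rho v s) &
               forall v w : index_vectors k,
                 equal_modulo (prod_group N) (rho v s) (rho w s)]].
Arguments group_G {k Y} H N _.

Record group_G_data (k : nat) (Y : 'I_k.+1 -> Type)
    (H : set ({i & Y i} -> {i & Y i})) (N : forall i, set (Y i -> Y i)) :
    Prop := GroupGData {
  gd_finite : finite_set [set: Y ord0];
  gd_inhabited : forall i, i != ord0 -> inhabited (Y i);
  gd_trivial : N ord0 = id_group (Y ord0);
  gd_perm_group : forall i, i != ord0 -> perm_group (N i);
  gd_top_perm_group : perm_group H;
  gd_fixes : forall h, H h -> fixes_setwise h [set a | tag a = ord0];
  gd_normal : normal_subgroup (prod_group N) H }.

Fixpoint class_H' (n : nat) (X : Type) (G : set (X -> X)) : Prop :=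
  if n is m.+1 then
    perm_group G /\
    exists (k : nat) (Y : 'I_k.+1 -> Type)
           (H : set ({i & Y i} -> {i & Y i})) (N : forall i, set (Y i -> Y i)),
      [/\ group_G_data H N,
          forall i, i != ord0 -> class_H' m (N i),
          class_H' m H &
          isomorphic_group G (group_G H N)]
  else perm_group G /\ finite_set [set: X].

(* Main.v *)
Require Import Defs.
From mathcomp Require Import all_boot.
From mathcomp Require Import all_classical topology.
From mathcomp Require Import zify.
From Stdlib Require Import RelationClasses.

Set Implicit Arguments.
Unset Strict Implicit.
Unset Printing Implicit Defensive.

Local Open Scope classical_set_scope.

(** The problem is the choice of identifications. If G has an omega-partition
    (K, nabla, Delta), then writing G as some G(H; N_0, ..., N_k) means
    identifying the Delta-classes inside each nabla-class with each other in
    such a way that every permutation of the classes, carried out along the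
    identification, belongs to G. Fullness of the omega-partition gives, for
    every permutation of the classes, a lift in G, but says nothing on what
    this lift does inside the classes.

    The way out is a finiteness property: a group C in H_m has an exponent
    e > 0 such that p^e lies in C for every permutation p of its domain that
    normalizes C ([class_H_on_exponent]). An element of G that fixes a
    Delta-class normalizes the component there. Hence, if phi is a permutation
    of the classes with phi^(e+1) = 1, the e-th power of a lift of phi^-1 lifts
    phi, and on the classes fixed by phi it belongs to the components, so it can
    be corrected to be the identity there, G being closed ([exact_lift]). In
    this way G contains lifts of (e+1)-cycles that are supported on e+1 classes.
    The elements of G supported on finitely many classes therefore act highly
    transitively on the classes ([finsupp_transitive]), and such an element
    which fixes a class restricts to an element of the component: conjugate the
    rest of its support off to infinity and use that G is closed
    ([finsupp_local]). So two finitely supported elements taking one given class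
    to another differ by an element of the component only, and they provide the
    identifications ([straight_sections]).

    The exponent comes from an induction on m, through the fact that all
    permutations normalizing C preserve any omega-partition of C
    ([partition_canonical]). The kernel is the union of the finite orbits. If q
    normalizes C and the q-image of a Delta-class met two Delta-classes of one
    nabla-class, then it would meet all Delta-classes of this nabla-class, and
    the same would hold for infinitely many q-images of Delta-classes; but these
    are all preserved by the component at any of the Delta-classes that they
    meet, and a component has finitely many orbits. Canonicity also shows
    that a closed group in which a member of H_m is normal is itself in H_m
    ([class_H_on_normal_supergroup]). Let D be the union of K and of one
    chosen Delta-class per nabla-class; the group H consists of the permutations
    of D whose diagonal copy lies in G. The product of the components is in
    H_(n-1) and normal in H, so H is in H_(n-1) too. With these choices G is
    recovered from H and the components ([slice_top], [slice_modulo],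
    [group_of_slices]).

    For the converse, G(H; N_0, ..., N_k) is closed because H and the N_i are,
    permuting copies shows fullness, and its components are copies of the N_i
    ([group_G_component]).

    All these arguments concern permutations of one fixed set that are
    supported in smaller and smaller subsets ([class_H_on]);
    [class_H_transfer] relates this setting to groups on subtypes. *)

(** * Permutations supported in a subset *)

Definition id_off (X : Type) (D : set X) (g : X -> X) : Prop :=
  forall x, ~ D x -> g x = x.

Definition on (X : Type) (A : set X) (g : X -> X) (x : X) : X :=
  if `[< A x >] then g x else x.

(** Permutations are plain functions, so the inverse is a variable; with both
    conjuncts the meaning is that conjugation by p maps G onto itself. *)
Definition normalizes (X : Type) (p : X -> X) (G : set (X -> X)) : Prop :=
  forall p', cancel p p' -> cancel p' p ->
  forall g, G g -> G (p \o g \o p') /\ G (p' \o g \o p).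

(** The group G_((A)), kept as a group of permutations of all of X. *)
Definition local_subgroup (X : Type) (G : set (X -> X)) (A : set X) : set (X -> X) :=
  [set g | G g /\ id_off A g].

(** Closedness in Sym(X) for pointwise convergence, by finite approximation;
    see [closed_groupE]. *)
Definition fin_closed (X : eqType) (G : set (X -> X)) : Prop :=
  forall f, bijective f ->
    (forall s : seq X, exists2 g, G g & {in s, g =1 f}) -> G f.

Section Basics.
Variable X : Type.
Implicit Types (G : set (X -> X)) (A D : set X) (g h p : X -> X).

Lemma perm_group_inverse G g : perm_group G -> G g ->
  exists g', [/\ G g', cancel g g' & cancel g' g].
Proof.
move=> pG Gg; have [g' gK g'K] := perm_group_sub pG Gg.
by exists g'; split=> //; exact: (perm_group_inv pG Gg gK g'K).
Qed.

Lemma perm_group_iter G g n : perm_group G -> G g -> G (iter n g).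
Proof.
move=> pG Gg; elim: n => [|n IHn]; first exact: (perm_group_id pG).
have -> : iter n.+1 g = g \o iter n g by [].
exact: perm_group_comp.
Qed.

Lemma bij_iter g n : bijective g -> bijective (iter n g).
Proof.
move=> bg; elim: n => [|n IHn]; first by exists id.
by apply: (bij_comp bg IHn).
Qed.

Lemma onT A g x : A x -> on A g x = g x.
Proof. by rewrite /on => /asboolP ->. Qed.

Lemma onF A g x : ~ A x -> on A g x = x.
Proof. by rewrite /on => /asboolPn/negbTE ->. Qed.

Lemma on_id_off A g : id_off A (on A g).
Proof. by move=> x; exact: onF. Qed.

Lemma eq_on A B g h : (forall x, A x <-> B x) -> (forall x, A x -> g x = h x) ->
  on A g = on B h.
Proof.
move=> AB gh; apply/funext => x; have [Ax|nAx] := pselect (A x).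
  by rewrite !onT ?gh//; exact/AB.
by rewrite !onF// => /AB.
Qed.

Lemma on_cancel A g g' : cancel g g' -> (forall x, A x -> A (g x)) ->
  cancel (on A g) (on A g').
Proof.
move=> gK gA x; have [Ax|nAx] := pselect (A x).
  by rewrite (onT _ Ax) onT//; exact: gA.
by rewrite (onF _ nAx) onF.
Qed.

Lemma on_bij A g : bijective g -> (forall x, A x <-> A (g x)) ->
  bijective (on A g).
Proof.
move=> [g' gK g'K] gA; exists (on A g'); apply: on_cancel => // x.
- by move/gA.
- by move=> Ax; apply/gA; rewrite g'K.
Qed.

Lemma on_comp A g h : (forall x, A x -> A (h x)) ->
  on A g \o on A h = on A (g \o h).
Proof.
move=> hA; apply/funext => x /=; have [Ax|nAx] := pselect (A x).
  by rewrite (onT h Ax) !onT//; exact: hA.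
by rewrite !onF ?onF.
Qed.

Lemma on_iter A g n : (forall x, A x -> A (g x)) ->
  iter n (on A g) = on A (iter n g).
Proof.
move=> gA; elim: n => [|n IHn].
  by apply/funext => x /=; rewrite /on; case: ifP.
have -> : iter n.+1 (on A g) = on A g \o iter n (on A g) by [].
rewrite IHn on_comp// => x Ax.
by elim: n {IHn} => //= n IHn; apply: gA.
Qed.

Lemma id_off_stab D g x : injective g -> id_off D g -> D x -> D (g x).
Proof.
move=> gI gD Dx; apply: contrapT => nD.
by have /gI gx := gD _ nD; apply: nD; rewrite gx.
Qed.

Lemma id_off_inv D g g' : cancel g g' -> id_off D g -> id_off D g'.
Proof. by move=> gK gD x /gD gx; rewrite -[in LHS]gx gK. Qed.

Lemma id_off_comp D g h : id_off D g -> id_off D h -> id_off D (g \o h).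
Proof. by move=> gD hD x nD /=; rewrite hD// gD. Qed.

Lemma id_off_iter D g n : id_off D g -> id_off D (iter n g).
Proof. by move=> gD x nD; elim: n => //= n ->; exact: gD. Qed.

Lemma id_offW A D g : A `<=` D -> id_off A g -> id_off D g.
Proof. by move=> AD gA x nD; apply: gA => /AD. Qed.

Lemma id_off_on A g : id_off A g -> on A g = g.
Proof.
move=> gA; apply/funext => x; have [Ax|nA] := pselect (A x).
  by rewrite onT.
by rewrite onF// gA.
Qed.

Lemma local_subgroup_perm_group G A : perm_group G -> perm_group (local_subgroup G A).
Proof.
move=> pG; split.
- by move=> g [Gg _]; exact: (perm_group_sub pG Gg).
- by split=> //; exact: (perm_group_id pG).
- move=> f g [Gf fA] [Gg gA]; split; first exact: perm_group_comp.
  exact: id_off_comp.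
- move=> f g [Gf fA] fK gK; split; first exact: (perm_group_inv pG Gf fK gK).
  exact: id_off_inv fA.
Qed.

Lemma normalizes_inv p p' G : cancel p p' -> cancel p' p ->
  normalizes p G -> normalizes p' G.
Proof.
move=> pK p'K np q qK p'q g Gg.
have -> : q = p by apply/funext => x; rewrite -[in RHS](p'q x) p'K.
by have [] := np _ pK p'K _ Gg.
Qed.

Lemma normalizes_comp p q G : bijective p -> bijective q ->
  normalizes p G -> normalizes q G -> normalizes (p \o q) G.
Proof.
move=> [p' pK p'K] [q' qK q'K] np nq r rK r'K g Gg.
have -> : r = q' \o p'.
  by apply/funext => x /=; rewrite -[in LHS](p'K x) -[in LHS](q'K (p' x)) rK.
split.
  exact: (np _ pK p'K _ (nq _ qK q'K _ Gg).1).1.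
exact: (nq _ qK q'K _ (np _ pK p'K _ Gg).2).2.
Qed.

Lemma group_normalizes G g : perm_group G -> G g -> normalizes g G.
Proof.
move=> pG Gg g' gK g'K h Gh; have Gg' := perm_group_inv pG Gg gK g'K.
by split; apply: (perm_group_comp pG) => //; apply: (perm_group_comp pG).
Qed.

Lemma normalizes_iter p G n : bijective p -> normalizes p G ->
  normalizes (iter n p) G.
Proof.
move=> bp np; elim: n => [|n IHn].
  move=> q qK q'K g Gg; have -> : q = id by apply/funext => x; rewrite -[RHS]qK.
  by [].
exact: (normalizes_comp bp (bij_iter n bp)).
Qed.

End Basics.

Section Glue.
Variable X : eqType.
Implicit Types (G : set (X -> X)) (A D : set X) (g h p : X -> X).

Lemma local_subgroup_fin_closed G A : fin_closed G -> fin_closed (local_subgroup G A).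
Proof.
move=> cG f bf fG; split.
  by apply: cG => // s; have [g [Gg _] gf] := fG s; exists g.
move=> x nA; have [g [_ gA] gf] := fG [:: x].
by rewrite -gf ?mem_head// gA.
Qed.

(** A finite set meets only finitely many classes of E, and there g agrees with
    a finite product of its restrictions to classes. *)
Lemma glue G (E : X -> X -> Prop) g : perm_group G -> fin_closed G ->
  (forall x, E x x) -> (forall x y, E x y -> E y x) ->
  (forall x y z, E x y -> E y z -> E x z) ->
  bijective g -> (forall x, G (on (E x) g)) -> G g.
Proof.
move=> pG cG Er Es Et bg gE.
have stab x y : E x y -> E x (g y).
  move=> xy; have inj := bij_inj (perm_group_sub pG (gE x)).
  by have := id_off_stab inj (@on_id_off _ _ _) xy; rewrite onT.
pose U (s : seq X) : set X := [set x | exists2 y, y \in s & E y x].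
have GU s : G (on (U s) g).
  elim: s => [|y s IHs].
    have -> : on (U [::]) g = idfun; last exact: (perm_group_id pG).
    by apply/funext => x; rewrite onF// => -[].
  have [Uy|nUy] := pselect (U s y).
    suff -> : on (U (y :: s)) g = on (U s) g by [].
    apply: eq_on => // x; split=> [[z]|[z zs zx]].
      rewrite inE => /orP[/eqP-> yx|zs zx]; last by exists z.
      by have [w ws wy] := Uy; exists w => //; exact: Et yx.
    by exists z => //; rewrite inE zs orbT.
  suff -> : on (U (y :: s)) g = on (U s) g \o on (E y) g.
    exact: perm_group_comp.
  apply/funext => x /=; have [yx|nyx] := pselect (E y x).
    rewrite (onT g yx) onT; last by exists y; rewrite ?mem_head.
    rewrite onF// => -[z zs zgx]; apply: nUy; exists z => //.
    by apply: Et zgx _; apply: Es; exact: stab.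
  rewrite (onF g nyx); have [Ux|nUx] := pselect (U s x).
    rewrite !onT//; have [z zs zx] := Ux; exists z => //.
    by rewrite inE zs orbT.
  rewrite !onF// => -[z]; rewrite inE => /orP[/eqP->//|zs zx].
  by apply: nUx; exists z.
apply: cG => // s; exists (on (U s) g) => // x xs.
by rewrite onT//; exists x.
Qed.

(** The form for an equivalence relation living on a subset, such as Delta. *)
Lemma glue_classes G (Del : X -> X -> Prop) (B : set X) g :
  perm_group G -> fin_closed G ->
  (forall x y, Del x y -> Del y x) ->
  (forall x y z, Del x y -> Del y z -> Del x z) ->
  (forall x, B x -> Del x x) -> (forall x y, B x -> Del x y -> B y) ->
  bijective (on B g) -> (forall x, B x -> G (on (Del x) g)) -> G (on B g).
Proof.
move=> pG cG Dsym Dtrans BD DB bg Gg.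
apply: (@glue G (fun x y => x = y \/ Del x y)) => //.
- by move=> x; left.
- by move=> x y [->|/Dsym]; [left|right].
- move=> x y z [->//|xy] [<-|yz]; right=> //.
  exact: Dtrans xy yz.
move=> x; have [Bx|nBx] := pselect (B x).
  suff <- : on (Del x) g = on [set y | x = y \/ Del x y] (on B g) by exact: Gg.
  apply: eq_on => y; last by move=> xy; rewrite onT//; exact: DB xy.
  by split=> [|[<-|//]]; [right|exact: BD].
suff -> : on [set y | x = y \/ Del x y] (on B g) = idfun.
  exact: (perm_group_id pG).
apply/funext => y; have [xy|nxy] := pselect (x = y \/ Del x y).
  rewrite onT// onF// => By; apply: nBx.
  by case: xy => [->//|/Dsym]; exact: DB.
by rewrite onF.
Qed.

End Glue.

(** * Moving the Delta-classes inside one nabla-class *)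

Lemma iter_next_uniq (T : eqType) (p : seq T) (x : T) :
  uniq p -> iter (size p) (next p) x = x.
Proof.
move=> up; have [xp|nxp] := boolP (x \in p); last first.
  have nx : next p x = x by rewrite next_nth (negbTE nxp).
  by elim: (size p) => //= n ->.
have [i q pE] := rot_to xp.
have -> : size p = (size q).+1 by rewrite -(size_rot i) pE.
rewrite -(eq_iter (next_rot i up)) pE.
have uq : uniq (x :: q) by rewrite -pE rot_uniq.
have nextE k : k <= size q -> next (x :: q) (nth x (x :: q) k) = nth x q k.
  by move=> kq; rewrite next_nth mem_nth// index_uniq.
have H k : k <= size q -> iter k (next (x :: q)) x = nth x (x :: q) k.
  elim: k => [//|k IHk kq]; rewrite iterS IHk; last exact: ltnW.
  by rewrite nextE//; exact: ltnW.
by rewrite iterS H// nextE// nth_default.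
Qed.

Lemma seq_bound (s : seq nat) : exists W, forall i, i \in s -> (i < W)%N.
Proof.
elim: s => [|a s [W IHs]]; first by exists 0.
by exists (maxn a.+1 W) => i; rewrite inE => /orP[/eqP->|/IHs]; lia.
Qed.

(** In this section C is one nabla-class, r enumerates representatives of the
    Delta-classes inside it, and e is an exponent as explained at the top: the
    e-th power of an element fixing a class belongs to G after restriction to
    this class. *)
Section Spread.
Variables (X : eqType) (G : set (X -> X)) (C : set X) (Del : X -> X -> Prop).
Variables (r : nat -> X) (e : nat).
Hypotheses (pG : perm_group G) (cG : fin_closed G).
Hypotheses (Dsym : forall x y, Del x y -> Del y x)
  (Dtrans : forall x y z, Del x y -> Del y z -> Del x z)
  (Dinv : forall g x y, G g -> Del x y -> Del (g x) (g y)).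
Hypotheses (r_refl : forall i, Del (r i) (r i))
  (r_inj : forall i j, Del (r i) (r j) -> i = j)
  (CE : forall x, C x <-> exists i, Del (r i) x).
Hypothesis full : forall phi : nat -> nat, bijective phi ->
  exists g, [/\ G g, id_off C g & forall i, Del (r (phi i)) (g (r i))].
Hypothesis e_gt0 : 0 < e.
Hypothesis expo : forall g x, G g -> Del x (g x) -> G (on (Del x) (iter e g)).

Let over g i j := Del (r j) (g (r i)).

Lemma over_cl g i j x : G g -> over g i j -> Del (r i) x -> Del (r j) (g x).
Proof. by move=> Gg gij ix; exact: Dtrans gij (Dinv Gg ix). Qed.

Lemma over_comp g h i j k : G h -> over g i j -> over h j k ->
  over (h \o g) i k.
Proof. by move=> Gh gij hjk; exact: over_cl gij. Qed.

Lemma over_inv g g' i j : G g' -> cancel g g' -> over g i j -> over g' j i.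
Proof. by move=> Gg' gK /(Dinv Gg'); rewrite gK /over => /Dsym. Qed.

Lemma cl_inj i j x : Del (r i) x -> Del (r j) x -> i = j.
Proof. by move=> ix /Dsym jx; apply: r_inj; exact: Dtrans ix jx. Qed.

Lemma over_inj g i j k : over g i j -> over g i k -> j = k.
Proof. exact: cl_inj. Qed.

Lemma over_iter g (phi : nat -> nat) n i : G g -> (forall i, over g i (phi i)) ->
  over (iter n g) i (iter n phi i).
Proof.
move=> Gg gphi; elim: n => [|n IHn]; first exact: r_refl.
exact: (over_comp Gg IHn (gphi _)).
Qed.

Lemma Del_refl i x : Del (r i) x -> Del x x.
Proof. by move=> ix; exact: Dtrans (Dsym ix) ix. Qed.

(** Starting from a lift g of the inverse psi of phi, the e-th power of g lifts
    psi^e = phi, and on the classes fixed by phi it restricts to elements of G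
    by the choice of e. Dividing by these restrictions makes it trivial there. *)
Lemma exact_lift (phi : nat -> nat) : bijective phi ->
  (forall i, iter e.+1 phi i = i) ->
  exists h, [/\ G h, id_off C h, forall i, over h i (phi i) &
    forall i x, phi i = i -> Del (r i) x -> h x = x].
Proof.
move=> [psi phiK psiK] phie.
have [g [Gg gC gpsi]] := full (Bijective psiK phiK).
pose h0 := iter e g.
have Gh0 : G h0 by exact: perm_group_iter.
have h0phi i : over h0 i (phi i).
  suff <- : iter e psi i = phi i by exact: over_iter.
  rewrite -[i in LHS](phie i) iterSr.
  by elim: (e) (phi i) => //= n IHn j; rewrite -iterS iterSr phiK.
pose B : set X := [set x | exists i, phi i = i /\ Del (r i) x].
have BC x : B x -> C x by move=> [i [_ ix]]; apply/CE; exists i.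
have Bh0 x : B x <-> B (h0 x).
  split=> [[i [ii ix]]|[i [ii ix]]].
    by exists i; split=> //; rewrite -[i]ii; exact: (over_cl Gh0 (h0phi i)).
  exists i; split=> //.
  have [h' [Gh' hK h'K]] := perm_group_inverse pG Gh0.
  have /(over_inv Gh' hK) H := h0phi i; rewrite ii in H.
  by have := over_cl Gh' H ix; rewrite hK.
have Gb : G (on B h0).
  apply: (glue_classes pG cG Dsym Dtrans).
  - by move=> x [i [_ /Del_refl]].
  - by move=> x y [i [ii ix]] xy; exists i; split=> //; exact: Dtrans xy.
  - by apply: on_bij => //; exact: (perm_group_sub pG Gh0).
  move=> x [i [ii ix]]; apply: expo => //; have H := gpsi i.
  rewrite -[in psi i]ii phiK in H.
  exact: Dtrans (Dsym ix) (over_cl Gg H ix).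
have [b' [Gb' bK b'K]] := perm_group_inverse pG Gb.
have b'B : id_off B b' by apply: id_off_inv bK _; exact: on_id_off.
exists (h0 \o b'); split.
- exact: perm_group_comp.
- apply: id_off_comp; first exact: id_off_iter.
  exact: id_offW b'B.
- move=> i; have [ii|nii] := pselect (phi i = i).
    rewrite /over /= ii; suff -> : h0 (b' (r i)) = r i by [].
    have Bri : B (r i) by exists i.
    rewrite -[RHS]b'K onT//.
    exact: id_off_stab (can_inj b'K) b'B Bri.
  rewrite /over /= b'B; first exact: h0phi.
  by move=> [j [jj /r_inj ji]]; apply: nii; rewrite -ji.
- move=> i x ii ix; have Bx : B x by exists i.
  rewrite /= -[RHS]b'K onT//.
  exact: id_off_stab (can_inj b'K) b'B Bx.
Qed.

(** The support meets only finitely many classes and lies inside C. *)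
Definition finsupp h :=
  [/\ G h, id_off C h & exists W, forall i x, W <= i -> Del (r i) x -> h x = x].

Lemma finsupp_id : finsupp idfun.
Proof. by split=> //; [exact: (perm_group_id pG)|exists 0]. Qed.

Lemma finsupp_comp g h : finsupp g -> finsupp h -> finsupp (g \o h).
Proof.
move=> [Gg gC [W gW]] [Gh hC [V hV]]; split.
- exact: perm_group_comp.
- exact: id_off_comp.
exists (maxn W V) => i x; rewrite geq_max => /andP[Wi Vi] ix /=.
by rewrite (hV i) ?(gW i).
Qed.

Lemma finsupp_inv g g' : finsupp g -> cancel g g' -> cancel g' g -> finsupp g'.
Proof.
move=> [Gg gC [W gW]] gK g'K; split.
- exact: (perm_group_inv pG Gg).
- exact: id_off_inv gC.
by exists W => i x Wi ix; rewrite -[in LHS](gW i x)// gK.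
Qed.

Lemma finsupp_inverse g : finsupp g ->
  exists g', [/\ finsupp g', cancel g g' & cancel g' g].
Proof.
move=> fg; have [Gg _ _] := fg.
have [g' [_ gK g'K]] := perm_group_inverse pG Gg.
by exists g'; split=> //; exact: finsupp_inv gK g'K.
Qed.

(** The permutation lifted is an (e+1)-cycle through a and b that avoids A. *)
Lemma finsupp_move (A : seq nat) a b : a \notin A -> b \notin A ->
  exists h, [/\ finsupp h, over h a b &
    forall i x, i \in A -> Del (r i) x -> h x = x].
Proof.
have [<- _ _|/eqP ab aA bA] := pselect (a = b).
  by exists id; split=> //; exact: finsupp_id.
have [W WA] := seq_bound (a :: b :: A).
pose p := a :: b :: iota W e.-1.
have up : uniq p.
  rewrite /= !inE negb_or ab iota_uniq !mem_iota andbT /=.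
  have := WA a; have := WA b; rewrite !inE !eqxx orbT => /(_ isT) + /(_ isT).
  by lia.
have sp : size p = e.+1 by rewrite /= size_iota; lia.
have bp : bijective (next p) by exists (prev p); [exact: prev_next|exact: next_prev].
have [|h [Gh hC hp hid]] := exact_lift bp.
  by move=> i; rewrite -sp iter_next_uniq.
have nextF i : i \notin p -> next p i = i by move=> ip; rewrite next_nth (negbTE ip).
exists h; split.
- split=> //; exists (W + e) => i x Wi; apply: hid; apply: nextF.
  rewrite !inE mem_iota.
  have := WA a; have := WA b; rewrite !inE !eqxx orbT => /(_ isT) + /(_ isT).
  by lia.
- by have := hp a; rewrite /= eqxx.
- move=> i x iA; apply: hid; apply: nextF.
  rewrite !inE mem_iota !negb_or.
  have := WA i; rewrite !inE iA !orbT => /(_ isT) iW.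
  apply/and3P; split; [| |by lia].
    by apply: contraNneq aA => <-.
  by apply: contraNneq bA => <-.
Qed.

(** The classes are sent to their targets one at a time, by moves that fix
    pointwise those already in place. *)
Lemma finsupp_transitive (A s : seq nat) (f : nat -> nat) : uniq s ->
  (forall i, i \in s -> i \notin A /\ f i \notin A) ->
  {in s &, injective f} ->
  exists h, [/\ finsupp h, forall i, i \in s -> over h i (f i) &
    forall i x, i \in A -> Del (r i) x -> h x = x].
Proof.
elim: s => [|a s IHs] /=.
  by move=> _ _ _; exists id; split=> //; exact: finsupp_id.
move=> /andP[nas us] sA fI.
have [||h [fh hs hA]] := IHs us.
- by move=> i si; apply: sA; rewrite inE si orbT.
- by move=> i j si sj; apply: fI; rewrite inE ?si ?sj orbT.
have [Gh hC _] := fh.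
have [h' [fh' hK h'K]] := finsupp_inverse fh; have [Gh' _ _] := fh'.
have Ca : C (h (r a)).
  by apply: id_off_stab (can_inj hK) hC _; apply/CE; exists a; exact: r_refl.
have [c ac] := (CE _).1 Ca.
have [aA faA] := sA a (mem_head _ _).
have ncA : c \notin A.
  apply/negP => cA; have : h' (h (r a)) = h (r a).
    by rewrite -[in LHS](hA c _ cA ac) !hK.
  rewrite hK => E; move: ac; rewrite -E => /r_inj ca.
  by rewrite -ca cA in aA.
have ncs : c \notin [seq f i | i <- s].
  apply/mapP => -[i si ci]; have hi := hs i si; rewrite -ci in hi.
  have H1 := over_inv Gh' hK hi; have H2 := over_inv Gh' hK ac.
  by move: nas; rewrite -(over_inj H1 H2) si.
have nfs : f a \notin [seq f i | i <- s].
  apply/mapP => -[i si]; have si' : i \in a :: s by rewrite inE si orbT.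
  by move=> /(fI a i (mem_head _ _) si') ai; rewrite ai si in nas.
have [||g [fg gac gA]] := @finsupp_move (A ++ [seq f i | i <- s]) c (f a).
- by rewrite mem_cat negb_or ncA.
- by rewrite mem_cat negb_or faA.
have [Gg _ _] := fg.
exists (g \o h); split.
- exact: finsupp_comp.
- move=> i; rewrite inE => /orP[/eqP->|si]; first exact: over_comp ac gac.
  rewrite /over /= (gA (f i)); last exact: hs; first exact: hs.
  by rewrite mem_cat map_f ?orbT.
- move=> i x iA ix /=; rewrite (hA _ _ iA ix) (gA i)//.
  by rewrite mem_cat iA.
Qed.

Lemma finite_levels (s : seq X) : exists M, forall x i, x \in s -> Del (r i) x -> i < M.
Proof.
elim: s => [|y s [M IHs]]; first by exists 0.
have [[j jy]|nj] := pselect (exists j, Del (r j) y); last first.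
  exists M => x i; rewrite inE => /orP[/eqP-> iy|]; last exact: IHs.
  by case: nj; exists i.
exists (maxn M j.+1) => x i; rewrite inE => /orP[/eqP-> iy|xs ix].
  by rewrite (cl_inj iy jy) leq_maxr.
exact: leq_trans (IHs x i xs ix) (leq_maxl _ _).
Qed.

(** Conjugating by elements that fix class n pointwise and carry the other
    classes in the support of h further and further away, the limit is the
    restriction of h to class n. *)
Lemma finsupp_local n h : finsupp h -> over h n n -> G (on (Del (r n)) h).
Proof.
move=> fh hn; have [Gh hC [W hW]] := fh.
have [h' [Gh' hK h'K]] := perm_group_inverse pG Gh.
have clh x : Del (r n) x <-> Del (r n) (h x).
  split; first exact: over_cl hn.
  by move=> /(over_cl Gh' (over_inv Gh' hK hn)); rewrite hK.
apply: cG; first by apply: on_bij => //; exact: (perm_group_sub pG).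
move=> s; have [M sM] := finite_levels s.
pose S := [seq i <- iota 0 W | i != n].
have [|||x [[Gx xC _] xS xn]] := @finsupp_transitive [:: n] S (fun i => i + M + n.+1).
- by rewrite filter_uniq// iota_uniq.
- move=> i; rewrite mem_filter /= !inE => /andP[-> _]; split=> //.
  by apply/eqP; lia.
- by move=> i j _ _; lia.
have [x' [Gx' xK x'K]] := perm_group_inverse pG Gx.
have x'C : id_off C x' by exact: id_off_inv xC.
have {}xn y : Del (r n) y -> x y = y by apply: xn; rewrite mem_head.
have x'n y : Del (r n) y -> x' y = y by move=> ny; rewrite -[in LHS](xn _ ny) xK.
exists (x \o h \o x').
  by apply: (perm_group_comp pG) => //; apply: (perm_group_comp pG).
move=> y sy /=; have [ny|nny] := pselect (Del (r n) y).
  by rewrite onT// x'n// xn// -clh.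
rewrite onF//; suff E : h (x' y) = x' y by rewrite E x'K.
have [Cy|nCy] := pselect (C y); last by rewrite x'C ?hC.
have [j jy] := (CE y).1 Cy; have jM := sM _ _ sy jy.
have : C (x' y) by apply: id_off_stab (can_inj x'K) x'C Cy.
move=> /CE [i iy].
have [Wi|iW] := leqP W i; first exact: hW iy.
have jn : j <> n by move=> jn; rewrite jn in jy.
have [ni|/eqP nni] := eqVneq i n.
  exfalso; apply: jn; rewrite ni in iy; apply: cl_inj jy _.
  by rewrite -[y]x'K xn.
have iS : i \in S by rewrite mem_filter /= mem_iota; apply/andP; split=> //; exact/eqP.
have := over_cl Gx (xS i iS) iy; rewrite x'K => H.
by have := cl_inj jy H; lia.
Qed.

(** Any choice of finitely supported z n taking class 0 to class n is coherent,
    because two choices differ on class 0 by an element of the component. On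
    finitely many classes q agrees with some finitely supported g, up to
    elements which fix each of these classes and so belong to components. *)
Lemma straight_sections : exists z z' : nat -> X -> X,
  [/\ forall n, [/\ finsupp (z n), cancel (z n) (z' n) & cancel (z' n) (z n)],
      forall n, over (z n) 0 n, z 0 = id &
      forall (phi : nat -> nat) (q : X -> X), bijective phi -> id_off C q ->
        (forall n x, Del (r n) x -> q x = z (phi n) (z' n x)) -> G q].
Proof.
have /choice[z zP] n : exists h, [/\ finsupp h, over h 0 n & n = 0 -> h = id].
  case: n => [|n]; first by exists id; split=> //; exact: finsupp_id.
  have [//|//|h [fh hn _]] := @finsupp_move [::] 0 n.+1.
  by exists h; split.
have /choice[z' z'P] n : exists h, [/\ finsupp h, cancel (z n) h & cancel h (z n)].
  by have [fz _ _] := zP n; exact: finsupp_inverse.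
exists z, z'; split.
- by move=> n; have [? _ _] := zP n; have [_ ? ?] := z'P n; split.
- by move=> n; have [] := zP n.
- by have [_ _] := zP 0; exact.
have z'0 n : over (z' n) n 0.
  have [[Gz _ _] zn _] := zP n; have [[Gz' _ _] zK _] := z'P n.
  exact: (over_inv Gz' zK zn).
have straight phi q : bijective phi -> id_off C q ->
    (forall n x, Del (r n) x -> q x = z (phi n) (z' n x)) ->
    forall n x, Del (r n) x -> Del (r (phi n)) (q x).
  move=> bphi qC qE n x nx; rewrite (qE n)//.
  have [[Gz _ _] zn _] := zP (phi n); have [[Gz' _ _] zK _] := z'P n.
  exact: (over_cl Gz zn (over_cl Gz' (z'0 n) nx)).
move=> phi q [psi phiK psiK] qC qE.
(* the inverse of q is the same construction with the inverse of phi *)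
pose q' x := if pselect (exists n, Del (r n) x) is left H then
  z (psi (projT1 (cid H))) (z' (projT1 (cid H)) x) else x.
have q'C : id_off C q'.
  by move=> x nC; rewrite /q'; case: pselect => // H; case: nC; exact/CE.
have q'E n x : Del (r n) x -> q' x = z (psi n) (z' n x).
  move=> nx; rewrite /q'; case: pselect => [H|[]]; last by exists n.
  by case: (cid H) => m mx /=; rewrite (cl_inj mx nx).
have can_straight (al be : nat -> nat) f f' : cancel al be -> bijective al ->
    id_off C f -> (forall n x, Del (r n) x -> f x = z (al n) (z' n x)) ->
    id_off C f' -> (forall n x, Del (r n) x -> f' x = z (be n) (z' n x)) ->
    cancel f f'.
  move=> alK bal fC fE f'C f'E x; have [Cx|nCx] := pselect (C x); last first.
    by rewrite fC ?f'C.
  have [n nx] := (CE x).1 Cx.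
  rewrite (f'E (al n)); last exact: (straight al).
  rewrite (fE n)// alK; have [_ -> _] := z'P (al n).
  by have [_ _ ->] := z'P n.
have bphi := Bijective phiK psiK.
have qK : cancel q q' by exact: (can_straight phi psi).
have q'K : cancel q' q.
  by apply: (can_straight psi phi) => //; exact: Bijective psiK phiK.
apply: cG; first by exists q'.
move=> s; have [M sM] := finite_levels s.
have [|||g [fg gphi _]] := @finsupp_transitive [::] (iota 0 M) phi.
- exact: iota_uniq.
- by [].
- by move=> i j _ _; exact: (can_inj phiK).
have [g' [fg' gK g'K]] := finsupp_inverse fg.
have [Gg gC _] := fg; have [Gg' g'C _] := fg'.
have {}gphi n : n < M -> over g n (phi n) by move=> nM; apply: gphi; rewrite mem_iota.
pose B : set X := [set x | exists n, n < M /\ Del (r n) x].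
have g'q n x : n < M -> Del (r n) x <-> Del (r n) (g' (q x)).
  move=> nM; have H := over_inv Gg' gK (gphi n nM); split=> nx.
    by apply: (over_cl Gg' H); exact: (straight phi).
  have := over_cl Gg (gphi n nM) nx; rewrite g'K => Hq.
  have := straight psi q' (Bijective psiK phiK) q'C q'E _ _ Hq.
  by rewrite qK phiK.
have Gb : G (on B (g' \o q)).
  apply: (glue_classes pG cG Dsym Dtrans).
  - by move=> x [i [_ /Del_refl]].
  - by move=> x y [i [ii ix]] xy; exists i; split=> //; exact: Dtrans xy.
  - apply: on_bij; first by apply: (bij_comp (Bijective g'K gK) (Bijective qK q'K)).
    move=> x; split=> -[n [nM nx]]; exists n; split=> //.
      exact: (g'q n x nM).1.
    exact: (g'q n x nM).2.
  move=> x [n [nM nx]].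
  have [fzn zphi _] := zP (phi n); have [Gz _ _] := fzn.
  have [fz'n _ _] := z'P n; have [Gz' _ _] := fz'n.
  have fu := finsupp_comp fg' (finsupp_comp fzn fz'n).
  have un : over (g' \o (z (phi n) \o z' n)) n n.
    apply: (over_comp Gg' _ (over_inv Gg' gK (gphi n nM))).
    exact: (over_comp Gz (z'0 n)).
  suff <- : on (Del (r n)) (g' \o (z (phi n) \o z' n)) = on (Del x) (g' \o q).
    exact: finsupp_local.
  apply: eq_on => y; last by move=> ny; rewrite /= (qE n).
  by split=> xy; [apply: Dtrans (Dsym nx) _|exact: Dtrans xy].
exists (g \o on B (g' \o q)); first exact: perm_group_comp.
move=> x xs /=; have [Cx|nCx] := pselect (C x).
  have [n nx] := (CE x).1 Cx.
  by rewrite onT /= ?g'K//; exists n; split=> //; exact: sM nx.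
by rewrite onF ?gC ?qC// => -[n [_ nx]]; apply: nCx; apply/CE; exists n.
Qed.

End Spread.

(** * Omega-partitions of groups supported in a subset *)

Lemma on_conj (X : Type) (A : set X) (g g' h : X -> X) :
  cancel g g' -> cancel g' g -> (forall x, A x <-> A (g x)) ->
  injective h -> id_off A h ->
  on A g \o h \o on A g' = g \o h \o g'.
Proof.
move=> gK g'K gA hI hA; apply/funext => x /=.
have g'A y : A y <-> A (g' y) by rewrite [X in _ <-> X]gA g'K.
have [Ax|nAx] := pselect (A x).
  by rewrite (onT _ Ax) onT//; exact: (id_off_stab hI hA ((g'A x).1 Ax)).
rewrite (onF _ nAx) (hA _ nAx) (onF _ nAx) (hA (g' x)) ?g'K//.
by move=> /(g'A x).
Qed.

Lemma cancel_unique (X : Type) (g g' g'' : X -> X) :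
  cancel g g' -> cancel g'' g -> g'' = g'.
Proof. by move=> gK gK'; apply/funext => x; rewrite -[in RHS](gK' x) gK. Qed.

Lemma normalizes_local_subgroup (X : Type) (A : set X) (g : X -> X) G :
  perm_group G -> (forall x, A x <-> A (g x)) -> normalizes g G ->
  normalizes g (local_subgroup G A).
Proof.
move=> pG gA ng g' gK g'K h [Gh hA]; have [H1 H2] := ng _ gK g'K _ Gh.
split; split=> // x nAx /=.
  by rewrite hA ?g'K// gA g'K.
by rewrite hA ?gK// -gA.
Qed.

Lemma normalizes_on (X : Type) (A : set X) (g : X -> X) G :
  perm_group G -> bijective g -> (forall x, A x <-> A (g x)) ->
  normalizes g G -> normalizes (on A g) (local_subgroup G A).
Proof.
move=> pG [g' gK g'K] gA ng p' pK p'K h lh.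
have g'A y : A y <-> A (g' y) by rewrite [X in _ <-> X]gA g'K.
have -> : p' = on A g'.
  by apply: (cancel_unique _ p'K); apply: on_cancel => // x; rewrite -gA.
have [Gh hA] := lh; have hI := bij_inj (perm_group_sub pG Gh).
rewrite (on_conj gK g'K gA hI hA) (on_conj g'K gK g'A hI hA).
exact: (normalizes_local_subgroup pG gA ng gK g'K lh).
Qed.

Lemma normalizes_iter_mul (X : Type) (G : set (X -> X)) (g p : X -> X) n :
  perm_group G -> G g -> bijective p -> normalizes p G ->
  exists2 h, G h & iter n (g \o p) = h \o iter n p.
Proof.
move=> pG Gg [p' pK p'K] np; elim: n => [|n [h Gh IHn]].
  by exists idfun => //; exact: (perm_group_id pG).
exists (g \o (p \o h \o p')).
  exact: (perm_group_comp pG Gg (np _ pK p'K _ Gh).1).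
by apply/funext => x; rewrite iterS IHn /= pK.
Qed.

Lemma seq_pigeonhole (T : eqType) (s : seq T) (f : nat -> T) :
  (forall i, i <= size s -> f i \in s) ->
  exists i j, [/\ i < j, j <= size s & f i = f j].
Proof.
move=> fs; have [[i [j [ij js fij]]]|H] :=
    pselect (exists i j, [/\ i < j, j <= size s & f i = f j]).
  by exists i, j.
have us : uniq [seq f i | i <- iota 0 (size s).+1].
  rewrite map_inj_in_uniq ?iota_uniq// => i j; rewrite !mem_iota /= !add0n !ltnS.
  move=> ins js fij; case: (ltngtP i j) => // ij; exfalso; apply: H.
    by exists i, j.
  by exists j, i.
have := uniq_leq_size us; rewrite size_map size_iota => /(_ s).
rewrite ltnn => H'; suff : false by []; apply: H' => x /mapP[i].
by rewrite mem_iota /= add0n ltnS => /fs fi ->.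
Qed.

(** Up to E the orbit of x has at most [size s] points, so its length divides
    the factorial of [size s]. *)
Lemma iter_orbit_fact (T : eqType) (E : T -> T -> Prop) (s : seq T) (p : T -> T) x :
  (forall a b, E a b -> E b a) -> (forall a b c, E a b -> E b c -> E a c) ->
  (forall a b, E a b <-> E (p a) (p b)) ->
  (forall i, exists2 y, y \in s & E (iter i p x) y) ->
  E x (iter (size s)`! p x).
Proof.
move=> Es Et Ep H; have Ei i a b : E a b <-> E (iter i p a) (iter i p b).
  by elim: i => //= i ->; exact: Ep.
have {H}/choice[f fP] i : exists y, y \in s /\ E (iter i p x) y.
  by have [y] := H i; exists y.
have [i [j [ij js fij]]] := seq_pigeonhole (fun i _ => (fP i).1).
have Ex : E x (iter (j - i) p x).
  apply/(Ei i); rewrite -iterD subnKC; last exact: ltnW.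
  apply: (Et _ _ _ (fP i).2); rewrite fij; exact: (Es _ _ (fP j).2).
have /dvdnP[k ->] : j - i %| (size s)`! by apply: dvdn_fact; lia.
rewrite iterM; have Exx : E x x by exact: (Et _ _ _ Ex (Es _ _ Ex)).
elim: k => // k IHk; rewrite iterS.
apply: (Et _ _ _ Ex); exact: (Ei (j - i) _ _).1 IHk.
Qed.

Lemma common_multiple (T : eqType) (s : seq T) (f : T -> nat) :
  (forall y, 0 < f y) -> exists2 e, 0 < e & forall y, y \in s -> f y %| e.
Proof.
move=> f0; elim: s => [|a s [e e0 IHs]]; first by exists 1.
exists (f a * e); first by rewrite muln_gt0 f0.
move=> y; rewrite inE => /orP[/eqP->|/IHs ye]; first exact: dvdn_mulr.
exact: dvdn_mull.
Qed.

Definition swap_nat (i j n : nat) : nat :=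
  if n == i then j else if n == j then i else n.

Lemma swap_natK i j : involutive (swap_nat i j).
Proof.
move=> n; rewrite /swap_nat; have [->|ni] := eqVneq n i.
  by rewrite eqxx; case: eqP.
have [->|nj] := eqVneq n j; first by rewrite eqxx.
by rewrite (negbTE ni) (negbTE nj).
Qed.

Lemma swap_natL i j : swap_nat i j i = j.
Proof. by rewrite /swap_nat eqxx. Qed.

(** An omega-partition of G in terms of elements instead of quotients. The
    relations hold only between points of D outside K; the number of classes
    and fullness are expressed by one enumeration r of representatives of the
    Del-classes inside a nab-class. *)
Record partition_on (X : eqType) (D : set X) (G : set (X -> X)) (K : set X)
    (nab Del : X -> X -> Prop) : Prop := PartitionOn {
  part_KD : K `<=` D;
  part_Kfin : exists s : seq X, forall x, K x -> x \in s;
  part_Kinv : forall g x, G g -> K x -> K (g x);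
  part_nab_sym : forall x y, nab x y -> nab y x;
  part_nab_trans : forall x y z, nab x y -> nab y z -> nab x z;
  part_Del_sym : forall x y, Del x y -> Del y x;
  part_Del_trans : forall x y z, Del x y -> Del y z -> Del x z;
  part_Del_nab : forall x y, Del x y -> nab x y;
  part_nab_dom : forall x y, nab x y -> D x /\ ~ K x;
  part_Del_refl : forall x, D x -> ~ K x -> Del x x;
  part_nab_inv : forall g x y, G g -> nab x y -> nab (g x) (g y);
  part_Del_inv : forall g x y, G g -> Del x y -> Del (g x) (g y);
  part_nab_fin : exists s : seq X, forall x, nab x x ->
    exists2 y, y \in s & nab x y;
  part_spread : forall x, nab x x -> exists r : nat -> X,
    [/\ forall i, nab x (r i), forall i j, Del (r i) (r j) -> i = j,
        forall y, nab x y -> exists i, Del (r i) y &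
        forall phi : nat -> nat, bijective phi -> exists g,
          [/\ G g, id_off (nab x) g & forall i, Del (r (phi i)) (g (r i))]] }.

(** The class H_(m-1) for groups of permutations of X supported in D. The
    components are subgroups of G, so the induction stays inside one type. *)
Fixpoint class_H_on (m : nat) (X : eqType) (D : set X) (G : set (X -> X)) : Prop :=
  if m is n.+1 then
    [/\ perm_group G, forall g, G g -> id_off D g, fin_closed G &
        exists K nab Del, partition_on D G K nab Del /\
          forall x, Del x x -> class_H_on n (Del x) (local_subgroup G (Del x))]
  else False.

(** The quotient by G of the normalizer of G in Sym(D) is killed by e. *)
Definition has_exponent (X : Type) (D : set X) (G : set (X -> X)) (e : nat) : Prop :=
  forall p, bijective p -> id_off D p -> normalizes p G -> G (iter e p).

Definition finite_orbits (X : eqType) (D : set X) (G : set (X -> X)) : Prop :=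
  exists s : seq X, forall x, D x -> exists2 g, G g & g x \in s.

Section Partition.
Variables (X : eqType) (D : set X) (G : set (X -> X)) (K : set X).
Variables (nab Del : X -> X -> Prop).
Hypotheses (pG : perm_group G) (GD : forall g, G g -> id_off D g).
Hypothesis (cG : fin_closed G).
Hypothesis (P : partition_on D G K nab Del).

Lemma Del_class x y : Del x y -> Del x x.
Proof. by move=> xy; exact: (part_Del_trans P xy (part_Del_sym P xy)). Qed.

Lemma nab_class x y : nab x y -> nab x x.
Proof. by move=> xy; exact: (part_nab_trans P xy (part_nab_sym P xy)). Qed.

Lemma nab_Del x : nab x x -> Del x x.
Proof. by move=> /(part_nab_dom P)[Dx nKx]; exact: (part_Del_refl P). Qed.

Lemma Del_dom x y : Del x y -> D x /\ ~ K x.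
Proof. by move=> /(part_Del_nab P); exact: (part_nab_dom P). Qed.

Lemma class_eq x y z : Del x y -> Del x z <-> Del y z.
Proof.
move=> xy; split; last exact: (part_Del_trans P).
exact: (part_Del_trans P (part_Del_sym P xy)).
Qed.

Lemma nab_transitive x y : nab x y ->
  exists g, [/\ G g, id_off (nab x) g & Del y (g x)].
Proof.
move=> xy; have [r [_ _ rs full]] := part_spread P (nab_class xy).
have [i ix] := rs _ (nab_class xy); have [j jy] := rs _ xy.
have [g [Gg gC gr]] := full _ (inv_bij (swap_natK i j)).
exists g; split=> //; apply: (part_Del_trans P (part_Del_sym P jy)).
have := gr i; rewrite swap_natL => H.
exact: (part_Del_trans P H (part_Del_inv P Gg ix)).
Qed.

Lemma has_exponentM A e k : perm_group (local_subgroup G A) ->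
  has_exponent A (local_subgroup G A) e -> has_exponent A (local_subgroup G A) (k * e).
Proof.
move=> pA H p bp pA' np.
have -> : iter (k * e) p = iter k (iter e p) by apply/funext => x; rewrite iterM.
by apply: perm_group_iter => //; exact: (H p bp).
Qed.

(** Components at points of one nab-class are conjugate in G. *)
Lemma has_exponent_nab x y e : nab x y ->
  has_exponent (Del y) (local_subgroup G (Del y)) e ->
  has_exponent (Del x) (local_subgroup G (Del x)) e.
Proof.
move=> xy H p bp pA np; have [g [Gg _ yg]] := nab_transitive xy.
have [g' [Gg' gK g'K]] := perm_group_inverse pG Gg.
have ng := group_normalizes pG Gg.
have clg z : Del x z <-> Del y (g z).
  rewrite (class_eq _ yg); split; first exact: (part_Del_inv P Gg).
  by move/(part_Del_inv P Gg'); rewrite !gK.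
have clg' z : Del x (g' z) <-> Del y z by rewrite clg g'K.
have conj_loc h : local_subgroup G (Del x) h -> local_subgroup G (Del y) (g \o h \o g').
  move=> [Gh hA]; split; first exact: (ng _ gK g'K _ Gh).1.
  by move=> z nz /=; rewrite hA ?g'K// clg'.
have conj_loc' h : local_subgroup G (Del y) h ->
    local_subgroup G (Del x) (g' \o h \o g).
  move=> [Gh hA]; split; first exact: (ng _ gK g'K _ Gh).2.
  by move=> z nz /=; rewrite hA ?gK// -clg.
pose q := g \o p \o g'.
have qi : g' \o iter e q \o g = iter e p.
  apply/funext => z /=; suff -> : iter e q (g z) = g (iter e p z) by rewrite gK.
  by elim: (e) => //= n ->; rewrite /q /= gK.
rewrite -qi; apply: (conj_loc'); apply: H.
- by apply: (bij_comp (bij_comp (Bijective gK g'K) bp) (Bijective g'K gK)).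
- by move=> z nz; rewrite /q /= pA ?g'K// clg'.
move=> q' qK q'K h lh; have [p' pK p'K] := bp.
have -> : q' = g \o p' \o g'.
  by apply: (cancel_unique _ q'K) => z; rewrite /q /= !gK pK g'K.
have [H1 H2] := np _ pK p'K _ (conj_loc' _ lh).
by split; [move/conj_loc: H1|move/conj_loc: H2]; congr local_subgroup;
  apply/funext => z; rewrite /q /= !gK !g'K.
Qed.

Lemma common_exponent :
  (forall x, Del x x ->
    exists2 e, 0 < e & has_exponent (Del x) (local_subgroup G (Del x)) e) ->
  exists2 e, 0 < e &
    forall x, Del x x -> has_exponent (Del x) (local_subgroup G (Del x)) e.
Proof.
move=> H; have [s sP] := part_nab_fin P.
have /choice[f fP] x : exists e, 0 < e /\
    (Del x x -> has_exponent (Del x) (local_subgroup G (Del x)) e).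
  have [/H[e e0 eP]|nx] := pselect (Del x x); first by exists e.
  by exists 1.
have [e e0 eP] := common_multiple s (fun y => (fP y).1).
exists e => // x /(part_Del_nab P) /sP[y ys xy].
have /dvdnP[k ->] := eP y ys.
apply: (has_exponent_nab xy); apply: has_exponentM.
  exact: local_subgroup_perm_group.
by apply: (fP y).2; apply: nab_Del; apply: (nab_class (part_nab_sym P xy)).
Qed.

Section Exponent.
Variable e : nat.
Hypotheses (e_gt0 : 0 < e)
  (compE : forall x, Del x x -> has_exponent (Del x) (local_subgroup G (Del x)) e).

(** An element fixing a class normalizes the component there. *)
Lemma component_power g x : G g -> Del x (g x) -> G (on (Del x) (iter e g)).
Proof.
move=> Gg xg; have bg := perm_group_sub pG Gg.
have gD y : Del x y <-> Del x (g y).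
  rewrite [X in _ <-> X](class_eq _ xg); split; first exact: (part_Del_inv P Gg).
  have [g' [Gg' gK g'K]] := perm_group_inverse pG Gg.
  by move/(part_Del_inv P Gg'); rewrite !gK.
rewrite -on_iter; last by move=> y /gD.
apply: (compE (Del_class xg) _ _ _).1.
- exact: on_bij.
- exact: on_id_off.
- exact: (normalizes_on pG bg gD (group_normalizes pG Gg)).
Qed.

(** This is [finsupp_move] with representatives replaced by arbitrary points;
    F lists representatives of the classes that h does not fix pointwise. *)
Lemma move_class (A : seq X) a b : nab a b ->
  (forall y, y \in A -> ~ Del y a /\ ~ Del y b) ->
  exists h, [/\ G h, id_off (nab a) h, Del b (h a),
    forall y, y \in A -> h y = y &
    exists F : seq X, forall z, h z <> z -> exists2 y, y \in F & Del y z].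
Proof.
move=> ab Aab; have [r [nr rI rs full]] := part_spread P (nab_class ab).
have rrefl i : Del (r i) (r i).
  by apply: nab_Del; apply: (nab_class (part_nab_sym P (nr i))).
have CE x : nab a x <-> exists i, Del (r i) x.
  split; first exact: rs.
  by move=> [i /(part_Del_nab P)]; exact: (part_nab_trans P (nr i)).
have [i ia] := rs _ (nab_class ab); have [j jb] := rs _ ab.
have Dsym := part_Del_sym P; have Dtrans := part_Del_trans P.
have [M AM] := finite_levels Dsym Dtrans rI A.
pose A' := [seq n <- iota 0 M | (n != i) && (n != j)].
have [||h [[Gh hC [W hW]] hab hA]] := @finsupp_move X G (nab a) Del r e pG cG
    Dsym Dtrans (part_Del_inv P) rrefl rI CE full e_gt0 component_power A' i j.
- by rewrite mem_filter eqxx.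
- by rewrite mem_filter eqxx andbF.
exists h; split=> //.
- apply: (Dtrans _ _ _ (Dsym _ _ jb)).
  exact: (Dtrans _ _ _ hab (part_Del_inv P Gh ia)).
- move=> y yA; have [ay|nay] := pselect (nab a y); last exact: hC.
  have [n ny] := rs _ ay; apply: (hA n) => //.
  have [nya nyb] := Aab y yA.
  rewrite mem_filter mem_iota /= add0n (AM y)// andbT.
  by apply/andP; split; apply/eqP => nE; rewrite nE in ny;
    [apply: nya|apply: nyb]; apply: (Dtrans _ _ _ (Dsym _ _ ny)).
exists [seq r n | n <- iota 0 W] => z hz.
have [az|/hC//] := pselect (nab a z).
have [n nz] := rs _ az; exists (r n) => //; apply/map_f.
rewrite mem_iota /= add0n ltnNge; apply/negP => Wn; apply: hz.
exact: (hW _ _ Wn nz).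
Qed.

Hypothesis (compF :
  forall x, Del x x -> finite_orbits (Del x) (local_subgroup G (Del x))).

(** * Canonicity of omega-partitions *)

Section NormalizerKernel.
Variables (q q' : X -> X).
Hypotheses (qK : cancel q q') (q'K : cancel q' q) (qD : id_off D q).
Hypothesis (nq : normalizes q G).

(** Points of K have finite orbits under G, points outside K do not. *)
Lemma normalizes_kernel x : K x -> K (q x).
Proof.
move=> Kx; apply: contrapT => nKq.
have Dq : D (q x).
  by apply: (id_off_stab (can_inj qK) qD _); exact: (part_KD P).
have nqq := part_Del_nab P (part_Del_refl P Dq nKq).
have [r [nr rI _ _]] := part_spread P nqq.
have /choice[g gP] i : exists g, G g /\ Del (r i) (g (q x)).
  by have [g [Gg _ gq]] := nab_transitive (nr i); exists g.
have [s sP] := part_Kfin P.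
have [|i [j [ij _ E]]] := @seq_pigeonhole _ s (fun i => q' (g i (q x))).
  move=> i _; apply: sP; have [Gg _] := gP i.
  exact: (part_Kinv P (nq qK q'K Gg).2 Kx).
move/(can_inj q'K) in E; have := (gP j).2; rewrite -E => gjq.
have := part_Del_trans P (gP i).2 (part_Del_sym P gjq) => /rI.
by lia.
Qed.

End NormalizerKernel.

Section NormalizerDel.
Variables (q q' : X -> X).
Hypotheses (qK : cancel q q') (q'K : cancel q' q) (qD : id_off D q).
Hypothesis (nq : normalizes q G).

Let q'D : id_off D q' := id_off_inv qK qD.
Let nq' : normalizes q' G := normalizes_inv qK q'K nq.

(** Write Del' for the image of Del under q. If a Del'-class meets two
    Del-classes of a nab-class, then moving one of them while fixing the other
    shows that it meets all. Infinitely many conjugates of this Del'-class have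
    the same property, for one of the finitely many nab-classes. An element of
    the component at c fixes the points outside the class of c, hence preserves
    each Del'-class that meets another Del-class; so the orbits of the
    components, being finite in number, cannot separate infinitely many
    Del'-classes. *)
Lemma normalizes_Del_same_nab x y : nab x y -> Del (q' x) (q' y) -> Del x y.
Proof.
move=> xy dxy; apply: contrapT => ndxy.
pose Del' u v := Del (q' u) (q' v).
have Dinv' g u v : G g -> Del' u v -> Del' (g u) (g v).
  move=> Gg; rewrite /Del' => /(part_Del_inv P (nq qK q'K Gg).2) /=.
  by rewrite !q'K.
have Dsym' u v : Del' u v -> Del' v u by exact: (part_Del_sym P).
have Dtrans' u v w : Del' u v -> Del' v w -> Del' u w by exact: (part_Del_trans P).
have nqq := part_Del_nab P (Del_class dxy).
have [r [nr rI _ _]] := part_spread P nqq.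
have /choice[g gP] i : exists g, G g /\ Del (r i) (q' (g x)).
  have [g [Gg _ gq]] := nab_transitive (nr i).
  by exists (q \o g \o q'); rewrite /= qK; split=> //; have [] := nq qK q'K Gg.
have xI i j : Del' (g i x) (g j x) -> i = j.
  move=> H; apply: rI; apply: (part_Del_trans P (gP i).2).
  exact: (part_Del_trans P H (part_Del_sym P (gP j).2)).
have [s sP] := part_nab_fin P.
have /choice[o oP] c : exists o : seq X, Del c c ->
    forall t, Del c t -> exists2 h, local_subgroup G (Del c) h & h t \in o.
  have [/compF[o oP]|nc] := pselect (Del c c); first by exists o.
  by exists [::].
have /choice[w wP] i : exists w, w \in flatten [seq o c | c <- s] /\ Del' (g i x) w.
  have [Gg _] := gP i; set u := g i x; set v := g i y.
  have uv : nab u v by exact: (part_nab_inv P Gg xy).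
  have duv : Del' u v by exact: (Dinv').
  have nduv : ~ Del u v.
    have [g' [Gg' gK _]] := perm_group_inverse pG Gg.
    by move/(part_Del_inv P Gg'); rewrite /u /v !gK.
  have [c cs uc] := sP _ (nab_class uv).
  have dc : Del c c by apply: nab_Del; apply: (nab_class (part_nab_sym P uc)).
  have [t [ut ct]] : exists t, Del' u t /\ Del c t.
    have [cu|ncu] := pselect (Del c u).
      by exists u; split=> //; exact: (Dtrans' _ _ _ duv (Dsym' _ _ duv)).
    have [cv|ncv] := pselect (Del c v); first by exists v.
    have vc : nab v c by exact: (part_nab_trans P (part_nab_sym P uv) uc).
    have [|h [Gh _ hv hu _]] := @move_class [:: u] v c vc.
      move=> z; rewrite inE => /eqP ->; split=> //.
      by move/(part_Del_sym P).
    exists (h v); split=> //.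
    by have := Dinv' _ _ _ Gh duv; rewrite (hu u) ?mem_head.
  have [h [Gh hc] ho] := oP c dc t ct.
  exists (h t); split; first by apply/flattenP; exists (o c) => //; exact: map_f.
  have [f [uf ncf]] : exists f, Del' u f /\ ~ Del c f.
    have [cu|ncu] := pselect (Del c u).
      exists v; split=> // cv; apply: nduv.
      exact: (part_Del_trans P (part_Del_sym P cu)).
    by exists u; split=> //; exact: (Dtrans' _ _ _ duv (Dsym' _ _ duv)).
  have := Dinv' _ _ _ Gh (Dtrans' _ _ _ (Dsym' _ _ uf) ut).
  by rewrite (hc f ncf); exact: (Dtrans').
have [i [j [ij _ E]]] := seq_pigeonhole (fun i _ => (wP i).1).
suff : i = j by lia.
apply: xI; apply: (Dtrans' _ _ _ (wP i).2); rewrite E.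
exact: (Dsym' _ _ (wP j).2).
Qed.

(** If x and y were in different nab-classes, moving the class of y inside its
    nab-class would fix x and produce a point related to y by Del' and by nab,
    but not by Del. *)
Lemma normalizes_Del_inv x y : Del (q' x) (q' y) -> Del x y.
Proof.
move=> dxy; apply: (normalizes_Del_same_nab _ dxy); apply: contrapT => nxy.
have /(Del_dom)[Dy' nKy'] := part_Del_sym P dxy.
have nKy : ~ K y by move=> Ky; apply: nKy'; exact: (normalizes_kernel q'K qK q'D nq').
have Dy : D y by rewrite -(q'K y); exact: (id_off_stab (can_inj qK) qD Dy').
have nyy := part_Del_nab P (part_Del_refl P Dy nKy).
have [r [nr rI _ _]] := part_spread P nyy.
have [y2 [yy2 nyy2]] : exists y2, nab y y2 /\ ~ Del y y2.
  have [y0|ny0] := pselect (Del y (r 0)); last by exists (r 0).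
  exists (r 1); split=> // y1.
  by have /rI := part_Del_trans P (part_Del_sym P y0) y1.
have [//|h [Gh hC hy _ _]] := @move_class [::] y y2 yy2.
have hx : h x = x by apply: hC => /(part_nab_sym P).
have xhy : Del (q' x) (q' (h y)).
  have := part_Del_inv P (nq qK q'K Gh).2 dxy.
  by rewrite /= !q'K hx.
have yhy : Del (q' y) (q' (h y)) by exact: (part_Del_trans P (part_Del_sym P dxy)).
have nyhy : nab y (h y).
  exact: (part_nab_trans P yy2 (part_Del_nab P hy)).
apply: nyy2; apply: (part_Del_trans P (normalizes_Del_same_nab nyhy yhy)).
exact: (part_Del_sym P).
Qed.

End NormalizerDel.

Section NormalizerNab.
Variables (q q' : X -> X).
Hypotheses (qK : cancel q q') (q'K : cancel q' q) (qD : id_off D q).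
Hypothesis (nq : normalizes q G).

Let q'D : id_off D q' := id_off_inv qK qD.
Let nq' : normalizes q' G := normalizes_inv qK q'K nq.

Lemma normalizes_Del x y : Del x y <-> Del (q x) (q y).
Proof.
split; first by rewrite -{1}(qK x) -{1}(qK y); exact: normalizes_Del_inv.
exact: (normalizes_Del_inv q'K qK q'D nq').
Qed.

(** Let nab' be the image of nab under q. An element that moves the class of x
    onto the class of y and fixes all but finitely many classes fixes a point
    of the nab'-class of x, hence preserves this nab'-class. *)
Lemma normalizes_nab_inv x y : nab x y -> nab (q' x) (q' y).
Proof.
move=> xy; apply: contrapT => nxy.
pose nab' u v := nab (q' u) (q' v).
have ninv' g u v : G g -> nab' u v -> nab' (g u) (g v).
  move=> Gg; rewrite /nab' => /(part_nab_inv P (nq qK q'K Gg).2) /=.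
  by rewrite !q'K.
have ntrans' u v w : nab' u v -> nab' v w -> nab' u w by exact: (part_nab_trans P).
have Del_nab' u v : Del u v -> nab' u v.
  move=> uv; apply: (part_Del_nab P); apply: (normalizes_Del _ _).2.
  by rewrite !q'K.
have [//|h [Gh hC hy _ [F FP]]] := @move_class [::] x y xy.
have nqq : nab (q' x) (q' x) by apply: Del_nab'; apply: nab_Del; exact: (nab_class xy).
have [r [nr rI _ _]] := part_spread P nqq.
have [i hi] : exists i, h (q (r i)) = q (r i).
  apply: contrapT => H.
  have /choice[f fP] i : exists f, f \in F /\ Del f (q (r i)).
    by have [|f] := FP (q (r i)); [move=> E; apply: H; exists i|exists f].
  have [i [j [ij _ E]]] := seq_pigeonhole (fun i _ => (fP i).1).
  have := (fP j).2; rewrite -E => fj.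
  have /((normalizes_Del _ _).2)/rI := part_Del_trans P (part_Del_sym P (fP i).2) fj.
  by lia.
have xz : nab' x (q (r i)) by rewrite /nab' qK.
have := ninv' _ _ _ Gh xz; rewrite hi => hxz.
apply: nxy; apply: (ntrans' _ (h x)).
  by apply: (ntrans' _ _ _ xz); exact: (part_nab_sym P).
by apply: Del_nab'; exact: (part_Del_sym P).
Qed.

End NormalizerNab.

(** Both the exponent of the normalizer and the passage to normal supergroups
    rest on this canonicity. *)
Lemma partition_canonical q : bijective q -> id_off D q -> normalizes q G ->
  [/\ forall x, K x <-> K (q x), forall x y, nab x y <-> nab (q x) (q y) &
      forall x y, Del x y <-> Del (q x) (q y)].
Proof.
move=> [q' qK q'K] qD nq; have q'D := id_off_inv qK qD.
have nq' := normalizes_inv qK q'K nq; split.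
- move=> x; split; first exact: (normalizes_kernel qK q'K qD nq).
  by move/(normalizes_kernel q'K qK q'D nq'); rewrite qK.
- move=> x y; split; first exact: (normalizes_nab_inv q'K qK q'D nq').
  by move/(normalizes_nab_inv qK q'K qD nq); rewrite !qK.
- exact: (normalizes_Del qK q'K qD nq).
Qed.

(** Fullness provides the element on one nab-class at a time. *)
Lemma match_classes q : bijective q -> (forall x, nab x x -> nab x (q x)) ->
  (forall x y, Del x y <-> Del (q x) (q y)) ->
  exists g, [/\ G g, forall z, ~ nab z z -> g z = z &
    forall z, nab z z -> Del (q z) (g z)].
Proof.
move=> [q' qK q'K] nq Dq; have [s sP] := part_nab_fin P.
suff [g [Gg gs gn]] : exists g, [/\ G g,
    forall z, (exists2 y, y \in s & nab y z) -> Del (q z) (g z) &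
    forall z, ~ (exists2 y, y \in s & nab y z) -> g z = z].
  exists g; split=> // z.
    by move=> nz; apply: gn => -[y ys /(part_nab_sym P)/nab_class].
  by move=> /sP[y ys zy]; apply: gs; exists y => //; exact: (part_nab_sym P).
elim: s {sP} => [|y s [g [Gg gs gn]]].
  by exists idfun; split=> // [|z []//]; exact: (perm_group_id pG).
have [yy|nyy] := pselect (nab y y); last first.
  exists g; split=> // z.
    move=> [x]; rewrite inE => /orP[/eqP->/nab_class//|xs xz].
    by apply: gs; exists x.
  by move=> H; apply: gn => -[x xs xz]; apply: H; exists x => //; rewrite inE xs orbT.
have [[w ws wy]|ns] := pselect (exists2 w, w \in s & nab w y).
  exists g; split=> // z.
    move=> [x]; rewrite inE => /orP[/eqP-> yz|xs xz]; apply: gs; last by exists x.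
    by exists w => //; exact: (part_nab_trans P wy).
  by move=> H; apply: gn => -[x xs xz]; apply: H; exists x => //; rewrite inE xs orbT.
have [r [nr rI rs full]] := part_spread P yy.
have ny i : nab y (q (r i)).
  apply: (part_nab_trans P (nr i)); apply: nq.
  exact: (nab_class (part_nab_sym P (nr i))).
have /choice[phi phiP] i := rs _ (ny i).
have nqi z : nab y z -> nab y (q' z).
  move=> yz; have zz := nab_class (part_nab_sym P yz).
  have dz : Del z z by exact: nab_Del.
  have : Del (q' z) (q' z) by apply: (Dq _ _).2; rewrite q'K.
  move=> /(part_Del_nab P)/nq; rewrite q'K => /(part_nab_sym P).
  exact: (part_nab_trans P).
have /choice[psi psiP] i := rs _ (nqi _ (nr i)).
have psiP' i : Del (q (r (psi i))) (r i) by rewrite -(q'K (r i)); exact: (Dq _ _).1.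
have bphi : bijective phi.
  exists psi => i; apply: rI.
    apply: (Dq _ _).2; apply: (part_Del_trans P (psiP' _)); exact: phiP.
  exact: (part_Del_trans P (phiP _)).
have [h [Gh hC hphi]] := full _ bphi.
have hz z : nab y z -> Del (q z) (h z).
  move=> yz; have [i iz] := rs _ yz.
  have H1 := part_Del_trans P (hphi i) (part_Del_inv P Gh iz).
  have H2 := (Dq _ _).1 iz.
  have H3 := part_Del_trans P (phiP i) H2.
  exact: (part_Del_trans P (part_Del_sym P H3) H1).
exists (h \o g); split; first exact: perm_group_comp.
  move=> z [x]; rewrite inE => /orP[/eqP-> yz|xs xz] /=.
    rewrite gn; first exact: hz.
    move=> [w ws wz]; apply: ns; exists w => //.
    exact: (part_nab_trans P wz (part_nab_sym P yz)).
  rewrite hC; first by apply: gs; exists x.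
  have H : Del (q z) (g z) by apply: gs; exists x.
  move=> ygz; apply: ns; exists x => //; apply: (part_nab_trans P xz).
  apply: (part_nab_trans P (nq z (nab_class (part_nab_sym P xz)))).
  apply: (part_nab_trans P (part_Del_nab P H)); exact: (part_nab_sym P).
move=> z H /=; rewrite gn; last first.
  by move=> [x xs xz]; apply: H; exists x => //; rewrite inE xs orbT.
by apply: hC => yz; apply: H; exists y => //; exact: mem_head.
Qed.

(** A power of p fixes K pointwise and every nab-class setwise. Dividing by an
    element of G that acts in the same way on the Del-classes gives an f that
    fixes every Del-class, and the e-th power of f belongs to G by gluing. *)
Lemma group_exponent : exists2 n, 0 < n & has_exponent D G n.
Proof.
have [s sP] := part_nab_fin P; have [sK sKP] := part_Kfin P.
exists (e * ((size s)`! * (size sK)`!)); first by rewrite !muln_gt0 e_gt0 !fact_gt0.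
move=> p bp pD np.
have -> : iter (e * ((size s)`! * (size sK)`!)) p =
    iter e (iter ((size s)`! * (size sK)`!) p).
  by apply/funext => x; rewrite iterM.
set e1 := _ * _; pose q := iter e1 p; rewrite -/q.
have [Kp nabp Delp] := partition_canonical bp pD np.
have bq : bijective q by exact: bij_iter.
have qD : id_off D q by exact: id_off_iter.
have nq : normalizes q G by exact: normalizes_iter.
have [Kq nabq Delq] := partition_canonical bq qD nq.
have qx x : ~ nab x x -> q x = x.
  move=> nx; have [Dx|/qD//] := pselect (D x).
  have Kx : K x.
    apply: contrapT => nKx; apply: nx.
    exact: (part_Del_nab P (part_Del_refl P Dx nKx)).
  have p0 : iter (size sK)`! p x = x.
    apply: esym; apply: (@iter_orbit_fact _ eq) => //.
    - by move=> a b c -> .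
    - by move=> a b; split=> [->//|]; exact: bij_inj.
    move=> i; exists (iter i p x) => //; apply: sKP.
    by elim: i => //= i; exact: (Kp _).1.
  rewrite /q /e1 iterM; elim: (_`!) => //= n ->; exact: p0.
have qn x : nab x x -> nab x (q x).
  move=> nx; rewrite /q /e1 mulnC iterM.
  have H : nab x (iter (size s)`! p x).
    apply: iter_orbit_fact => //.
    - exact: (part_nab_sym P).
    - exact: (part_nab_trans P).
    move=> i; apply: sP; elim: i => //= i; exact: (nabp _ _).1.
  have nabi n a b : nab a b <-> nab (iter n p a) (iter n p b).
    by elim: n => //= n ->; exact: nabp.
  elim: (_`!) => //= n IHn; apply: (part_nab_trans P H).
  exact: (nabi _ _ _).1.
have [g [Gg gn gD]] := match_classes bq qn Delq.
have [g' [Gg' gK g'K]] := perm_group_inverse pG Gg.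
pose f := g' \o q.
have bf : bijective f by apply: bij_comp => //; exact: (perm_group_sub pG).
have fn x : ~ nab x x -> f x = x.
  by move=> nx; rewrite /f /= qx// -[in LHS](gn _ nx) gK.
have fD x : Del x x -> Del x (f x).
  move=> /(part_Del_nab P)/gD/(part_Del_inv P Gg'); rewrite gK.
  exact: (part_Del_sym P).
have nf : normalizes f G.
  apply: normalizes_comp => //; first exact: (perm_group_sub pG).
  exact: group_normalizes.
have Gf : G (iter e f).
  have -> : iter e f = on [set x | nab x x] (iter e f).
    by rewrite (id_off_on (id_off_iter e fn)).
  apply: (glue_classes pG cG (part_Del_sym P) (part_Del_trans P)).
  - exact: nab_Del.
  - by move=> x y _ /(part_Del_sym P)/(part_Del_nab P)/nab_class.
  - by rewrite (id_off_on (id_off_iter e fn)); exact: bij_iter.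
  move=> x /nab_Del xx.
  have fcl y : Del x y <-> Del x (f y).
    split=> xy.
      by apply: (part_Del_trans P xy); exact/fD/Del_class/(part_Del_sym P xy).
    have [yy|nyy] := pselect (Del y y).
      exact: (part_Del_trans P xy (part_Del_sym P (fD _ yy))).
    by rewrite -(fn y)// => /nab_Del.
  rewrite -on_iter; last by move=> y /fcl.
  apply: (compE xx _ _ _).1; first exact: on_bij.
    exact: on_id_off.
  exact: (normalizes_on pG bf fcl nf).
have -> : q = g \o f by apply/funext => x; rewrite /f /= g'K.
have [h Gh ->] := normalizes_iter_mul e pG Gg bf nf.
exact: perm_group_comp.
Qed.

End Exponent.

End Partition.

(** * The classes H_n on a fixed set *)

Section Induction.
Variable X : eqType.
Implicit Types (D : set X) (G N H : set (X -> X)).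

Lemma class_H_on_finite_orbits m D G : class_H_on m D G -> finite_orbits D G.
Proof.
elim: m D G => // m IHm D G [pG GD cG [K [nab [Del [P comp]]]]].
have [sK sKP] := part_Kfin P; have [s sP] := part_nab_fin P.
have /choice[o oP] y : exists o : seq X, Del y y ->
    forall x, Del y x -> exists2 g, local_subgroup G (Del y) g & g x \in o.
  have [/comp/IHm[o oP]|ny] := pselect (Del y y); first by exists o.
  by exists [::].
exists (sK ++ flatten [seq o y | y <- s]) => x Dx.
have [Kx|nKx] := pselect (K x).
  exists idfun; first exact: (perm_group_id pG).
  by rewrite mem_cat sKP.
have [y ys xy] := sP _ (part_Del_nab P (part_Del_refl P Dx nKx)).
have [g [Gg _ yg]] := nab_transitive P xy.
have [h [Gh _] ho] := oP y (Del_class P yg) _ yg.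
exists (h \o g); first exact: perm_group_comp.
rewrite mem_cat; apply/orP; right; apply/flattenP; exists (o y) => //.
exact: map_f.
Qed.

Lemma components_exponent m D G K nab Del : perm_group G ->
  partition_on D G K nab Del ->
  (forall D' G', class_H_on m D' G' -> exists2 e, 0 < e & has_exponent D' G' e) ->
  (forall x, Del x x -> class_H_on m (Del x) (local_subgroup G (Del x))) ->
  exists2 e, 0 < e &
    forall x, Del x x -> has_exponent (Del x) (local_subgroup G (Del x)) e.
Proof.
move=> pG P IHm comp; apply: (common_exponent pG P) => x /comp.
exact: IHm.
Qed.

Lemma class_H_on_exponent m D G : class_H_on m D G ->
  exists2 e, 0 < e & has_exponent D G e.
Proof.
elim: m D G => // m IHm D G [pG GD cG [K [nab [Del [P comp]]]]].
have [e e0 eP] := components_exponent pG P IHm comp.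
apply: (group_exponent pG cG P e0 eP) => x /comp.
exact: class_H_on_finite_orbits.
Qed.

Lemma class_H_on_component_power m D G K nab Del : perm_group G ->
  partition_on D G K nab Del ->
  (forall x, Del x x -> class_H_on m (Del x) (local_subgroup G (Del x))) ->
  exists2 e, 0 < e &
    forall g x, G g -> Del x (g x) -> G (on (Del x) (iter e g)).
Proof.
move=> pG P comp.
have [e e0 eP] := components_exponent pG P (@class_H_on_exponent m) comp.
by exists e => // g x; exact: (component_power pG P eP).
Qed.

Lemma class_H_on_canonical m D G K nab Del : perm_group G -> fin_closed G ->
  partition_on D G K nab Del ->
  (forall x, Del x x -> class_H_on m (Del x) (local_subgroup G (Del x))) ->
  forall q, bijective q -> id_off D q -> normalizes q G ->
  [/\ forall x, K x <-> K (q x), forall x y, nab x y <-> nab (q x) (q y) &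
      forall x y, Del x y <-> Del (q x) (q y)].
Proof.
move=> pG cG P comp q.
have [e e0 eP] := components_exponent pG P (@class_H_on_exponent m) comp.
apply: (partition_canonical pG cG P e0 eP) => x /comp.
exact: class_H_on_finite_orbits.
Qed.

(** By canonicity an omega-partition of N is one of H as well. Its components
    with respect to H are closed and contain those of N as normal subgroups. *)
Lemma class_H_on_normal_supergroup m D N H : class_H_on m D N ->
  perm_group H -> (forall h, H h -> id_off D h) -> fin_closed H ->
  N `<=` H -> (forall h, H h -> normalizes h N) -> class_H_on m D H.
Proof.
elim: m D N H => // m IHm D N H [pN ND cN [K [nab [Del [P comp]]]]] pH HD cH NH nH.
have can h (Hh : H h) := class_H_on_canonical pN cN P comp
  (perm_group_sub pH Hh) (HD h Hh) (nH h Hh).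
split=> //; exists K, nab, Del; split.
  split; first [exact: (part_KD P)|exact: (part_Kfin P)|exact: (part_nab_sym P)|
    exact: (part_nab_trans P)|exact: (part_Del_sym P)|exact: (part_Del_trans P)|
    exact: (part_Del_nab P)|exact: (part_nab_dom P)|exact: (part_Del_refl P)|
    exact: (part_nab_fin P)|idtac].
  - by move=> g x /can[Kg _ _] /Kg.
  - by move=> g x y /can[_ ng _] xy; exact: (ng x y).1.
  - by move=> g x y /can[_ _ dg] xy; exact: (dg x y).1.
  - move=> x /(part_spread P)[r [nr rI rs full]]; exists r; split=> // phi bphi.
    by have [g [Ng gC gr]] := full _ bphi; exists g; split=> //; exact: NH.
move=> x xx; apply: (IHm _ (local_subgroup N (Del x))).
- exact: comp.
- exact: local_subgroup_perm_group.
- by move=> h [].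
- exact: local_subgroup_fin_closed.
- by move=> h [/NH].
move=> h [Hh hx]; apply: (normalizes_local_subgroup pN _ (nH h Hh)) => y.
have hI := bij_inj (perm_group_sub pH Hh).
split; first exact: (id_off_stab hI hx).
by move=> xhy; apply: contrapT => nxy; apply: (nxy); rewrite -(hx y nxy).
Qed.

Lemma class_H_on_finite m D G (s : seq X) : (forall x, D x -> x \in s) ->
  perm_group G -> (forall g, G g -> id_off D g) -> class_H_on m.+1 D G.
Proof.
move=> Ds pG GD; split=> //.
  move=> f bf fG; have [g Gg gf] := fG s.
  suff -> : f = g by [].
  apply/funext => x; have [/Ds/gf//|nD] := pselect (D x).
  have [h Gh hf] := fG [:: x].
  by rewrite -hf ?mem_head// (GD h)// (GD g).
exists D, (fun _ _ => False), (fun _ _ => False); split=> //; split=> //.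
- by exists s.
- move=> g x Gg Dx; apply: (id_off_stab _ (GD g Gg) Dx).
  exact: bij_inj (perm_group_sub pG Gg).
- by exists [::].
Qed.

(** * Products over finitely many blocks *)

Section Product.
Variables (I : finType) (D : set X) (idx : X -> I) (N : I -> set (X -> X)).

Definition block (i : I) : set X := [set x | D x /\ idx x = i].

(** The group prod_i N_i, each N_i being supported in block i. *)
Definition block_product : set (X -> X) :=
  [set g | [/\ bijective g, id_off D g & forall i, N i (on (block i) g)]].

Hypotheses (pN : forall i, perm_group (N i))
  (N_off : forall i g, N i g -> id_off (block i) g)
  (cN : forall i, fin_closed (N i)).

Lemma block_product_stab g x : block_product g -> D x ->
  D (g x) /\ idx (g x) = idx x.
Proof.
move=> [bg gD gN] Dx; have Ng := gN (idx x).
have inj := bij_inj (perm_group_sub (pN _) Ng).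
have Bx : block (idx x) x by [].
by have := id_off_stab inj (@on_id_off _ _ _) Bx; rewrite onT.
Qed.

Lemma block_product_stabE g i x : block_product g -> block i x <-> block i (g x).
Proof.
move=> Pg; have [bg gD _] := Pg.
have [Dx|nD] := pselect (D x); last by rewrite gD.
have [Dg ig] := block_product_stab Pg Dx.
by rewrite /block /= ig; split=> -[].
Qed.

Lemma block_product_group : perm_group block_product.
Proof.
split.
- by move=> g [].
- split=> //.
  move=> i; have -> : on (block i) idfun = idfun; last exact: (perm_group_id (pN i)).
  by apply/funext => x; rewrite /on; case: ifP.
- move=> f g Pf Pg; have [bf fD fN] := Pf; have [bg gD gN] := Pg; split.
  + exact: bij_comp.
  + exact: id_off_comp.
  move=> i; rewrite -on_comp; first exact: perm_group_comp.
  by move=> x /(block_product_stabE i x Pg).1.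
- move=> f g Pf fK gK; have [bf fD fN] := Pf; split.
  + by exists f.
  + exact: id_off_inv fK fD.
  have sf i x := block_product_stabE i x Pf.
  move=> i; apply: (perm_group_inv (pN i) (fN i)); apply: on_cancel => // x.
    by move/(sf i x).1.
  by move=> Bx; apply: (sf i _).2; rewrite gK.
Qed.

Lemma block_product_closed : fin_closed block_product.
Proof.
move=> f bf fP.
have fD : id_off D f.
  by move=> x nD; have [g [_ gD _] gf] := fP [:: x]; rewrite -gf ?mem_head// gD.
have sf i x : block i x <-> block i (f x).
  have [g Pg gf] := fP [:: x]; rewrite -gf ?mem_head//.
  exact: block_product_stabE.
split=> // i; apply: cN; first by apply: on_bij.
move=> s; have [g [bg gD gN] gf] := fP s; exists (on (block i) g) => // x xs.
have [Bx|nB] := pselect (block i x); first by rewrite !onT// gf.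
by rewrite !onF.
Qed.

Lemma on_disjoint i j g : id_off (block i) g -> i <> j -> on (block j) g = idfun.
Proof.
move=> gi ij; apply/funext => x; have [[Dx jx]|nB] := pselect (block j x).
  by rewrite onT// gi// => -[_ ix]; apply: ij; rewrite -ix.
by rewrite onF.
Qed.

Lemma block_subgroup i g : N i g -> block_product g.
Proof.
move=> Ng; have gi := N_off Ng; split.
- exact: (perm_group_sub (pN i)).
- by move=> x nD; apply: gi => -[].
move=> j; have [<-|ij] := pselect (i = j); first by rewrite id_off_on.
by rewrite (on_disjoint gi ij); exact: (perm_group_id (pN j)).
Qed.

Lemma block_productP i g : block_product g -> id_off (block i) g -> N i g.
Proof. by move=> [_ _ gN] gi; rewrite -(id_off_on gi). Qed.

End Product.

Lemma class_H_on_block_product (I : finType) m D (idx : X -> I)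
    (N : I -> set (X -> X)) :
  (forall i, class_H_on m.+1 (block D idx i) (N i)) ->
  class_H_on m.+1 D (block_product D idx N).
Proof.
move=> NH; have pN i : perm_group (N i) by have [] := NH i.
have N_off i g : N i g -> id_off (block D idx i) g by have [_ + _ _] := NH i; apply.
have cN i : fin_closed (N i) by have [] := NH i.
split; [exact: block_product_group|by move=> g []|exact: block_product_closed|].
have /choice[F FP] i : exists F : set X * ((X -> X -> Prop) * (X -> X -> Prop)),
    partition_on (block D idx i) (N i) F.1 F.2.1 F.2.2 /\
    forall x, F.2.2 x x -> class_H_on m (F.2.2 x) (local_subgroup (N i) (F.2.2 x)).
  have [_ _ _ [K [nab [Del H]]]] := NH i.
  by exists (K, (nab, Del)).
pose Ki i := (F i).1; pose nabi i := (F i).2.1; pose Deli i := (F i).2.2.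
have P i : partition_on (block D idx i) (N i) (Ki i) (nabi i) (Deli i) := (FP i).1.
have comp i := (FP i).2; rewrite -/(Deli _) in comp.
have nidx i x y : nabi i x y -> idx x = i /\ idx y = i.
  move=> xy; have [[_ ->] _] := part_nab_dom (P i) xy.
  by have [[_ ->] _] := part_nab_dom (P i) (part_nab_sym (P i) xy).
have didx i x y : Deli i x y -> idx x = i /\ idx y = i.
  by move/(part_Del_nab (P i)); exact: nidx.
exists [set x | Ki (idx x) x], (fun x y => nabi (idx x) x y),
  (fun x y => Deli (idx x) x y).
have gE g i x : block_product D idx N g -> D x -> idx x = i ->
    g x = on (block D idx i) g x.
  by move=> _ Dx ix; rewrite onT.
split; first split.
- by move=> x /(part_KD (P _))[].
- have /choice[s sP] i := part_Kfin (P i).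
  exists (flatten [seq s i | i <- enum I]) => x Kx.
  apply/flattenP; exists (s (idx x)); last exact: sP.
  by apply: map_f; rewrite mem_enum.
- move=> g x Pg /= Kx; have [Dx _] := part_KD (P _) Kx.
  have [_ ->] := block_product_stab pN Pg Dx.
  by rewrite (gE g (idx x))//; apply: (part_Kinv (P _)) => //; have [_ _] := Pg.
- by move=> x y xy; have [_ ->] := nidx _ _ _ xy; exact: (part_nab_sym (P _)).
- move=> x y z xy; have [_ ->] := nidx _ _ _ xy.
  exact: (part_nab_trans (P _)).
- by move=> x y xy; have [_ ->] := didx _ _ _ xy; exact: (part_Del_sym (P _)).
- move=> x y z xy; have [_ ->] := didx _ _ _ xy.
  exact: (part_Del_trans (P _)).
- by move=> x y; exact: (part_Del_nab (P _)).
- by move=> x y /(part_nab_dom (P _))[[Dx _] nK].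
- by move=> x Dx nK; exact: (part_Del_refl (P _)).
- move=> g x y Pg xy; have [_ yx] := nidx _ _ _ xy.
  have [[Dx _] _] := part_nab_dom (P _) xy.
  have [[Dy _] _] := part_nab_dom (P _) (part_nab_sym (P _) xy).
  have [_ ->] := block_product_stab pN Pg Dx.
  rewrite (gE g (idx x) x)// (gE g (idx x) y)//; apply: (part_nab_inv (P _)) => //.
  by have [_ _] := Pg.
- move=> g x y Pg xy; have [_ yx] := didx _ _ _ xy.
  have [[Dx _] _] := Del_dom (P _) xy.
  have [[Dy _] _] := Del_dom (P _) (part_Del_sym (P _) xy).
  have [_ ->] := block_product_stab pN Pg Dx.
  rewrite (gE g (idx x) x)// (gE g (idx x) y)//; apply: (part_Del_inv (P _)) => //.
  by have [_ _] := Pg.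
- have /choice[s sP] i := part_nab_fin (P i).
  exists (flatten [seq s i | i <- enum I]) => x /sP[y ys xy]; exists y => //.
  apply/flattenP; exists (s (idx x)) => //.
  by apply: map_f; rewrite mem_enum.
- move=> x /(part_spread (P _))[r [nr rI rs full]]; exists r.
  have ridx i : idx (r i) = idx x by have [_ ->] := nidx _ _ _ (nr i).
  split=> //.
  + by move=> i j; rewrite ridx; exact: rI.
  + by move=> y /rs[i iy]; exists i; rewrite ridx.
  move=> phi /full[g [Ng gC gr]]; exists g; split=> //.
    exact: (block_subgroup pN N_off Ng).
  by move=> i; rewrite ridx.
move=> x xx; have := comp _ _ xx; congr class_H_on.
apply/seteqP; split=> g [H gx]; split=> //; first exact: (block_subgroup pN N_off H).
apply: block_productP H _.
apply: id_offW gx => y xy.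
by have [[] //] := Del_dom (P _) (part_Del_sym (P _) xy).
Qed.

End Induction.

(** * Coordinates *)

Definition shift (X : Type) (k : nat) (idx : X -> 'I_k.+1) (lev : X -> nat)
    (up : X -> nat -> X) (pr : X -> X) (sg : 'I_k.+1 -> nat -> nat) (x : X) : X :=
  up (pr x) (sg (idx x) (lev x)).

(** The identification of X with the set Omega: [idx] is the index of the block
    (0 on K), [lev] is the number of the copy inside the block, [pr] projects to
    copy 0 and [up a n] is the copy of a with number n. On K, where there is only
    one copy, [up] ignores the number. The last clause says that permutations of
    the copies belong to G. *)
Record coordinates (X : eqType) (G : set (X -> X)) (K : set X)
    (nab Del : X -> X -> Prop) (k : nat) (idx : X -> 'I_k.+1) (lev : X -> nat)
    (up : X -> nat -> X) (pr : X -> X) : Prop := Coordinates {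
  co_K : forall x, K x <-> idx x = ord0;
  co_nab : forall x y, nab x y <-> idx x <> ord0 /\ idx x = idx y;
  co_Del : forall x y, Del x y <-> [/\ idx x <> ord0, idx x = idx y & lev x = lev y];
  co_lev0 : forall x, idx x = ord0 -> lev x = 0;
  co_idx_pr : forall x, idx (pr x) = idx x;
  co_lev_pr : forall x, lev (pr x) = 0;
  co_up_pr : forall x, up (pr x) (lev x) = x;
  co_idx_up : forall a n, lev a = 0 -> idx (up a n) = idx a;
  co_pr_up : forall a n, lev a = 0 -> pr (up a n) = a;
  co_lev_up : forall a n, lev a = 0 -> idx a <> ord0 -> lev (up a n) = n;
  co_up_kernel : forall a n, idx a = ord0 -> up a n = a;
  co_up_0 : forall a, lev a = 0 -> up a 0 = a;
  co_inhabited : forall i, i <> ord0 -> exists x, idx x = i;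
  co_shift : forall sg : 'I_k.+1 -> nat -> nat, (forall i, bijective (sg i)) ->
    G (shift idx lev up pr sg) }.

Lemma shift_cancel (X : eqType) (k : nat) (idx : X -> 'I_k.+1) (lev : X -> nat)
    (up : X -> nat -> X) (pr : X -> X) (sg sg' : 'I_k.+1 -> nat -> nat) :
  (forall x, idx x = ord0 -> lev x = 0) ->
  (forall x, idx (pr x) = idx x) -> (forall x, lev (pr x) = 0) ->
  (forall x, up (pr x) (lev x) = x) ->
  (forall a n, lev a = 0 -> idx (up a n) = idx a) ->
  (forall a n, lev a = 0 -> pr (up a n) = a) ->
  (forall a n, lev a = 0 -> idx a <> ord0 -> lev (up a n) = n) ->
  (forall a n, idx a = ord0 -> up a n = a) ->
  (forall i, cancel (sg i) (sg' i)) ->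
  cancel (shift idx lev up pr sg) (shift idx lev up pr sg').
Proof.
move=> l0 ip lp upr iu pu lu uk sgK x; rewrite /shift pu//.
have [i0|ni0] := pselect (idx x = ord0).
  by rewrite -[RHS]upr !(uk (pr x)) ?ip.
by rewrite iu// lu// ip// sgK upr.
Qed.

Section Existence.
Variables (X : eqType) (G : set (X -> X)) (K : set X) (nab Del : X -> X -> Prop).
Hypotheses (pG : perm_group G) (cG : fin_closed G).
Hypothesis (P : partition_on setT G K nab Del).

Lemma nab_transversal : exists t : seq X,
  [/\ uniq t, {in t &, forall y z, nab y z -> y = z},
      {in t, forall y, nab y y} &
      forall x, nab x x -> exists2 y, y \in t & nab y x].
Proof.
have [s sP] := part_nab_fin P.
suff [t [ut tI tn st]] : exists t : seq X,
    [/\ uniq t, {in t &, forall y z, nab y z -> y = z}, {in t, forall y, nab y y} &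
      forall x, (exists2 y, y \in s & nab y x) -> exists2 y, y \in t & nab y x].
  exists t; split=> // x /sP[y ys xy]; apply: st; exists y => //.
  exact: (part_nab_sym P).
elim: s {sP} => [|y s [t [ut tI tn st]]]; first by exists [::]; split=> // x [].
have old x : ~ (nab y x /\ ~ exists2 w, w \in t & nab w y) ->
    (exists2 w, w \in y :: s & nab w x) -> exists2 w, w \in t & nab w x.
  move=> H [w]; rewrite inE => /orP[/eqP->|ws] wx; last by apply: st; exists w.
  have [[w' wt wy]|nt] := pselect (exists2 w, w \in t & nab w y).
    by exists w' => //; exact: (part_nab_trans P wy).
  by case: H.
have [yy|nyy] := pselect (nab y y); last first.
  exists t; split=> // x; apply: old => -[yx _]; apply: nyy.
  exact: (nab_class P yx).
have [ty|nt] := pselect (exists2 w, w \in t & nab w y).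
  by exists t; split=> // x; apply: old => -[].
exists (y :: t); split.
- rewrite /= ut andbT; apply/negP => yt; apply: nt; exists y => //.
- move=> a b; rewrite !inE => /orP[/eqP->|ta] /orP[/eqP->|tb] // ab.
  + case: nt; exists b => //; exact: (part_nab_sym P).
  + by case: nt; exists a.
  + exact: tI.
- by move=> a; rewrite inE => /orP[/eqP->//|]; exact: tn.
move=> x xs; have [yx|nyx] := pselect (nab y x).
  by exists y => //; exact: mem_head.
have [|w wt wx] := old x _ xs; first by move=> [].
by exists w => //; rewrite inE wt orbT.
Qed.

(** Coordinates are straight sections chosen separately in each nab-class. *)
Lemma coordinates_exist e : 0 < e ->
  (forall g x, G g -> Del x (g x) -> G (on (Del x) (iter e g))) ->
  exists (k : nat) (idx : X -> 'I_k.+1) (lev : X -> nat) (up : X -> nat -> X)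
    (pr : X -> X), coordinates G K nab Del idx lev up pr.
Proof.
move=> e0 expo; have [t [ut tI tn tP]] := nab_transversal.
have Dsym := part_Del_sym P; have Dtrans := part_Del_trans P.
have nsym := part_nab_sym P; have ntrans := part_nab_trans P.
pose c := tnth (in_tuple t).
have ct j : c j \in t by rewrite mem_tnth.
have cI i j : nab (c i) (c j) -> i = j.
  move=> H; have cc := tI _ _ (ct i) (ct j) H.
  exact: (elimT (tuple_uniqP (in_tuple t)) ut).
have /choice[idx idxP] x : exists i : 'I_(size t).+1,
    (forall j, i = lift ord0 j -> nab (c j) x) /\ (i = ord0 -> ~ nab x x).
  have [nx|nnx] := pselect (nab x x); last first.
    by exists ord0; split=> // j /eqP; rewrite (negbTE (neq_lift _ _)).
  have [y yt yx] := tP x nx; have /tnthP[j yj] : y \in in_tuple t by [].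
  exists (lift ord0 j); split; last first.
    by move=> /eqP; rewrite eq_sym (negbTE (neq_lift _ _)).
  by move=> i /lift_inj <-; rewrite /c -yj.
have idxL x j : idx x = lift ord0 j -> nab (c j) x by exact: (idxP x).1.
have idxL' x j : nab (c j) x -> idx x = lift ord0 j.
  move=> jx; case: (unliftP ord0 (idx x)) => [i ii|/(idxP x).2 []].
    by rewrite ii; congr lift; apply: cI; apply: ntrans (idxL _ _ ii) (nsym _ _ jx).
  exact: (nab_class P (nsym _ _ jx)).
have idx0 x : idx x = ord0 <-> ~ nab x x.
  split; first exact: (idxP x).2.
  move=> nx; case: (unliftP ord0 (idx x)) => [i ii|//]; case: nx.
  exact: (nab_class P (nsym _ _ (idxL _ _ ii))).
have lift0 j : lift ord0 j <> ord0 :> 'I_(size t).+1.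
  by move=> /eqP; rewrite eq_sym (negbTE (neq_lift _ _)).
have nabE x y : nab x y <-> idx x <> ord0 /\ idx x = idx y.
  split=> [xy|[x0 xy]].
    have x0 : idx x <> ord0 by move=> /idx0; apply; exact: (nab_class P xy).
    split=> //; case: (unliftP ord0 (idx x)) => [j xj|//].
    by rewrite xj (idxL' y j)//; exact: ntrans (idxL _ _ xj) xy.
  case: (unliftP ord0 (idx x)) => [j xj|//].
  have jy : idx y = lift ord0 j by rewrite -xy.
  exact: ntrans (nsym _ _ (idxL _ _ xj)) (idxL _ _ jy).
have /choice[Z ZP] (j : 'I_(size t)) :
  exists Z : (nat -> X) * ((nat -> X -> X) * (nat -> X -> X)),
    [/\ forall i i', Del (Z.1 i) (Z.1 i') -> i = i',
      forall y, nab (c j) y <-> exists i, Del (Z.1 i) y,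
      forall n, [/\ G (Z.2.1 n), cancel (Z.2.1 n) (Z.2.2 n), cancel (Z.2.2 n) (Z.2.1 n)
        & Del (Z.1 n) (Z.2.1 n (Z.1 0))],
      Z.2.1 0 = id &
      forall (phi : nat -> nat) (q : X -> X), bijective phi -> id_off (nab (c j)) q ->
        (forall n x, Del (Z.1 n) x -> q x = Z.2.1 (phi n) (Z.2.2 n x)) -> G q].
  have [r [nr rI rs full]] := part_spread P (tn _ (ct j)).
  have rrefl i : Del (r i) (r i).
    by apply: (nab_Del P); apply: (nab_class P (nsym _ _ (nr i))).
  have CE x : nab (c j) x <-> exists i, Del (r i) x.
    split; first exact: rs.
    by move=> [i /(part_Del_nab P)]; exact: (ntrans _ _ _ (nr i)).
  have [z [z' [zP z0 zid zs]]] := straight_sections pG cG Dsym Dtrans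
    (part_Del_inv P) rrefl rI CE full e0 expo.
  by exists (r, (z, z')); split=> //= n; have [[? _ _] ? ?] := zP n; split.
pose r j := (Z j).1; pose z j := (Z j).2.1; pose z' j := (Z j).2.2.
have rI j i i' x : Del (r j i) x -> Del (r j i') x -> i = i'.
  move=> ix i'x; have [H _ _ _ _] := ZP j; apply: H.
  exact: Dtrans ix (Dsym _ _ i'x).
have CE j y : nab (c j) y <-> exists i, Del (r j i) y.
  by have [_ + _ _ _] := ZP j; apply.
have Gz j n : G (z j n) by have [_ _ H _ _] := ZP j; have [] := H n.
have zK j n : cancel (z j n) (z' j n) by have [_ _ H _ _] := ZP j; have [] := H n.
have z'K j n : cancel (z' j n) (z j n) by have [_ _ H _ _] := ZP j; have [] := H n.
have zr j n : Del (r j n) (z j n (r j 0)) by have [_ _ H _ _] := ZP j; have [] := H n.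
have z0 j : z j 0 = id by have [_ _ _ + _] := ZP j.
have zs j := let: And5 _ _ _ _ H := ZP j in H.
have Gz' j n : G (z' j n) by exact: (perm_group_inv pG (Gz j n)).
have zlev j n x : Del (r j 0) x -> Del (r j n) (z j n x).
  by move=> H; exact: Dtrans (zr j n) (part_Del_inv P (Gz j n) H).
have z'lev j n x : Del (r j n) x -> Del (r j 0) (z' j n x).
  move=> H; apply: Dtrans (part_Del_inv P (Gz' j n) H).
  apply: Dsym; have := part_Del_inv P (Gz' j n) (zr j n).
  by rewrite zK.
have /choice[lev levP] x : exists n, (idx x = ord0 -> n = 0) /\
    forall j, idx x = lift ord0 j -> Del (r j n) x.
  case: (unliftP ord0 (idx x)) => [j xj|x0]; last first.
    by exists 0; split=> // j; rewrite x0 => /esym /lift0.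
  have /CE[n nx] := idxL _ _ xj; exists n; split; first by rewrite xj => /lift0.
  by move=> i; rewrite xj => /lift_inj <-.
have levL x j : idx x = lift ord0 j -> Del (r j (lev x)) x by exact: (levP x).2.
have levE j n x : Del (r j n) x -> idx x = lift ord0 j /\ lev x = n.
  move=> nx; have xj : idx x = lift ord0 j by apply: idxL'; apply/CE; exists n.
  by split=> //; exact: rI (levL _ _ xj) nx.
pose up a n := if unlift ord0 (idx a) is Some j then z j n a else a.
pose pr x := if unlift ord0 (idx x) is Some j then z' j (lev x) x else x.
have upE a n j : idx a = lift ord0 j -> up a n = z j n a.
  by rewrite /up => ->; rewrite liftK.
have prE x j : idx x = lift ord0 j -> pr x = z' j (lev x) x.
  by rewrite /pr => ->; rewrite liftK.
have up_ker a n : idx a = ord0 -> up a n = a.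
  by rewrite /up => ->; rewrite unlift_none.
have pr_ker x : idx x = ord0 -> pr x = x.
  by rewrite /pr => ->; rewrite unlift_none.
have lev0 x : idx x = ord0 -> lev x = 0 by exact: (levP x).1.
have prP x : [/\ idx (pr x) = idx x, lev (pr x) = 0 & up (pr x) (lev x) = x].
  case: (unliftP ord0 (idx x)) => [j xj|x0]; last first.
    by rewrite pr_ker// up_ker// lev0.
  have [ij l0] := levE _ _ _ (z'lev _ _ _ (levL _ _ xj)).
  by rewrite (prE _ j)// ij l0 xj (upE _ _ j)// z'K.
have upP a n : lev a = 0 -> [/\ idx (up a n) = idx a, pr (up a n) = a &
    idx a <> ord0 -> lev (up a n) = n].
  move=> la; case: (unliftP ord0 (idx a)) => [j aj|a0]; last first.
    by rewrite up_ker// pr_ker.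
  have H := levL _ _ aj; rewrite la in H.
  have [ij ln] := levE _ _ _ (zlev _ n _ H).
  by rewrite (upE _ _ j)// (prE _ j)// ij ln aj zK.
exists (size t), idx, lev, up, pr; split=> //.
- move=> x; rewrite idx0; split=> [Kx /(part_nab_dom P)[_]//|nx].
  apply: contrapT => nK; apply: nx; apply: (part_Del_nab P).
  exact: (part_Del_refl P).
- move=> x y; split=> [xy|[x0 xy lxy]].
    have /nabE[x0 ixy] := part_Del_nab P xy; split=> //.
    case: (unliftP ord0 (idx x)) => [j xj|//].
    by have [_ ->] := levE _ _ _ (Dtrans _ _ _ (levL _ _ xj) xy).
  case: (unliftP ord0 (idx x)) => [j xj|//].
  have yj : idx y = lift ord0 j by rewrite -xy.
  by apply: Dtrans (Dsym _ _ (levL _ _ xj)) _; rewrite lxy; exact: levL.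
- by move=> x; have [] := prP x.
- by move=> x; have [] := prP x.
- by move=> x; have [] := prP x.
- by move=> a n /(upP _ n)[].
- by move=> a n /(upP _ n)[].
- by move=> a n /(upP _ n)[].
- move=> a la; case: (unliftP ord0 (idx a)) => [j aj|a0]; last exact: up_ker.
  by rewrite (upE _ _ j)// z0.
- move=> i i0; case: (unliftP ord0 i) => [j ij|//].
  by exists (c j); rewrite ij; apply: idxL'; exact: tn.
move=> sg bsg; set f := shift _ _ _ _ _.
have /choice[sg' sgP] i : exists f', cancel (sg i) f' /\ cancel f' (sg i).
  by have [f' ? ?] := bsg i; exists f'.
have fK sg1 sg2 : (forall i, cancel (sg1 i) (sg2 i)) ->
    cancel (shift idx lev up pr sg1) (shift idx lev up pr sg2).
  apply: shift_cancel => //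
    [x|x|x|a n /(upP _ n)[]|a n /(upP _ n)[]|a n /(upP _ n)[]] //;
    by have [] := prP x.
have bf : bijective f.
  by exists (shift idx lev up pr sg'); apply: fK => i; have [] := sgP i.
have f_ker x : idx x = ord0 -> f x = x.
  by move=> x0; rewrite /f /shift pr_ker// up_ker.
have -> : f = on [set x | nab x x] f.
  by rewrite id_off_on// => x /= /idx0/f_ker.
apply: (glue_classes pG cG nsym ntrans) => //.
- by move=> x y _ /nsym/(nab_class P).
- by rewrite id_off_on// => x /= /idx0/f_ker.
move=> x /nabE[x0 _]; case: (unliftP ord0 (idx x)) => [j xj|//].
have nabj y : nab x y <-> nab (c j) y.
  split; first exact: ntrans (idxL _ _ xj).
  exact: ntrans (nsym _ _ (idxL _ _ xj)).
apply: (zs j (sg (lift ord0 j))) => //.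
  by move=> y ny; apply: onF => /nabj.
move=> n y ny; have [yj ly] := levE _ _ _ ny.
rewrite onT; last by apply/nabj; exact: idxL.
rewrite /f /shift yj ly (prE _ j)// ly; apply: upE.
by have [] := levE _ _ _ (z'lev _ _ _ ny).
Qed.

End Existence.

(** * Recovering a group from its sections *)

Section Coords.
Variables (X : eqType) (G : set (X -> X)) (K : set X) (nab Del : X -> X -> Prop).
Variables (k : nat) (idx : X -> 'I_k.+1) (lev : X -> nat) (up : X -> nat -> X)
  (pr : X -> X).
Hypotheses (pG : perm_group G) (cG : fin_closed G).
Hypothesis (P : partition_on setT G K nab Del).
Hypothesis (co : coordinates G K nab Del idx lev up pr).

Definition base : set X := [set a | lev a = 0].

(** The permutation that acts as q on every copy at once. *)
Definition diag (q : X -> X) (x : X) : X := up (q (pr x)) (lev x).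

Definition level (i : 'I_k.+1) (n : nat) : set X :=
  [set x | idx x = i /\ lev x = n].

(** The groups N_i, acting on copy 0. *)
Definition bottom (i : 'I_k.+1) : set (X -> X) :=
  if i == ord0 then [set idfun] else local_subgroup G (block base idx i).

Definition bottom_product : set (X -> X) := block_product base idx bottom.

(** The group H, acting on copy 0. *)
Definition top : set (X -> X) :=
  [set q | [/\ bijective q, id_off base q & G (diag q)]].

(** The permutation rho_v(g), acting on copy 0. *)
Definition slice (v : 'I_k.+1 -> nat) (g : X -> X) (a : X) : X :=
  if lev a == 0 then pr (g (up a (v (idx a)))) else a.

Local Notation sh := (shift idx lev up pr).

Definition respects_levels (s : X -> X) : Prop :=
  [/\ bijective s, forall x, idx x = ord0 <-> idx (s x) = ord0,
      forall x y, idx x = idx y <-> idx (s x) = idx (s y) &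
      forall x y, idx x = idx y -> lev x = lev y <-> lev (s x) = lev (s y)].

Lemma pr_base a : lev a = 0 -> pr a = a.
Proof. by move=> la; rewrite -[in LHS](co_up_0 co la) (co_pr_up co). Qed.

Lemma idx_sh sg x : idx (sh sg x) = idx x.
Proof. by rewrite /shift (co_idx_up co) ?(co_lev_pr co)// (co_idx_pr co). Qed.

Lemma lev_sh sg x : idx x <> ord0 -> lev (sh sg x) = sg (idx x) (lev x).
Proof. by move=> x0; rewrite /shift (co_lev_up co) ?(co_lev_pr co) ?(co_idx_pr co). Qed.

Lemma pr_kernel x : idx x = ord0 -> pr x = x.
Proof. by move=> x0; rewrite pr_base// (co_lev0 co). Qed.

Lemma sh_kernel sg x : idx x = ord0 -> sh sg x = x.
Proof. by move=> x0; rewrite /shift pr_kernel// (co_up_kernel co). Qed.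

Lemma sh_cancel sg sg' : (forall i, cancel (sg i) (sg' i)) -> cancel (sh sg) (sh sg').
Proof.
apply: shift_cancel => *; first exact: (co_lev0 co).
- exact: (co_idx_pr co).
- exact: (co_lev_pr co).
- exact: (co_up_pr co).
- exact: (co_idx_up co).
- exact: (co_pr_up co).
- exact: (co_lev_up co).
- exact: (co_up_kernel co).
Qed.

Definition swap_levels i n m := sh (fun j => if j == i then swap_nat n m else id).

Lemma swap_levels_group i n m : G (swap_levels i n m).
Proof.
apply: (co_shift co) => j; case: eqP => _; last by exists id.
exact: (inv_bij (swap_natK n m)).
Qed.

Lemma swap_levelsK i n m : involutive (swap_levels i n m).
Proof. by apply: sh_cancel => j; case: eqP => // _; exact: swap_natK. Qed.

Lemma swap_levelsE i n m x : idx x = i ->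
  swap_levels i n m x = up (pr x) (swap_nat n m (lev x)).
Proof. by move=> xi; rewrite /swap_levels /shift xi eqxx. Qed.

Lemma swap_levels_off i n m x : idx x <> i -> swap_levels i n m x = x.
Proof. by move=> /eqP/negbTE xi; rewrite /swap_levels /shift xi (co_up_pr co). Qed.

Lemma idx_swap_levels i n m x : idx (swap_levels i n m x) = idx x.
Proof. exact: idx_sh. Qed.

Lemma group_respects_levels g : G g -> respects_levels g.
Proof.
move=> Gg; have [g' [Gg' gK g'K]] := perm_group_inverse pG Gg.
have g0 h x : G h -> idx x = ord0 -> idx (h x) = ord0.
  by move=> Gh /(co_K co)/(part_Kinv P Gh)/(co_K co).
have gi h x y : G h -> idx x = idx y -> idx (h x) = idx (h y).
  move=> Gh xy; have [x0|x0] := pselect (idx x = ord0).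
    by rewrite !g0// -xy.
  have /(part_nab_inv P Gh)/(co_nab co)[//] : nab x y by apply/(co_nab co).
have gl h x y : G h -> idx x = idx y -> lev x = lev y -> lev (h x) = lev (h y).
  move=> Gh xy lxy; have [x0|x0] := pselect (idx x = ord0).
    by rewrite !(co_lev0 co) ?g0// -xy.
  have /(part_Del_inv P Gh)/(co_Del co)[//] : Del x y by apply/(co_Del co).
split; first by exists g'.
- by move=> x; split=> [|/(g0 g' _ Gg')]; [exact: g0|rewrite gK].
- by move=> x y; split=> [|/(gi g' _ _ Gg')]; [exact: gi|rewrite !gK].
- move=> x y xy; split; first exact: gl.
  by move=> /(gl g' _ _ Gg'); rewrite !gK; apply; exact: gi.
Qed.

Lemma respects_levels_inv s s' : cancel s s' -> cancel s' s ->
  respects_levels s -> respects_levels s'.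
Proof.
move=> sK s'K [_ s0 si sl]; split; first by exists s.
- by move=> x; rewrite [X in _ <-> X]s0 s'K.
- by move=> x y; rewrite [X in _ <-> X]si !s'K.
- move=> x y xy; rewrite [X in _ <-> X]sl ?s'K//.
  by apply: (si _ _).2; rewrite !s'K.
Qed.

Lemma respects_levels_comp s t :
  respects_levels s -> respects_levels t -> respects_levels (s \o t).
Proof.
move=> [bs s0 si sl] [bt t0 ti tl]; split.
- exact: bij_comp.
- by move=> x; exact: (iff_trans (t0 x) (s0 _)).
- by move=> x y; exact: (iff_trans (ti x y) (si _ _)).
- by move=> x y xy; exact: (iff_trans (tl x y xy) (sl _ _ ((ti x y).1 xy))).
Qed.

Lemma sh_group sg : (forall i, bijective (sg i)) -> G (sh sg).
Proof. exact: (co_shift co). Qed.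

Lemma idx_up_pr x n : idx (up (pr x) n) = idx x.
Proof. by rewrite (co_idx_up co) ?(co_lev_pr co)// (co_idx_pr co). Qed.

Lemma lev_up_pr x n : idx x <> ord0 -> lev (up (pr x) n) = n.
Proof. by move=> x0; rewrite (co_lev_up co) ?(co_lev_pr co)// (co_idx_pr co). Qed.

(** Such an s maps the copies of a block to those of another one by a bijection
    between their numbers; the shift by the inverse bijections undoes it. *)
Lemma straighten s : respects_levels s ->
  exists sg sg', [/\ forall i, cancel (sg i) (sg' i),
    forall i, cancel (sg' i) (sg i) & forall x, lev (s (sh sg x)) = lev x].
Proof.
move=> rs; have [[s' sK s'K] s0 si sl] := rs.
have [_ s0' si' sl'] := respects_levels_inv sK s'K rs.
have /choice[F FP] i : exists F : (nat -> nat) * (nat -> nat),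
    [/\ cancel F.1 F.2, cancel F.2 F.1 & forall x, idx x = i -> i <> ord0 ->
      lev (s (up (pr x) (F.1 (lev x)))) = lev x].
  have [i0|i0] := pselect (i = ord0); first by exists (id, id); split.
  have [a ai] := co_inhabited co i0.
  have a0 : idx a <> ord0 by rewrite ai.
  have sa0 : idx (s a) <> ord0 by move=> /(s0 a).2.
  pose f n := lev (s' (up (pr (s a)) n)); pose f' n := lev (s (up (pr a) n)).
  have idx_s' n : idx (s' (up (pr (s a)) n)) = idx a.
    by apply: (si _ _).2; rewrite s'K idx_up_pr.
  have lev_s x y : idx x = idx y -> lev x = lev y -> lev (s x) = lev (s y).
    by move=> xy /(sl _ _ xy).1.
  have lev_s' x y : idx x = idx y -> lev x = lev y -> lev (s' x) = lev (s' y).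
    by move=> xy /(sl' _ _ xy).1.
  exists (f, f'); split=> /=.
  - move=> n; rewrite /f' (lev_s _ (s' (up (pr (s a)) n))).
    + by rewrite s'K lev_up_pr.
    + by rewrite idx_up_pr idx_s'.
    + by rewrite lev_up_pr.
  - move=> n; rewrite /f (lev_s' _ (s (up (pr a) n))).
    + by rewrite sK lev_up_pr.
    + by rewrite idx_up_pr; apply: (si _ _).1; rewrite idx_up_pr.
    + by rewrite lev_up_pr.
  - move=> x xi _; rewrite (lev_s _ (s' (up (pr (s a)) (lev x)))).
    + by rewrite s'K lev_up_pr.
    + by rewrite idx_up_pr idx_s' xi ai.
    + by rewrite lev_up_pr// xi.
exists (fun i => (F i).1), (fun i => (F i).2); split.
- by move=> i; have [] := FP i.
- by move=> i; have [] := FP i.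
move=> x; have [x0|x0] := pselect (idx x = ord0).
  by rewrite sh_kernel// !(co_lev0 co)//; exact: (s0 x).1.
by have [_ _ H] := FP (idx x); exact: H.
Qed.

Lemma bottom_group i : perm_group (bottom i).
Proof.
rewrite /bottom; case: eqP => _; last exact: local_subgroup_perm_group.
split=> //.
- by move=> _ ->; exists id.
- by move=> _ _ -> ->.
- by move=> _ g -> fK gK; apply/funext => x; exact: (fK x).
Qed.

Lemma bottom_id_off i g : bottom i g -> id_off (block base idx i) g.
Proof. by rewrite /bottom; case: eqP => [_ -> //|_ []]. Qed.

Lemma bottom_sub i g : bottom i g -> G g.
Proof.
rewrite /bottom; case: eqP => [_ ->|_ []//].
exact: (perm_group_id pG).
Qed.

Lemma on_block_bottom i g : i <> ord0 -> G (on (block base idx i) g) ->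
  bottom i (on (block base idx i) g).
Proof.
move=> /eqP/negbTE i0 Gg; rewrite /bottom i0; split=> //.
exact: on_id_off.
Qed.

Lemma bottom_product_base nu a : bottom_product nu -> lev a = 0 ->
  lev (nu a) = 0 /\ idx (nu a) = idx a.
Proof. exact: (block_product_stab bottom_group). Qed.

Lemma bottom_product_kernel nu x : bottom_product nu -> idx x = ord0 -> nu x = x.
Proof.
move=> [_ _ nuN] x0; have := nuN ord0; rewrite /bottom eqxx => H.
have lx := co_lev0 co x0.
by rewrite -[LHS](@onT _ (block base idx ord0))// H.
Qed.

Lemma bottom_product_on i nu : bottom_product nu -> G (on (block base idx i) nu).
Proof. by move=> [_ _ nuN]; exact: bottom_sub. Qed.

(** On each class M is the conjugate by a shift of an element of some N_i, so M
    is glued from elements of G. *)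
Lemma levelwise M : bijective M -> (forall x, idx x = ord0 -> M x = x) ->
  (forall x, idx x <> ord0 -> exists2 nu, bottom_product nu &
     forall y, Del x y -> M y = up (nu (pr y)) (lev y)) -> G M.
Proof.
move=> bM M0 MN; pose B : set X := [set x | idx x <> ord0].
have offB : id_off B M by move=> x /contrapT; exact: M0.
rewrite -(id_off_on offB).
apply: (glue_classes pG cG (part_Del_sym P) (part_Del_trans P)).
- by move=> x x0; apply/(co_Del co).
- by move=> x y x0 /(co_Del co)[_ xy _]; rewrite /B /= -xy.
- by rewrite id_off_on.
move=> x x0; have [nu Nnu nuM] := MN x x0.
have swx y : Del x y -> swap_levels (idx x) 0 (lev x) y = pr y.
  move=> /(co_Del co)[_ xy lxy]; rewrite swap_levelsE// -lxy /swap_nat eqxx.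
  have := co_up_0 co (co_lev_pr co y).
  by case: eqP => [->|_].
suff -> : on (Del x) M = swap_levels (idx x) 0 (lev x) \o
    (on (block base idx (idx x)) nu \o swap_levels (idx x) 0 (lev x)).
  apply: (perm_group_comp pG (swap_levels_group _ _ _)).
  apply: (perm_group_comp pG _ (swap_levels_group _ _ _)).
  exact: bottom_product_on.
apply/funext => y /=; have [xy|nxy] := pselect (Del x y).
  have /(co_Del co)[_ ixy lxy] := xy.
  rewrite (onT M xy) (nuM y xy) (swx y xy) (onT nu); last first.
    by split; [exact: (co_lev_pr co y)|rewrite (co_idx_pr co)].
  have [ln ni] := bottom_product_base Nnu (co_lev_pr co y).
  rewrite swap_levelsE; last by rewrite ni (co_idx_pr co).
  by rewrite ln (pr_base ln) swap_natL lxy.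
rewrite onF//; rewrite (onF (A := block base idx (idx x))) ?swap_levelsK// => -[ly iy].
apply: nxy; rewrite idx_swap_levels in iy; apply/(co_Del co); split=> //.
have y0 : idx y <> ord0 by rewrite iy.
have := lev_sh (fun j => if j == idx x then swap_nat 0 (lev x) else id) y0.
rewrite -/(swap_levels _ _ _) ly iy eqxx /swap_nat.
by case: eqP => ?; [|case: eqP => ?]; lia.
Qed.

Definition kernel_preserving (q : X -> X) : Prop :=
  forall a, lev a = 0 -> idx (q a) = ord0 <-> idx a = ord0.

Lemma base_stab q a : injective q -> id_off base q -> lev a = 0 -> lev (q a) = 0.
Proof. by move=> qI qb la; exact: (id_off_stab qI qb). Qed.

Lemma lev_diag q x : injective q -> id_off base q -> kernel_preserving q ->
  lev (diag q x) = lev x.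
Proof.
move=> qI qb qk; have lp := co_lev_pr co x; have lq := base_stab qI qb lp.
have [x0|x0] := pselect (idx x = ord0).
  have q0 : idx (q (pr x)) = ord0 by apply: (qk _ lp).2; rewrite (co_idx_pr co).
  by rewrite /diag (co_up_kernel co)// lq (co_lev0 co).
rewrite /diag (co_lev_up co)// => /(qk _ lp).1.
by rewrite (co_idx_pr co).
Qed.

Lemma pr_diag q x : injective q -> id_off base q -> pr (diag q x) = q (pr x).
Proof.
move=> qI qb; rewrite /diag (co_pr_up co)//.
exact: (base_stab qI qb (co_lev_pr co x)).
Qed.

Lemma diag_base q a : injective q -> id_off base q -> lev a = 0 -> diag q a = q a.
Proof.
move=> qI qb la; rewrite /diag pr_base// la (co_up_0 co)//.
exact: (base_stab qI qb la).
Qed.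

Lemma diag_comp q t x : injective t -> id_off base t -> kernel_preserving t ->
  diag q (diag t x) = diag (q \o t) x.
Proof. by move=> tI tb tk; rewrite {1}/diag pr_diag// lev_diag. Qed.

Lemma diag_cancel q t : cancel q t -> id_off base q -> kernel_preserving q ->
  cancel (diag q) (diag t).
Proof.
move=> qK qb qk x; rewrite diag_comp//; last exact: can_inj qK.
by rewrite /diag /= qK (co_up_pr co).
Qed.

Lemma kernel_preserving_inv q q' : cancel q q' -> cancel q' q ->
  id_off base q -> kernel_preserving q -> kernel_preserving q'.
Proof.
move=> qK q'K qb qk a la; have q'b := id_off_inv qK qb.
have lq' := base_stab (can_inj q'K) q'b la.
by rewrite -(qk _ lq') q'K.
Qed.

Lemma top_kernel_preserving q : top q -> kernel_preserving q.
Proof.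
move=> [bq qb Gq] a la; have [_ H _ _] := group_respects_levels Gq.
by rewrite (H a) diag_base//; exact: (bij_inj bq).
Qed.

Lemma diag_bij q : bijective q -> id_off base q -> kernel_preserving q ->
  bijective (diag q).
Proof.
move=> [q' qK q'K] qb qk; exists (diag q'); apply: diag_cancel => //.
  exact: id_off_inv qK qb.
exact: kernel_preserving_inv qK q'K qb qk.
Qed.

Lemma top_group : perm_group top.
Proof.
have idP : top idfun.
  split=> //.
  have -> : diag idfun = idfun by apply/funext => x; exact: (co_up_pr co).
  exact: (perm_group_id pG).
split=> //; first by move=> q [].
- move=> q t tq tt; have [bq qb Gq] := tq; have [bt tb Gt] := tt; split.
  + exact: bij_comp.
  + exact: id_off_comp.
  have -> : diag (q \o t) = diag q \o diag t; last exact: perm_group_comp.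
  apply/funext => x; rewrite /= diag_comp//; first exact: bij_inj.
  exact: top_kernel_preserving.
- move=> q t tq qK tK; have [bq qb Gq] := tq; split; first by exists q.
    exact: id_off_inv qK qb.
  have qk := top_kernel_preserving tq.
  apply: (perm_group_inv pG Gq); apply: diag_cancel => //.
    exact: id_off_inv qK qb.
  exact: (kernel_preserving_inv qK tK).
Qed.

Lemma top_closed : fin_closed top.
Proof.
move=> q bq qT.
have qb : id_off base q.
  by move=> x nx; have [t [_ tb _] tq] := qT [:: x]; rewrite -tq ?mem_head// tb.
have qk : kernel_preserving q.
  move=> a la; have [t tt tq] := qT [:: a]; rewrite -tq ?mem_head//.
  exact: top_kernel_preserving.
split=> //; apply: cG; first exact: diag_bij.
move=> s; have [t [bt tb Gt] tq] := qT [seq pr x | x <- s].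
by exists (diag t) => // x xs; rewrite /diag tq// map_f.
Qed.

Lemma bottom_product_kernel_preserving nu : bottom_product nu ->
  kernel_preserving nu.
Proof. by move=> Nnu a /(bottom_product_base Nnu)[_ ->]. Qed.

Lemma bottom_product_top nu : bottom_product nu -> top nu.
Proof.
move=> Nnu; have [bnu nub _] := Nnu; split=> //.
have nuI := bij_inj bnu; have nuk := bottom_product_kernel_preserving Nnu.
apply: levelwise; first exact: diag_bij.
  move=> x x0; have lx := co_lev0 co x0.
  by rewrite diag_base// (bottom_product_kernel Nnu).
by move=> x x0; exists nu.
Qed.

(** The diagonal copy of h permutes the blocks and normalizes G, so it carries
    components to components. *)
Lemma top_conj_bottom h h' nu : top h -> cancel h h' -> cancel h' h ->
  bottom_product nu -> bottom_product (h \o nu \o h').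
Proof.
move=> th hK h'K Nnu; have [bnu nub _] := Nnu; have [bh hb Gh] := th.
have th' := perm_group_inv top_group th hK h'K; have [bh' h'b Gh'] := th'.
have hI := can_inj hK; have h'I := can_inj h'K.
split.
- by apply: (bij_comp (bij_comp _ _)) => //; exists h'.
- by apply: (id_off_comp (id_off_comp _ _)).
move=> i; have [i0|i0] := pselect (i = ord0).
  rewrite i0 /bottom eqxx; apply/funext => x.
  have [[lx x0]|nx] := pselect (block base idx ord0 x); last by rewrite onF.
  rewrite onT//= (bottom_product_kernel Nnu) ?h'K//.
  exact: (top_kernel_preserving th' lx).2.
apply: on_block_bottom => //; have [a' ai'] := co_inhabited co i0.
have [_ _ hi' _] := group_respects_levels Gh'.
pose j := idx (diag h' (pr a')).
have jE x : lev x = 0 -> idx x = i <-> idx (h' x) = j.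
  move=> lx; rewrite -(diag_base h'I h'b lx) /j -hi' (co_idx_pr co) ai'.
  by [].
suff -> : on (block base idx i) (h \o nu \o h') =
    diag h \o (on (block base idx j) nu \o diag h').
  apply: (perm_group_comp pG Gh); apply: (perm_group_comp pG _ Gh').
  exact: bottom_product_on.
have h'k := top_kernel_preserving th'; have hk := top_kernel_preserving th.
apply/funext => x /=; have [[lx xi]|nx] := pselect (block base idx i x).
  have lh' := base_stab h'I h'b lx.
  have [ln _] := bottom_product_base Nnu lh'.
  have Bj : block base idx j (h' x) by split=> //; exact: (jE _ lx).1.
  rewrite onT; last by split.
  by rewrite (diag_base h'I h'b lx) (onT nu Bj) (diag_base hI hb ln).
rewrite (onF (h \o nu \o h') nx) onF.
  by rewrite (diag_cancel h'K)//.
move=> [lx xj]; apply: nx; rewrite /base /= lev_diag// in lx; split=> //.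
by apply: (jE _ lx).2; rewrite -(diag_base h'I h'b lx).
Qed.

Lemma top_normalizes_bottom h : top h -> normalizes h bottom_product.
Proof.
move=> th h' hK h'K nu Nnu; split; first exact: top_conj_bottom Nnu.
apply: top_conj_bottom => //; exact: (perm_group_inv top_group th).
Qed.

Lemma block_Del i a : i <> ord0 -> idx a = i ->
  block base idx i = Del (pr a).
Proof.
move=> i0 ai; apply/funext => x; apply/propext; rewrite (co_Del co).
rewrite /block /base /= (co_idx_pr co) (co_lev_pr co) ai.
by split=> [[-> ->]|[_ -> <-]].
Qed.

Lemma class_H_on_bottom m i :
  (forall x, Del x x -> class_H_on m.+1 (Del x) (local_subgroup G (Del x))) ->
  class_H_on m.+1 (block base idx i) (bottom i).
Proof.
move=> comp; have [i0|i0] := pselect (i = ord0).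
  have [s sP] := part_Kfin P.
  apply: (@class_H_on_finite _ _ _ _ s).
  - by move=> x [_]; rewrite i0 => /(co_K co)/sP.
  - exact: bottom_group.
  - by move=> g; rewrite /bottom i0 eqxx => ->.
have [a ai] := co_inhabited co i0.
have := bottom_group i; rewrite /bottom; case: eqP => // _ _.
rewrite (block_Del i0 ai); apply: comp; apply/(co_Del co).
by split=> //; rewrite (co_idx_pr co) ai.
Qed.

(** The product of the N_i is in the class and is normal in H. *)
Lemma class_H_on_top m :
  (forall x, Del x x -> class_H_on m.+1 (Del x) (local_subgroup G (Del x))) ->
  class_H_on m.+1 base top.
Proof.
move=> comp; apply: (@class_H_on_normal_supergroup _ _ _ bottom_product).
- by apply: class_H_on_block_product => i; exact: class_H_on_bottom.
- exact: top_group.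
- by move=> h [].
- exact: top_closed.
- exact: bottom_product_top.
- exact: top_normalizes_bottom.
Qed.

Section Straight.
Variable e : nat.
Hypotheses (e_gt0 : 0 < e)
  (expo : forall g x, G g -> Del x (g x) -> G (on (Del x) (iter e g))).

Lemma local_of_finsupp i n h : i <> ord0 -> G h ->
  (forall x, idx x <> i -> h x = x) ->
  (exists W, forall x, idx x = i -> W <= lev x -> h x = x) ->
  (forall x, level i n x -> level i n (h x)) -> G (on (level i n) h).
Proof.
move=> i0 Gh hi [W hW] hl; have [a' ai'] := co_inhabited co i0.
pose a := pr a'; have la : lev a = 0 by exact: (co_lev_pr co).
have ai : idx a = i by rewrite (co_idx_pr co).
have a0 : idx a <> ord0 by rewrite ai.
pose r n := up a n.
have rE j x : Del (r j) x <-> level i j x.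
  rewrite (co_Del co) /r (co_idx_up co)// (co_lev_up co)// ai.
  by split=> [[_ -> ->]|[-> ->]].
have -> : on (level i n) h = on (Del (r n)) h.
  by apply: eq_on => // x; rewrite rE.
have rl j : level i j (r j) by rewrite /level /= (co_idx_up co)// (co_lev_up co).
apply: (@finsupp_local X G [set x | idx x = i] Del r e pG cG (part_Del_sym P)
  (part_Del_trans P) (part_Del_inv P)) => //.
- by move=> j; apply/rE.
- by move=> j l /rE[_]; have [_ ->] := rl l => ->.
- move=> x; split=> [xi|[j /rE[]//]].
  by exists (lev x); apply/rE.
- move=> phi bphi; exists (sh (fun j => if j == i then phi else id)); split.
  + by apply: sh_group => j; case: eqP => // _; exists id.
  + by move=> x /eqP/negbTE xi; rewrite /shift xi (co_up_pr co).
  + move=> j; apply/rE; have [ri rj] := rl j; split; first by rewrite idx_sh.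
    by rewrite lev_sh ri// rj eqxx.
- split=> //; exists W => j x Wj /rE[xi xj]; apply: hW => //.
  by rewrite xj.
- by apply/rE; exact: hl.
Qed.

Definition level_preserving (g : X -> X) : Prop := forall x, lev (g x) = lev x.

(** For level preserving g, the element h below exchanges copies n and m, applies
    g, exchanges them back and applies the inverse of g. It is supported on two
    classes and compares g on copy m with g on copy n. *)
Lemma straighten_defect g g' i n m : G g -> cancel g g' -> cancel g' g ->
  level_preserving g -> i <> ord0 ->
  exists2 nu, bottom_product nu & forall a, block base idx i a ->
    nu a = pr (g' (up (pr (g (up a m))) n)).
Proof.
move=> Gg gK g'K gl i0; have Gg' := perm_group_inv pG Gg gK g'K.
have [_ g0 gi _] := group_respects_levels Gg.
have [_ g0' gi' _] := group_respects_levels Gg'.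
have gl' x : lev (g' x) = lev x by rewrite -[in RHS](g'K x) gl.
have [b bi] := co_inhabited co i0; pose j := idx (g b).
have gj x : idx x = i <-> idx (g x) = j by rewrite -bi; exact: gi.
have j0 : j <> ord0 by move=> /(g0 b).2; rewrite bi.
pose h := g' \o (swap_levels j n m \o (g \o swap_levels i n m)).
have Gh : G h.
  apply: (perm_group_comp pG Gg').
  apply: (perm_group_comp pG (swap_levels_group _ _ _)).
  exact: (perm_group_comp pG Gg (swap_levels_group _ _ _)).
have h_off x : idx x <> i -> h x = x.
  by move=> xi; rewrite /h /= swap_levels_off// swap_levels_off ?gK// => /(gj x).2.
have hE x : level i n x ->
    [/\ h x = g' (up (pr (g (up (pr x) m))) n), idx (h x) = i & lev (h x) = n].
  move=> [xi xn]; have x0 : idx x <> ord0 by rewrite xi.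
  have gx : idx (g (up (pr x) m)) = j by apply: (gj _).1; rewrite idx_up_pr.
  have -> : h x = g' (up (pr (g (up (pr x) m))) n).
    rewrite /h /= (@swap_levelsE i n m x xi) xn swap_natL.
    rewrite (@swap_levelsE j n m _ gx) gl lev_up_pr//.
    by rewrite /swap_nat eqxx; case: eqP => [->|].
  split=> //; last by rewrite gl' lev_up_pr// gx.
  by apply: (gj _).2; rewrite g'K idx_up_pr.
have Gon : G (on (level i n) h).
  apply: local_of_finsupp => //; last by move=> x /hE[].
  exists (maxn n m).+1 => x xi lx.
  have sx f y : idx y = f -> lev y = lev x -> f <> ord0 -> swap_levels f n m y = y.
    move=> yf yx f0; rewrite swap_levelsE// yx /swap_nat.
    have -> : (lev x == n) = false by apply/eqP; lia.
    have -> : (lev x == m) = false by apply/eqP; lia.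
    by rewrite -yx (co_up_pr co).
  by rewrite /h /= (sx i)// (sx j)// ?gK//; exact: (gj x).1.
have toL a : block base idx i a -> swap_levels i 0 n a = up a n.
  by move=> [la ai]; rewrite swap_levelsE// la swap_natL pr_base.
have upL a : block base idx i a -> level i n (up a n).
  move=> [la ai]; split; first by rewrite (co_idx_up co).
  by rewrite (co_lev_up co)// ai.
have frL x : level i n x -> swap_levels i 0 n x = pr x.
  move=> [xi xn]; rewrite swap_levelsE// xn /swap_nat eqxx.
  by have := co_up_0 co (co_lev_pr co x); case: eqP => [->|].
pose nu := swap_levels i 0 n \o (on (level i n) h \o swap_levels i 0 n).
have nuE a : block base idx i a -> nu a = pr (g' (up (pr (g (up a m))) n)).
  move=> Ba; have [la ai] := Ba; rewrite /nu /= (toL _ Ba) (onT h (upL _ Ba)).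
  have [hx hi hn] := hE _ (upL _ Ba); rewrite frL; last by split.
  by rewrite hx (co_pr_up co).
have Gnu : G nu.
  apply: (perm_group_comp pG (swap_levels_group _ _ _)).
  exact: (perm_group_comp pG Gon (swap_levels_group _ _ _)).
have nuB a : block base idx i a -> block base idx i (nu a).
  move=> Ba; rewrite /nu /= (toL _ Ba) (onT h (upL _ Ba)).
  have [hx hi hn] := hE _ (upL _ Ba); rewrite frL; last by split.
  by split; [exact: (co_lev_pr co _)|rewrite (co_idx_pr co)].
have nu_off : id_off (block base idx i) nu.
  move=> x nx; rewrite /nu /=.
  have [Lx|nLx] := pselect (level i n (swap_levels i 0 n x)).
    exfalso; apply: nx; rewrite -(swap_levelsK i 0 n x) frL//; have [xi xn] := Lx.
    by split; [exact: (co_lev_pr co _)|rewrite (co_idx_pr co)].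
  by rewrite onF// swap_levelsK.
exists nu => //.
apply: (block_subgroup bottom_group bottom_id_off (i := i)).
by rewrite -(id_off_on nu_off); apply: on_block_bottom; rewrite ?id_off_on.
Qed.
Lemma slice_base v g a : lev a = 0 -> slice v g a = pr (g (up a (v (idx a)))).
Proof. by rewrite /slice => ->; rewrite eqxx. Qed.

Lemma slice_id_off v g : id_off base (slice v g).
Proof. by move=> a; rewrite /base /= /slice; case: eqP. Qed.

Lemma lev_slice v g a : lev a = 0 -> lev (slice v g a) = 0.
Proof. by move=> la; rewrite slice_base// (co_lev_pr co). Qed.

Lemma idx_slice v g a : respects_levels g -> lev a = 0 -> idx (slice v g a) = idx (g a).
Proof.
move=> [_ _ gi _] la; rewrite slice_base// (co_idx_pr co).
by apply: (gi _ _).1; rewrite (co_idx_up co).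
Qed.

Lemma up_slice v g a n : respects_levels g -> level_preserving g -> lev a = 0 ->
  n = v (idx a) -> up (slice v g a) n = g (up a n).
Proof.
move=> ag gl la ->; have [_ g0 _ _] := ag.
have [a0|a0] := pselect (idx a = ord0).
  rewrite (co_up_kernel co); last by rewrite idx_slice//; exact: (g0 a).1.
  by rewrite slice_base// (co_up_kernel co)// pr_kernel//; exact: (g0 a).1.
rewrite slice_base//; set y := g _.
have <- : lev y = v (idx a) by rewrite gl (co_lev_up co).
exact: (co_up_pr co).
Qed.

Lemma slice_cancel v v' g g' : cancel g g' -> respects_levels g -> level_preserving g ->
  (forall x, v' (idx (g x)) = v (idx x)) -> cancel (slice v g) (slice v' g').
Proof.
move=> gK ag gl vv' a; have [la|nla] := pselect (lev a = 0); last first.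
  by rewrite !(@slice_id_off _ _ a).
rewrite (@slice_base v' g'); last exact: lev_slice.
rewrite idx_slice// vv' (up_slice ag gl la)// gK.
by rewrite (co_pr_up co).
Qed.

Lemma inverse_vector (v : 'I_k.+1 -> nat) g g' :
  cancel g g' -> cancel g' g -> respects_levels g ->
  exists v' : 'I_k.+1 -> nat, (forall x, v' (idx (g x)) = v (idx x)) /\
             (forall x, v (idx (g' x)) = v' (idx x)).
Proof.
move=> gK g'K ag; have [_ _ gi _] := ag.
have /choice[w wP] j : exists n, forall x, idx x = j -> n = v (idx (g' x)).
  have [[c cj]|nc] := pselect (exists c, idx c = j).
    exists (v (idx (g' c))) => x xj; congr v; apply: (gi _ _).2.
    by rewrite !g'K cj.
  by exists 0 => x xj; case: nc; exists x.
exists w; split=> x; last by rewrite (wP (idx x) x).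
by rewrite (wP (idx (g x)) (g x))// gK.
Qed.

Lemma slice_kernel_preserving v g : respects_levels g -> kernel_preserving (slice v g).
Proof. by move=> ag a la; rewrite idx_slice//; have [_ g0 _ _] := ag; rewrite -g0. Qed.

Lemma slice_bij v g : respects_levels g -> level_preserving g -> bijective (slice v g).
Proof.
move=> ag gl; have [[g' gK g'K] _ _ _] := ag.
have gl' : level_preserving g' by move=> x; rewrite -[in RHS](g'K x) gl.
have [v' [v1 v2]] := inverse_vector v gK g'K ag.
exists (slice v' g'); apply: slice_cancel => //.
exact: respects_levels_inv gK g'K ag.
Qed.

(** By [straighten_defect] a level preserving g differs from the diagonal copy
    of any of its slices by elements of components. *)
Lemma slice_top_straight v g : G g -> level_preserving g -> top (slice v g).
Proof.
move=> Gg gl; have ag := group_respects_levels Gg; have [bg g0 _ _] := ag.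
have bq := slice_bij v ag gl; have qb := @slice_id_off v g.
have qI := bij_inj bq; have qk := slice_kernel_preserving v ag.
have [g' [Gg' gK g'K]] := perm_group_inverse pG Gg.
have gl' : level_preserving g' by move=> x; rewrite -[in RHS](g'K x) gl.
split=> //.
have -> : diag (slice v g) = g \o (g' \o diag (slice v g)).
  by apply/funext => x; rewrite /= g'K.
apply: (perm_group_comp pG Gg); apply: levelwise.
- by apply: bij_comp (diag_bij bq qb qk); exists g.
- move=> x x0; have lx := co_lev0 co x0.
  rewrite /= (diag_base qI qb lx) slice_base// (co_up_kernel co)//.
  by rewrite pr_kernel ?gK//; exact: (g0 x).1.
move=> x x0; have [nu Nnu nuE] :=
  straighten_defect (lev x) (v (idx x)) Gg gK g'K gl x0.
exists nu => // y /(co_Del co)[_ xy lxy].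
have lp := co_lev_pr co y.
have By : block base idx (idx x) (pr y).
  by split=> //; rewrite (co_idx_pr co).
rewrite nuE// /= /diag slice_base// (co_idx_pr co) -xy -lxy.
set z := g' _; have <- : lev z = lev x; last by rewrite (co_up_pr co).
rewrite gl' lev_up_pr//; apply: contra_not x0 => /(g0 _).2.
by rewrite idx_up_pr xy.
Qed.

Lemma slice_modulo_straight v w g : G g -> level_preserving g ->
  exists2 nu, bottom_product nu & slice v g = slice w g \o nu.
Proof.
move=> Gg gl; have ag := group_respects_levels Gg; have [bg g0 _ _] := ag.
have [g' [Gg' gK g'K]] := perm_group_inverse pG Gg.
have ag' := group_respects_levels Gg'; have [_ _ gi' _] := ag'.
have gl' : level_preserving g' by move=> x; rewrite -[in RHS](g'K x) gl.
have [w' [w1 w2]] := inverse_vector w gK g'K ag.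
have sK : cancel (slice w' g') (slice w g) by exact: slice_cancel.
exists (slice w' g' \o slice v g); last by apply/funext => x; rewrite /= sK.
split.
- by apply: bij_comp; exact: slice_bij.
- by apply: id_off_comp; exact: slice_id_off.
have nuE a : lev a = 0 -> slice w' g' (slice v g a) =
    pr (g' (up (pr (g (up a (v (idx a))))) (w (idx a)))).
  move=> la; rewrite slice_base ?lev_slice// idx_slice// w1.
  by rewrite slice_base.
move=> i; have [i0|i0] := pselect (i = ord0).
  rewrite i0 /bottom eqxx; apply/funext => a.
  have [[la a0]|na] := pselect (block base idx ord0 a); last by rewrite onF.
  rewrite onT//= nuE// (co_up_kernel co _ a0) (pr_kernel ((g0 a).1 a0)).
  by rewrite (co_up_kernel co) ?gK ?pr_base//; exact: (g0 a).1.
have [nu Nnu nuE'] := straighten_defect (w i) (v i) Gg gK g'K gl i0.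
have [_ _ /(_ i)] := Nnu; congr bottom.
apply: eq_on => // a Ba; have [la ai] := Ba.
by rewrite nuE'//= nuE// ai.
Qed.

Lemma slice_shift s v sg sg' : (forall i, cancel (sg' i) (sg i)) ->
  slice v s = slice (fun i => sg' i (v i)) (s \o sh sg).
Proof.
move=> sgK; apply/funext => a; rewrite /slice; case: eqP => // la /=.
congr (pr (s _)).
have [a0|a0] := pselect (idx a = ord0).
  by rewrite !(co_up_kernel co)// sh_kernel.
by rewrite /shift (co_pr_up co)// (co_idx_up co)// (co_lev_up co)// sgK.
Qed.

Lemma slice_top v g : G g -> top (slice v g).
Proof.
move=> Gg; have [sg [sg' [sgK sg'K gl]]] := straighten (group_respects_levels Gg).
rewrite (slice_shift _ _ sg'K); apply: slice_top_straight => //.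
apply: (perm_group_comp pG Gg); apply: sh_group => i.
exact: Bijective (sgK i) (sg'K i).
Qed.

Lemma slice_modulo v w g : G g ->
  exists2 nu, bottom_product nu & slice v g = slice w g \o nu.
Proof.
move=> Gg; have [sg [sg' [sgK sg'K gl]]] := straighten (group_respects_levels Gg).
rewrite (slice_shift _ v sg'K) (slice_shift _ w sg'K).
apply: slice_modulo_straight => //.
apply: (perm_group_comp pG Gg); apply: sh_group => i.
exact: Bijective (sgK i) (sg'K i).
Qed.

(** Once s is level preserving, dividing it by the diagonal copy of its slice at
    copy 0 leaves a permutation that acts on each class as an element of N. *)
Lemma group_of_slices s : respects_levels s -> (forall v, top (slice v s)) ->
  (forall v w, exists2 nu, bottom_product nu & slice v s = slice w s \o nu) ->
  G s.
Proof.
move=> rs sT sN; have [sg [sg' [sgK sg'K tl]]] := straighten rs.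
have Gsh : G (sh sg) by apply: sh_group => i; exact: Bijective (sgK i) (sg'K i).
have Gsh' : G (sh sg') by apply: sh_group => i; exact: Bijective (sg'K i) (sgK i).
suff Gt : G (s \o sh sg).
  have -> : s = (s \o sh sg) \o sh sg'; last exact: perm_group_comp.
  by apply/funext => x; rewrite /= (sh_cancel sg'K).
set t := s \o sh sg in tl *.
have rt : respects_levels t.
  by apply: respects_levels_comp => //; exact: group_respects_levels.
have sgE (u : 'I_k.+1 -> nat) : (fun i => sg' i (sg i (u i))) = u.
  by apply/funext => i; rewrite sgK.
have tT v : top (slice v t).
  by rewrite -(sgE v) -(slice_shift s (fun i => sg i (v i)) sg'K).
have tN v w : exists2 nu, bottom_product nu & slice v t = slice w t \o nu.
  have [nu Nnu E] := sN (fun i => sg i (v i)) (fun i => sg i (w i)).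
  by exists nu => //; move: E; rewrite !(slice_shift s _ sg'K) !sgE.
pose h := slice (fun=> 0) t; have [bh hb Gh] : top h := tT _.
have [bt t0 _ _] := rt; have hI := bij_inj bh.
have [d' [Gd' dK d'K]] := perm_group_inverse pG Gh.
have -> : t = diag h \o (d' \o t) by apply/funext => x; rewrite /= d'K.
apply: (perm_group_comp pG Gh).
have hk := top_kernel_preserving (tT (fun=> 0)).
apply: levelwise.
- by apply: bij_comp => //; exists (diag h).
- move=> x x0; have lx := co_lev0 co x0.
  rewrite /=; have <- : diag h x = t x; last by rewrite dK.
  rewrite (diag_base hI hb lx) /h slice_base// (co_up_kernel co)//.
  by rewrite pr_kernel//; exact: (t0 x).1.
move=> x x0; have [nu Nnu nuE] := tN (fun=> lev x) (fun=> 0).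
exists nu => // y /(co_Del co)[_ xy lxy].
have lp := co_lev_pr co y.
have y0 : idx y <> ord0 by rewrite -xy.
have [ln ni] := bottom_product_base Nnu lp.
rewrite /=; have <- : diag h (up (nu (pr y)) (lev y)) = t y; last by rewrite dK.
rewrite /diag (co_pr_up co)// (co_lev_up co)//; last by rewrite ni (co_idx_pr co).
have -> : h (nu (pr y)) = slice (fun=> lev x) t (pr y) by rewrite nuE.
by rewrite (up_slice rt tl lp) ?(co_up_pr co).
Qed.

End Straight.

End Coords.

(** * From the topology and the quotients to elements *)

(** Basic neighbourhoods of f prescribe its values at finitely many points. *)
Lemma closed_groupE (Z : Type) (G : set (Z -> Z)) : G `<=` Sym Z ->
  closed_group G <-> @fin_closed {classic Z} G.
Proof.
move=> GS; pose T := {ptws {classic Z} -> discrete_topology {classic Z}}.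
pose V : set T := [set f | forall s : seq {classic Z}, exists2 g, G g & {in s, g =1 f}].
have GV : G `<=` V by move=> g Gg s; exists g.
split.
  move=> /closed_subspaceP[W clW WG] f bf fG.
  suff : (W `&` Sym Z) f by rewrite WG => -[].
  split=> //; apply: clW.
  pose F : set_system T := [set U | exists s : seq {classic Z},
    forall g : T, {in s, g =1 f} -> U g].
  have FF : Filter F.
    split.
    - by exists [::].
    - move=> A B [s sA] [t tB]; exists (s ++ t) => g gf; split.
        by apply: sA => x xs; apply: gf; rewrite mem_cat xs.
      by apply: tB => x xs; apply: gf; rewrite mem_cat xs orbT.
    - by move=> A B AB [s sA]; exists s => g /sA/AB.
  have Ff : {ptws, F --> (f : T)}.
    apply: (iffRL (@pointwise_cvgP (discrete_topology {classic Z})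
      (discrete_topology {classic Z}) F f FF)) => t A /nbhs_singleton At.
    exists [:: t] => g gf /=.
    by rewrite /= gf ?mem_head.
  move=> B /Ff[s sB]; have [g Gg gf] := fG s; exists g; split.
    suff : (W `&` Sym Z) g by case.
    by rewrite WG; split=> //; exact: GS.
  exact: sB.
move=> cG; apply/closed_subspaceP; exists V; last first.
  apply/seteqP; split=> f [fV fS]; split=> //; first exact: cG.
  exact: GV.
move=> f clf s.
have : nbhs (f : T) [set g : T | {in s, g =1 f}].
  elim: s => [|x s IHs].
    by apply: (@filterS _ (nbhs (f : T)) _ setT) => [g _ x //|]; exact: filterT.
  have H : nbhs (f : T) [set g : T | g x = f x].
    exact: (@proj_continuous {classic Z} (fun=> discrete_topology {classic Z}) x f
      [set f x] (discrete_set1 _)).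
  apply: (filterS _ (filterI IHs H)) => g [gs gx] y.
  by rewrite inE => /orP[/eqP->//|]; exact: gs.
move=> /clf[g [gV gf]]; have [h Gh hg] := gV s; exists h => // x xs.
by rewrite hg// gf.
Qed.

Lemma inj_surj_bij (T U : Type) (f : T -> U) :
  injective f -> (forall y, exists x, f x = y) -> bijective f.
Proof.
move=> fI /choice[g gP]; exists g => // x; exact: fI.
Qed.

Lemma restrict_exists (Z : Type) (A : set Z) (g : Z -> Z) :
  (forall x, A x -> A (g x)) -> exists h : A -> A, forall y, val (h y) = g (val y).
Proof.
move=> gA; have /choice[h hP] (y : A) : exists w : A, val w = g (val y).
  by exists (exist _ (g (val y)) (mem_set (gA _ (set_valP y)))).
by exists h.
Qed.

Lemma local_group_exists (Z : Type) (A : set Z) G (g : Z -> Z) :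
  perm_group G -> G g -> id_off A g ->
  exists2 h, local_group G A h & forall y, val (h y) = g (val y).
Proof.
move=> pG Gg gA; have gI := bij_inj (perm_group_sub pG Gg).
have [h hP] := restrict_exists (fun x => @id_off_stab _ A g x gI gA).
by exists h => //; exists g.
Qed.

Section RelRestr.
Variables (Z : Type) (K : set Z) (E : Z -> Z -> Prop).
Hypothesis EK : forall x y, E x y -> ~ K x /\ ~ K y.

Lemma equivalence_restrP : Equivalence (rel_restr E (~` K)) <->
  [/\ forall x, ~ K x -> E x x, forall x y, E x y -> E y x &
      forall x y z, E x y -> E y z -> E x z].
Proof.
pose pt x (nK : ~ K x) : ~` K := exist _ x (mem_set nK).
split=> [[Er Es Et]|[Er Es Et]].
  split=> [x nK|x y xy|x y z xy yz].
  - exact: (Er (pt x nK)).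
  - have [nx ny] := EK xy; exact: (Es (pt x nx) (pt y ny)).
  - have [nx ny] := EK xy; have [_ nz] := EK yz.
    exact: (Et (pt x nx) (pt y ny) (pt z nz)).
split.
- by move=> x; apply: Er; exact: set_valP x.
- by move=> x y; exact: Es.
- by move=> x y z; exact: Et.
Qed.

Lemma preserves_restrP (G : set (Z -> Z)) : perm_group G ->
  (forall g x, G g -> K x -> K (g x)) ->
  (forall h, group_restr G (~` K) h -> preserves h (rel_restr E (~` K))) <->
  (forall g x y, G g -> E x y -> E (g x) (g y)).
Proof.
move=> pG GK; pose pt x (nK : ~ K x) : ~` K := exist _ x (mem_set nK).
have nGK g x : G g -> ~ K x -> ~ K (g x).
  move=> Gg nK; have [g' [Gg' gK _]] := perm_group_inverse pG Gg.
  by move=> /(GK g' _ Gg'); rewrite gK.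
split=> H.
  move=> g x y Gg xy; have [nx ny] := EK xy.
  have [h hP] := @restrict_exists _ (~` K) g (fun x => nGK g x Gg).
  have := (H h _ (pt x nx) (pt y ny)).1 xy.
  by rewrite /rel_restr !hP; apply; exists g.
move=> h [g Gg hg] x y; rewrite /rel_restr !hg; split; first exact: H.
have [g' [Gg' gK _]] := perm_group_inverse pG Gg.
by move=> /(H g' _ _ Gg'); rewrite !gK.
Qed.

End RelRestr.

Section OmegaPartition.
Variables (Z : Type) (G : set (Z -> Z)) (K : set Z) (nab Del : Z -> Z -> Prop).
Hypothesis pG : perm_group G.

Lemma omega_partition_on : omega_partition G K nab Del ->
  @partition_on {classic Z} setT G K nab Del.
Proof.
move=> op; have DN := op_Delta_sub_nabla op; have nK := op_nabla_field op.
have dK x y : Del x y -> ~ K x /\ ~ K y by move=> /DN/nK.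
have GK g x : G g -> K x -> K (g x).
  by move=> Gg Kx; rewrite -(op_fixes_kernel op Gg); exists x.
have [/(equivalence_restrP nK)[nr ns nt] nP] := op_nabla_congruence op.
have [/(equivalence_restrP dK)[dr ds dt] dP] := op_Delta_congruence op.
split=> //.
- have [s sP] := (@finite_seqP {classic Z} K).1 (op_finite_kernel op).
  by exists s => x Kx; have : [set` s] x by rewrite -sP.
- by move=> x y xy; split=> //; exact: (nK _ _ xy).1.
- by move=> x _ nKx; exact: dr.
- exact/(preserves_restrP nK pG GK).
- exact/(preserves_restrP dK pG GK).
- have [S SP] := (@finite_seqP (set Z) _).1 (op_finite_nabla op).
  have /choice[f fP] (A : set Z) : exists y : option Z,
      forall x, A x -> exists2 y', y = Some y' & A y'.
    have [[x Ax]|nA] := pselect (exists x, A x).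
      by exists (Some x) => _ _; exists x.
    by exists None => x Ax; case: nA; exists x.
  exists (pmap (f : set Z -> option {classic Z}) S) => x xx.
  have Cx : classes nab (nab x) by exists x.
  have [y fy xy] := fP (nab x) x xx; exists y => //.
  rewrite mem_pmap; apply/mapP; exists (nab x) => //.
  by have : [set` S] (nab x) by rewrite -SP.
move=> x xx; pose C : set Z := nab x.
have Cx : classes nab C by exists x.
have Cd (y : C) : Del (val y) (val y).
  by apply: dr; have [] := nK _ _ (set_valP y : nab x (val y)).
have := op_countable op Cx; rewrite card_eq_sym => /card_set_bijP[f [fA fI fS]].
have /choice[a aP] n : exists a : C, f n = [set y | rel_restr Del C a y].
  by have /= [a _ <-] := fA n Logic.I; exists a.
have clE n (y : C) : f n y <-> Del (val (a n)) (val y) by rewrite aP.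
have finj n m : Del (val (a n)) (val (a m)) -> n = m.
  move=> nm; apply: fI; rewrite ?inE// !aP; apply/seteqP; split=> y.
    exact: dt (ds _ _ nm).
  exact: dt nm.
have fsurj (y : C) : exists n, Del (val (a n)) (val y).
  have [|n _ fn] := fS [set z | rel_restr Del C y z].
    by exists y => //; exact: Cd.
  by exists n; apply/clE; rewrite fn; exact: Cd.
exists (fun n => val (a n)); split=> //.
- by move=> n; exact: (set_valP (a n)).
- by move=> y xy; exact: (fsurj (exist _ y (mem_set xy))).
move=> phi [psi phiK psiK].
pose cls := classes (rel_restr Del C).
have Cf n : cls (f n) by exact: fA.
have /choice[ix ixP] (A : cls) : exists n, f n = val A.
  by have [n _ fn] := fS _ (set_valP A); exists n.
pose mk n : cls := exist _ (f n) (mem_set (Cf n)).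
have ixK n : ix (mk n) = n by apply: fI; rewrite ?inE// ixP.
have mkK A : mk (ix A) = A by apply: val_inj; exact: ixP.
have : Sym cls (fun A => mk (phi (ix A))).
  by exists (fun A => mk (psi (ix A))) => A; rewrite ixK ?phiK ?psiK mkK.
rewrite -(op_full op Cx) => -[g [g0 [Gg0 g0C] g0E] gE].
exists g0; split=> // n.
have := gE (mk n); rewrite ixK /= => E.
have : f (phi n) (g (a n)).
  by rewrite E; exists (a n) => //; apply/clE; exact: Cd.
by move=> /clE; rewrite g0E.
Qed.

Lemma omega_partition_of : @partition_on {classic Z} setT G K nab Del ->
  omega_partition G K nab Del.
Proof.
move=> P; have ns := part_nab_sym P; have nt := part_nab_trans P.
have ds := part_Del_sym P; have dt := part_Del_trans P.
have nK x y : nab x y -> ~ K x /\ ~ K y.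
  move=> xy; split; first exact: (part_nab_dom P xy).2.
  exact: (part_nab_dom P (ns _ _ xy)).2.
have DN := part_Del_nab P.
have dK x y : Del x y -> ~ K x /\ ~ K y by move=> /DN/nK.
have dr x : ~ K x -> Del x x by exact: (part_Del_refl P).
have nr x : ~ K x -> nab x x by move=> /dr/DN.
have [s sK] := part_Kfin P; have GK := part_Kinv P.
split=> //.
- by apply: (@sub_finite_set _ _ [set` s]); [exact: sK|exact: finite_seq].
- move=> g Gg; apply/seteqP; split=> [_ [x Kx <-]|x Kx]; first exact: GK.
  have [g' [Gg' gK g'K]] := perm_group_inverse pG Gg.
  by exists (g' x) => //; exact: GK.
- split; first exact/(equivalence_restrP nK).
  apply/(preserves_restrP nK pG GK); exact: (part_nab_inv P).
- split; first exact/(equivalence_restrP dK).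
  apply/(preserves_restrP dK pG GK); exact: (part_Del_inv P).
- have [t tP] := part_nab_fin P.
  apply: (@sub_finite_set _ _ (nab @` [set` t])); last exact/finite_image/finite_seq.
  move=> _ [x xx <-]; have [y ty xy] := tP x xx; exists y => //.
  by apply/seteqP; split=> z; [exact: nt|exact: nt (ns _ _ xy)].
- move=> _ [x xx <-]; set C := [set y | nab x y].
  have [r [nr' rI rs _]] := part_spread P xx.
  pose a n : C := exist _ (r n) (mem_set (nr' n)).
  have Da n : Del (r n) (r n) by apply: dr; have [] := nK _ _ (nr' n).
  rewrite card_eq_sym; apply/card_set_bijP.
  exists (fun n => [set y : C | rel_restr Del C (a n) y]); split.
  + by move=> n _; exists (a n) => //; exact: Da.
  + move=> n m _ _ E; apply: rI.
    suff : [set y : C | rel_restr Del C (a n) y] (a m) by [].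
    by rewrite E; exact: Da.
  + move=> _ [b bb <-]; have [n nb] := rs _ (set_valP b); exists n => //.
    by apply/seteqP; split=> y; [exact: dt (ds _ _ nb)|exact: dt nb].
move=> _ [x xx <-]; set C := [set y | nab x y].
have [r [nr' rI rs full]] := part_spread P xx.
pose cls := classes (rel_restr Del C).
have clsP (A : cls) : exists n, forall y : C, val A y <-> Del (r n) (val y).
  have [b bb bA] := set_valP A; have [n nb] := rs _ (set_valP b).
  exists n => y; rewrite -bA /= /rel_restr.
  by split; [exact: dt nb|exact: dt (ds _ _ nb)].
have Da n : Del (r n) (r n) by apply: dr; have [] := nK _ _ (nr' n).
pose a n : C := exist _ (r n) (mem_set (nr' n)).
have Cf n : cls [set y | rel_restr Del C (a n) y] by exists (a n) => //; exact: Da.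
pose mk n : cls := exist (fun A => A \in cls) _ (mem_set (Cf n)).
have /choice[ix ixP] := clsP.
have cls_eq (A B : cls) : ix A = ix B -> A = B.
  move=> E; apply: val_inj; apply/seteqP; split=> y /ixP H; apply/ixP.
    by rewrite -E.
  by rewrite E.
have ixK n : ix (mk n) = n.
  by apply: rI; have := (ixP (mk n) (a n)).1 (Da n).
have mkK A : mk (ix A) = A by apply: cls_eq; exact: ixK.
apply/seteqP; split=> [h [g [g0 [Gg0 g0C] g0E] hE]|h [h' hK h'K]].
  have [g1 [Gg1 gK g1K]] := perm_group_inverse pG Gg0.
  have g1C : id_off C g1 := id_off_inv gK g0C.
  have memE A (y : C) : val (h A) (g y) <-> val A y.
    rewrite hE; split=> [[z Az zy]|Ay]; last by exists y.
    suff <- : z = y by [].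
    by apply: val_inj; apply: (can_inj gK); rewrite -!g0E zy.
  apply: inj_surj_bij.
    move=> A B AB; apply: val_inj; apply/seteqP; split=> y H; apply/memE.
      by rewrite -AB; apply/memE.
    by rewrite AB; apply/memE.
  move=> B; have nC : C (g1 (r (ix B))).
    by apply: (id_off_stab (can_inj g1K) g1C); exact: nr'.
  have [n nb] := rs _ nC; exists (mk n); apply: cls_eq.
  pose b : C := exist _ (g1 (r (ix B))) (mem_set nC).
  have gb : val (g b) = r (ix B) by rewrite g0E /= g1K.
  have : val (h (mk n)) (g b) by apply/memE.
  by move=> /ixP; rewrite gb => /rI.
pose phi n := ix (h (mk n)); pose psi n := ix (h' (mk n)).
have bphi : bijective phi.
  by exists psi => n; rewrite /phi /psi mkK ?hK ?h'K ixK.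
have [g0 [Gg0 g0C g0r]] := full phi bphi.
have [g lg gE] := local_group_exists pG Gg0 g0C; exists g => // A.
have [g1 [Gg1 gK g1K]] := perm_group_inverse pG Gg0.
have g1C : id_off C g1 := id_off_inv gK g0C.
have phiA : ix (h A) = phi (ix A) by rewrite /phi mkK.
apply/seteqP; split=> y.
  move=> /ixP; rewrite phiA => yA.
  have Cy : C (g1 (val y)) by exact: (id_off_stab (can_inj g1K) g1C (set_valP y)).
  exists (exist _ (g1 (val y)) (mem_set Cy)); last by apply: val_inj; rewrite gE /= g1K.
  apply/ixP => /=; apply: (part_Del_sym P).
  have := part_Del_inv P Gg1 (dt _ _ _ (ds _ _ yA) (g0r (ix A))).
  by rewrite gK.
move=> [z /ixP zA <-]; apply/ixP; rewrite phiA gE.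
exact: dt (g0r (ix A)) (part_Del_inv P Gg0 zA).
Qed.

End OmegaPartition.

(** * Transfer along injections *)

(** The group G carried over to the image of f and extended by the identity. *)
Definition ext (Z X : Type) (f : Z -> X) (G : set (Z -> Z)) : set (X -> X) :=
  [set g | id_off (range f) g /\ exists2 h, G h & forall z, g (f z) = f (h z)].

Definition lift_fun (Z X : Type) (f : Z -> X) (h : Z -> Z) (x : X) : X :=
  if pselect (exists z, f z = x) is left H then f (h (projT1 (cid H))) else x.

Definition image_rel (Z X : Type) (f : Z -> X) (E : Z -> Z -> Prop) (x y : X) : Prop :=
  exists z w, [/\ f z = x, f w = y & E z w].

Section Transfer.
Variables (Z : Type) (X : eqType) (f : Z -> X).
Hypothesis fI : injective f.
Implicit Types (G : set (Z -> Z)).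

Lemma lift_funE h z : lift_fun f h (f z) = f (h z).
Proof.
rewrite /lift_fun; case: pselect => [H|[]]; last by exists z.
by case: (cid H) => w /= /fI ->.
Qed.

Lemma lift_fun_off h : id_off (range f) (lift_fun f h).
Proof.
move=> x nx; rewrite /lift_fun; case: pselect => // -[z zx].
by case: nx; exists z.
Qed.

Lemma rangeP x : (exists z, x = f z) \/ ~ range f x.
Proof.
have [[z _ <-]|nx] := pselect (range f x); [by left; exists z|by right].
Qed.

Lemma ext_lift G h : G h -> ext f G (lift_fun f h).
Proof.
by move=> Gh; split; [exact: lift_fun_off|exists h => // z; exact: lift_funE].
Qed.

Lemma ext_liftP G h : ext f G (lift_fun f h) -> G h.
Proof.
move=> [_ [h' Gh' hE]]; suff -> : h = h' by [].
by apply/funext => z; apply: fI; rewrite -hE lift_funE.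
Qed.

Lemma extP G g : ext f G g -> exists2 h, G h & g = lift_fun f h.
Proof.
move=> [gf [h Gh gE]]; exists h => //; apply/funext => x.
case: (rangeP x) => [[z ->]|nx]; first by rewrite gE lift_funE.
by rewrite gf// lift_fun_off.
Qed.

Lemma lift_comp h h' : lift_fun f h \o lift_fun f h' = lift_fun f (h \o h').
Proof.
apply/funext => x; case: (rangeP x) => [[z ->]|nx]; first by rewrite /= !lift_funE.
by rewrite /= !lift_fun_off.
Qed.

Lemma lift_idfun : lift_fun f idfun = idfun.
Proof.
apply/funext => x; case: (rangeP x) => [[z ->]|nx]; first by rewrite lift_funE.
by rewrite lift_fun_off.
Qed.

Lemma lift_cancel h h' : cancel h h' -> cancel (lift_fun f h) (lift_fun f h').
Proof.
move=> hK x; case: (rangeP x) => [[z ->]|nx]; first by rewrite !lift_funE hK.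
by rewrite !lift_fun_off.
Qed.

Lemma lift_cancelP h h' : cancel (lift_fun f h) (lift_fun f h') -> cancel h h'.
Proof. by move=> H z; apply: fI; rewrite -[RHS]H !lift_funE. Qed.

Lemma id_off_lift g : bijective g -> id_off (range f) g ->
  exists2 h, bijective h & g = lift_fun f h.
Proof.
move=> [g' gK g'K] gf; have g'f := id_off_inv gK gf.
have lift_ex k k' : cancel k k' -> id_off (range f) k ->
    exists h, k = lift_fun f h.
  move=> kK kf; have /choice[h hP] z : exists w, k (f z) = f w.
    have fz : range f (f z) by exists z.
    have [w _ <-] := id_off_stab (can_inj kK) kf fz.
    by exists w.
  exists h; apply/funext => x.
  case: (rangeP x) => [[z ->]|nx]; first by rewrite lift_funE hP.
  by rewrite kf// lift_fun_off.
have [h hE] := lift_ex g g' gK gf; have [h' h'E] := lift_ex g' g g'K g'f.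
exists h => //; exists h'; apply: lift_cancelP; rewrite -hE -h'E //.
Qed.

Lemma perm_group_ext G : perm_group G <-> perm_group (ext f G).
Proof.
split=> pG; split.
- move=> _ /extP[h Gh ->]; have [h' hK h'K] := perm_group_sub pG Gh.
  by exists (lift_fun f h'); exact: lift_cancel.
- by rewrite -lift_idfun; apply: ext_lift; exact: (perm_group_id pG).
- move=> _ _ /extP[h Gh ->] /extP[k Gk ->]; rewrite lift_comp.
  by apply: ext_lift; exact: (perm_group_comp pG).
- move=> _ g /extP[h Gh ->] hgK ghK.
  have [h' [Gh' hK h'K]] := perm_group_inverse pG Gh.
  suff -> : g = lift_fun f h' by exact: ext_lift.
  by apply: cancel_unique ghK; exact: lift_cancel.
- move=> h /ext_lift Gh; have [g' [Gg' gK g'K]] := perm_group_inverse pG Gh.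
  have [h' _ E] := extP Gg'; rewrite E in gK g'K.
  by exists h'; exact: lift_cancelP.
- by apply: ext_liftP; rewrite lift_idfun; exact: (perm_group_id pG).
- move=> h k /ext_lift Gh /ext_lift Gk; apply: ext_liftP.
  by rewrite -lift_comp; exact: (perm_group_comp pG).
- move=> h k /ext_lift Gh hK kK; apply: ext_liftP.
  by apply: (perm_group_inv pG Gh); exact: lift_cancel.
Qed.

Lemma fin_closed_ext G : @fin_closed {classic Z} G <-> fin_closed (ext f G).
Proof.
split=> cG.
  move=> g bg gG; have gf : id_off (range f) g.
    by move=> x nx; have [g1 [g1f _] g1g] := gG [:: x]; rewrite -g1g ?mem_head// g1f.
  have [h bh gE] := id_off_lift bg gf; rewrite gE; apply: ext_lift.
  apply: cG => // s; have [g1 [_ [h1 Gh1 h1E]] g1g] := gG [seq f z | z <- s].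
  exists h1 => // z zs; apply: fI.
  have fzs : f z \in [seq f z | z <- s] by exact: (@map_f {classic Z} X f).
  by rewrite -h1E g1g// gE lift_funE.
move=> h [h' hK h'K] hG; apply: ext_liftP; apply: cG.
  by exists (lift_fun f h'); exact: lift_cancel.
move=> s; have /choice[finv finvP] x : exists z : option {classic Z},
    forall w, f w = x -> z = Some w.
  case: (rangeP x) => [[z ->]|nx]; first by exists (Some z) => w /fI ->.
  by exists None => w wx; case: nx; exists w.
have [h1 Gh1 h1h] := hG (pmap finv s); exists (lift_fun f h1); first exact: ext_lift.
move=> x xs; case: (rangeP x) => [[z xz]|nx]; last by rewrite !lift_fun_off.
rewrite xz !lift_funE h1h// mem_pmap; apply/mapP; exists x => //.
by rewrite (finvP x z).
Qed.

Lemma partition_on_image G K nab Del :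
  @partition_on {classic Z} setT G K nab Del ->
  partition_on (range f) (ext f G) (f @` K) (image_rel f nab) (image_rel f Del).
Proof.
move=> P; have sym E : (forall x y, E x y -> E y x) ->
    forall x y, image_rel f E x y -> image_rel f E y x.
  by move=> Es _ _ [z [w [<- <- zw]]]; exists w, z; split=> //; exact: Es.
have trans (E : Z -> Z -> Prop) : (forall x y z, E x y -> E y z -> E x z) ->
    forall x y z, image_rel f E x y -> image_rel f E y z -> image_rel f E x z.
  move=> Et _ _ _ [z [w [<- <- zw]]] [w' [u [/fI E1 <- wu]]].
  by exists z, u; split=> //; apply: (Et _ w) => //; rewrite -E1.
have inv (E : Z -> Z -> Prop) : (forall g x y, G g -> E x y -> E (g x) (g y)) ->
    forall g x y, ext f G g -> image_rel f E x y -> image_rel f E (g x) (g y).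
  move=> Ei g _ _ [_ [h Gh hE]] [z [w [<- <- zw]]].
  by exists (h z), (h w); rewrite !hE; split=> //; exact: Ei.
have relf E z w : image_rel f E (f z) (f w) <-> E z w.
  split=> [[z' [w' [/fI <- /fI <-]]] //|zw].
  by exists z, w.
split.
- by move=> _ [z _ <-]; exists z.
- have [s sP] := part_Kfin P; exists [seq f z | z <- s] => _ [z Kz <-].
  by apply: (@map_f {classic Z} X f); exact: sP.
- move=> g _ [_ [h Gh hE]] [z Kz <-]; rewrite hE; exists (h z) => //.
  exact: (part_Kinv P).
- exact/sym/(part_nab_sym P).
- exact/trans/(part_nab_trans P).
- exact/sym/(part_Del_sym P).
- exact/trans/(part_Del_trans P).
- move=> _ _ [z [w [<- <- zw]]]; exists z, w; split=> //.
  exact: (part_Del_nab P).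
- move=> _ _ [z [w [<- _ zw]]]; split; first by exists z.
  have [_ nK] := part_nab_dom P zw.
  by move=> [z' Kz' /fI E]; apply: nK; rewrite -E.
- move=> _ [z _ <-] nK; apply/relf.
  by apply: (part_Del_refl P) => // Kz; apply: (nK); exists z.
- exact/inv/(part_nab_inv P).
- exact/inv/(part_Del_inv P).
- have [s sP] := part_nab_fin P; exists [seq f z | z <- s] => x [z [w [<- /fI -> zz]]].
  have [y ys zy] := sP z zz; exists (f y); last exact/relf.
  exact: (@map_f {classic Z} X f).
move=> x [z [w [<- /fI -> zz]]]; have [r [nr rI rs full]] := part_spread P zz.
exists (fun n => f (r n)); split.
- by move=> i; apply/relf.
- by move=> i j /relf; exact: rI.
- move=> y [z' [y' [/fI -> <-]]] /rs[i iy]; exists i; exact/relf.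
move=> phi /full[g [Gg gC gr]]; exists (lift_fun f g); split.
- exact: ext_lift.
- move=> y; case: (rangeP y) => [[y' ->]|ny _]; last exact: lift_fun_off.
  by rewrite lift_funE => nzy; rewrite gC// => zy; apply: nzy; apply/relf.
- by move=> i; rewrite lift_funE; apply/relf.
Qed.

Lemma partition_on_preimage G K nab Del :
  partition_on (range f) (ext f G) K nab Del ->
  @partition_on {classic Z} setT G (f @^-1` K)
    (fun z w => nab (f z) (f w)) (fun z w => Del (f z) (f w)).
Proof.
move=> P; have finvP (s : seq X) : exists s' : seq {classic Z},
    forall z, f z \in s -> z \in s'.
  have /choice[finv finvP] x : exists z : option {classic Z},
      forall w, f w = x -> z = Some w.
    case: (rangeP x) => [[z ->]|nx]; first by exists (Some z) => w /fI ->.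
    by exists None => w wx; case: nx; exists w.
  exists (pmap finv s) => z zs; rewrite (@mem_pmap X {classic Z}).
  apply/mapP; exists (f z) => //.
  by rewrite (finvP (f z) z).
have inv (E : X -> X -> Prop) :
    (forall g x y, ext f G g -> E x y -> E (g x) (g y)) ->
    forall g z w, G g -> E (f z) (f w) -> E (f (g z)) (f (g w)).
  by move=> Ei g z w /ext_lift/Ei Eg /Eg; rewrite !lift_funE.
split=> //.
- have [s sP] := part_Kfin P; have [s' sP'] := finvP s.
  by exists s' => z /sP/sP'.
- by move=> g z /ext_lift Gg /(part_Kinv P Gg); rewrite /= lift_funE.
- by move=> z w; exact: (part_nab_sym P).
- by move=> z w u; exact: (part_nab_trans P).
- by move=> z w; exact: (part_Del_sym P).
- by move=> z w u; exact: (part_Del_trans P).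
- by move=> z w; exact: (part_Del_nab P).
- by move=> z w /(part_nab_dom P)[].
- by move=> z _ nK; apply: (part_Del_refl P) => //; exists z.
- exact: (inv nab (part_nab_inv P)).
- exact: (inv Del (part_Del_inv P)).
- have [s sP] := part_nab_fin P; have [s' sP'] := finvP s.
  exists s' => z /sP[y ys zy].
  have [[w _ wy] _] := part_nab_dom P (part_nab_sym P zy).
  by exists w; [apply: sP'; rewrite wy|rewrite wy].
move=> z /(part_spread P)[r [nr rI rs full]].
have /choice[r' rE] i : exists w, f w = r i.
  by have [[w _ wr] _] := part_nab_dom P (part_nab_sym P (nr i)); exists w.
exists r'; split.
- by move=> i; rewrite rE.
- by move=> i j; rewrite !rE; exact: rI.
- by move=> y /rs[i iy]; exists i; rewrite rE.
move=> phi /full[g [[gf [h Gh hE]] gC gr]]; exists h; split=> //.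
  by move=> y zy; apply: fI; rewrite -hE gC.
by move=> i; rewrite -hE !rE.
Qed.

Lemma range_comp_val (Y : set Z) : range (f \o (val : Y -> Z)) = f @` Y.
Proof.
apply/seteqP; split=> [_ [y _ <-]|_ [z Yz <-]].
  by exists (val y) => //; exact: set_valP.
by exists (exist _ z (mem_set Yz)).
Qed.

Lemma ext_local_group G (Y : set Z) : perm_group G ->
  ext (f \o (val : Y -> Z)) (local_group G Y) = local_subgroup (ext f G) (f @` Y).
Proof.
move=> pG; apply/seteqP; split=> g.
  move=> [gf [h [h0 [Gh0 h0Y] hE] gE]]; rewrite range_comp_val in gf.
  split=> //; split; first by apply: id_offW gf => _ [z _ <-]; exists z.
  exists h0 => // z; have [Yz|nYz] := pselect (Y z).
    by have := gE (exist _ z (mem_set Yz)); rewrite /= hE.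
  by rewrite h0Y// gf// => -[w Yw /fI E]; apply: nYz; rewrite -E.
move=> [[gf [h Gh hE]] gY]; split; first by rewrite range_comp_val.
have hY : id_off Y h.
  by move=> z nz; apply: fI; rewrite -hE gY// => -[w Yw /fI E]; apply: nz; rewrite -E.
have [h' lh' h'E] := local_group_exists pG Gh hY; exists h' => // y.
by rewrite /= h'E hE.
Qed.

End Transfer.

(** The components of [ext f G] are the components of G carried over by the
    restrictions of f to classes, so the induction is on m for all injections
    simultaneously. *)
Lemma class_H_transfer (m : nat) (Z : Type) (X : eqType) (f : Z -> X)
    (G : set (Z -> Z)) : injective f ->
  class_H_upto m G <-> class_H_on m (range f) (ext f G).
Proof.
elim: m Z f G => // m IHm Z f G fI.
have comp (Del : Z -> Z -> Prop) z : perm_group G ->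
    class_H_upto m (local_group G [set y | Del z y]) <->
    class_H_on m (f @` [set y | Del z y])
      (local_subgroup (ext f G) (f @` [set y | Del z y])).
  move=> pG; rewrite -(ext_local_group fI _ pG) -(range_comp_val f).
  apply: IHm; apply: inj_comp fI _; exact: val_inj.
split.
  move=> [pG cG [K [nab [Del [op cH]]]]].
  have P := omega_partition_on pG op.
  split; first exact/(perm_group_ext fI).
  - by move=> g [].
  - by apply/(fin_closed_ext fI)/closed_groupE => //; exact: (perm_group_sub pG).
  exists (f @` K), (image_rel f nab), (image_rel f Del).
  split; first exact: partition_on_image.
  move=> _ [z [w [<- /fI -> zz]]].
  have -> : image_rel f Del (f z) = f @` [set y | Del z y].
    apply/seteqP; split=> [_ [z' [y [/fI -> <- zy]]]|_ [y zy <-]]; first by exists y.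
    by exists z, y.
  by apply/(comp Del _ pG)/cH; exists z.
move=> [pG _ cG [K [nab [Del [P cH]]]]].
have {}pG := (perm_group_ext fI G).2 pG.
split=> //.
  by apply/closed_groupE; [exact: (perm_group_sub pG)|exact/(fin_closed_ext fI)].
exists (f @^-1` K), (fun z w => nab (f z) (f w)), (fun z w => Del (f z) (f w)).
split; first exact/omega_partition_of/partition_on_preimage.
move=> _ [z zz <-]; apply/(comp (fun z w => Del (f z) (f w)) z pG).
have -> : f @` [set y | Del (f z) (f y)] = Del (f z).
  apply/seteqP; split=> [_ [y zy <-] //|x zx].
  have [[w _ wx] _] := Del_dom P (part_Del_sym P zx).
  by exists w; rewrite //= wx.
exact: cH.
Qed.

(** * The groups G(H; N_0, ..., N_k) belong to H_n *)

Lemma Tagged_inj (I : eqType) (Y : I -> Type) (i : I) : injective (@Tagged I i Y).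
Proof.
move=> a b /(congr1 (tagged_as (Tagged Y a))).
by rewrite !tagged_asE.
Qed.

Lemma prod_group_closed (I : eqType) (Y : I -> Type) (N : forall i, set (Y i -> Y i)) :
  (forall i, @fin_closed {classic Y i} (N i)) ->
  @fin_closed {classic {i & Y i}} (prod_group N).
Proof.
move=> cN f bf fN; split=> // i.
have /choice[g gE] (a : Y i) : exists b : Y i, f (Tagged Y a) = Tagged Y b.
  have [nu [_ /(_ i)[g _ gE]] nuf] := fN [:: Tagged Y a].
  by exists (g a); rewrite -nuf ?mem_head// gE.
exists g => //; apply: cN.
  apply: inj_surj_bij.
    by move=> a b ab; apply: (@Tagged_inj _ Y); apply: (bij_inj bf); rewrite !gE ab.
  move=> b; have [f' fK f'K] := bf.
  have fz := f'K (Tagged Y b); case: (f' _) fz => j a fz.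
  have ij : j = i.
    have [nu [_ /(_ j)[h _ hE]] nuf] := fN [:: Tagged Y a].
    have := nuf (Tagged Y a) (mem_head _ _).
    by rewrite hE [RHS]fz => /(congr1 tag).
  move: a fz; rewrite ij => a fz.
  by exists a; apply: (@Tagged_inj _ Y); rewrite -gE.
move=> s; have [nu [_ /(_ i)[h Nh hE]] nuf] := fN [seq Tagged Y a | a <- s].
exists h => // a sa; apply: (@Tagged_inj _ Y); rewrite -hE -gE; apply: nuf.
exact: (@map_f {classic Y i} {classic {i & Y i}} (@Tagged _ i Y)).
Qed.

Section GroupG.
Variables (k : nat) (Y : 'I_k.+1 -> Type).
Variables (H : set ({i & Y i} -> {i & Y i})) (N : forall i, set (Y i -> Y i)).
Arguments N : clear implicits.
Hypothesis data : group_G_data H N.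
Local Notation Z := {i & Y i}.
Local Notation GG := (group_G H N).

Let pt (w : Omega Y) : Z := (val w).1.
Let lv (w : Omega Y) : nat := (val w).2.

Let mk (a : Z) (n : nat) (p : tag a = ord0 -> n = 0) : Omega Y :=
  exist _ (a, n) (mem_set p).

Let OmegaP (w : Omega Y) : tag (pt w) = ord0 -> lv w = 0.
Proof. exact: (set_valP w). Qed.

Let Omega_eq (w w' : Omega Y) : pt w = pt w' -> lv w = lv w' -> w = w'.
Proof.
rewrite /pt /lv => E1 E2; apply: val_inj.
by rewrite [LHS]surjective_pairing [RHS]surjective_pairing E1 E2.
Qed.

Let sec (v : index_vectors k) (a : Z) : Omega Y := Omega_section v a.

Let sec_eq v w : lv w = val v (tag (pt w)) -> w = sec v (pt w).
Proof. by move=> E; apply: Omega_eq. Qed.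

Let pN i : perm_group (N i).
Proof.
have [->|i0] := eqVneq i ord0; last exact: (gd_perm_group data).
rewrite (gd_trivial data); split.
- by move=> _ ->; exists id.
- by [].
- by move=> _ _ -> ->.
- by move=> _ g -> fK gK; apply/funext => x; exact: (fK x).
Qed.

Let pH : perm_group H := gd_top_perm_group data.

Let pPN : perm_group (prod_group N).
Proof. by have [] := gd_normal data. Qed.

Let PNH : prod_group N `<=` H.
Proof. by have [] := gd_normal data. Qed.

Lemma group_G_tag s w w' : GG s ->
  tag (pt w) = tag (pt w') <-> tag (pt (s w)) = tag (pt (s w')).
Proof. by move=> [_ _ [sn _] _ _]; exact: sn. Qed.

Lemma group_G_level s w w' : GG s -> tag (pt w) = tag (pt w') ->
  lv w = lv w' <-> lv (s w) = lv (s w').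
Proof.
move=> Gs ww; have [_ _ [_ sd] _ _] := Gs; have ww' := (group_G_tag w w' Gs).1 ww.
have := sd w w'; rewrite /Omega_Delta => sdw; split=> E.
  by have [] := sdw.1 (conj ww E).
by have [] := sdw.2 (conj ww' E).
Qed.

Lemma group_G_kernel s w : GG s -> tag (pt w) = ord0 <-> tag (pt (s w)) = ord0.
Proof.
move=> [[s' sK s'K] sk _ _ _]; split=> wk.
  by have : (s @` Omega_kernel Y) (s w) by [exists w]; rewrite sk.
have : Omega_kernel Y (s w) by [].
by rewrite -sk => -[w' w'k /(can_inj sK) <-].
Qed.

Section Closed.
Hypothesis (cN : forall i, @fin_closed {classic Y i} (N i)).
Hypothesis (cH : @fin_closed {classic Z} H).

(** The sections of f are limits of sections of elements of the group. Only
    their surjectivity needs an argument: f permutes the classes, so a point can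
    be pulled back along the class that f carries to its class. *)
Lemma group_G_closed : @fin_closed {classic Omega Y} GG.
Proof.
move=> f bf fG; have [f' fK f'K] := bf.
have fk w : tag (pt w) = ord0 <-> tag (pt (f w)) = ord0.
  have [g Gg gf] := fG [:: w]; rewrite -gf ?mem_head//.
  exact: group_G_kernel.
have app2 w w' : exists g, [/\ GG g, g w = f w & g w' = f w'].
  have [g Gg gf] := fG [:: w; w']; exists g; split=> //; apply: gf.
    exact: mem_head.
  by rewrite !inE eqxx orbT.
have ft w w' : tag (pt w) = tag (pt w') <-> tag (pt (f w)) = tag (pt (f w')).
  by have [g [Gg <- <-]] := app2 w w'; exact: group_G_tag.
have fl w w' : tag (pt w) = tag (pt w') -> lv w = lv w' <-> lv (f w) = lv (f w').
  by have [g [Gg <- <-]] := app2 w w'; exact: group_G_level.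
have rho_bij v : bijective (rho v f).
  apply: inj_surj_bij.
    move=> a b; rewrite /rho /=; have [g [Gg <- <-]] := app2 (sec v a) (sec v b).
    have [_ _ _ /(_ v)Hg _] := Gg.
    exact: (bij_inj (perm_group_sub pH Hg)).
  move=> b.
  have p0 : tag b = ord0 -> 0 = 0 by [].
  pose w1 := f' (mk p0); pose u := f (sec v (pt w1)).
  have ub : tag (pt u) = tag b.
    have : tag (pt (sec v (pt w1))) = tag (pt w1) by [].
    by move=> /(ft _ _).1; rewrite f'K.
  have pu : tag b = ord0 -> lv u = 0 by rewrite -ub; exact: OmegaP.
  pose w2 := f' (mk pu); have fw2 : f w2 = mk pu by exact: f'K.
  have t2 : tag (pt w2) = tag (pt (sec v (pt w1))).
    by apply: (ft _ _).2; rewrite fw2.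
  have l2 : lv w2 = val v (tag (pt w2)).
    by rewrite t2; apply: (fl _ (sec v (pt w1)) t2).2; rewrite fw2.
  by exists (pt w2); rewrite /rho /= -[Omega_section _ _]sec_eq// fw2.
have rho_app v (s : seq {classic Z}) : exists2 g, GG g & {in s, rho v g =1 rho v f}.
  have [g Gg gf] := fG [seq sec v a | a <- s]; exists g => // a sa.
  rewrite /rho /=; congr (Omega_proj _); apply: gf.
  exact: (@map_f {classic Z} {classic Omega Y} (sec v)).
split=> //.
- apply/seteqP; split=> [_ [w wk <-]|w wk]; first exact: (fk w).1.
  by exists (f' w); rewrite ?f'K//; apply: (fk _).2; rewrite f'K.
- split=> w w'; first exact: ft.
  split=> -[t l]; split; [exact: (ft _ _).1|exact: (fl _ _ t).1|exact: (ft _ _).2|].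
  by apply: (fl _ _ _).2 => //; apply: (ft _ _).2.
- move=> v; apply: cH => // s; have [g [_ _ _ Hg _] gf] := rho_app v s.
  by exists (rho v g).
move=> v w; have [r' rK r'K] := rho_bij w.
exists (r' \o rho v f); last by apply/funext => a; rewrite /= r'K.
apply: (prod_group_closed cN).
  by apply: bij_comp => //; exists (rho w f).
move=> s; set h := r' \o rho v f.
have [g Gg gf] := fG ([seq sec v a | a <- s] ++ [seq sec w (h a) | a <- s]).
have [_ _ _ Hg /(_ v w)[nu Nnu nuE]] := Gg; exists nu => // a sa.
have gw : rho w g (h a) = rho w f (h a).
  rewrite /rho /=; congr (Omega_proj _); apply: gf; rewrite mem_cat; apply/orP; right.
  exact: (@map_f {classic Z} {classic Omega Y} (fun a => sec w (h a))).
have gv : rho v g a = rho v f a.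
  rewrite /rho /=; congr (Omega_proj _); apply: gf; rewrite mem_cat; apply/orP; left.
  exact: (@map_f {classic Z} {classic Omega Y} (sec v)).
apply: (bij_inj (perm_group_sub pH (Hg w))).
by rewrite gw /h /= r'K -gv nuE.
Qed.

End Closed.

Let nab (w w' : Omega Y) : Prop := tag (pt w) <> ord0 /\ tag (pt w) = tag (pt w').
Let Del (w w' : Omega Y) : Prop :=
  [/\ tag (pt w) <> ord0, tag (pt w) = tag (pt w') & lv w = lv w'].

(** All sections of a permutation that changes only the numbers of the copies
    are trivial. *)
Lemma group_G_vertical g : bijective g -> (forall w, pt (g w) = pt w) ->
  (forall w w', tag (pt w) = tag (pt w') -> lv w = lv w' <-> lv (g w) = lv (g w')) ->
  GG g.
Proof.
move=> bg gpt glv; have [g' gK g'K] := bg.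
have g'pt w : pt (g' w) = pt w by rewrite -[in RHS](g'K w) gpt.
have rhoE v : rho v g = idfun by apply/funext => a; exact: gpt.
split=> //.
- apply/seteqP; split=> [_ [w wk <-]|w wk].
    by rewrite /Omega_kernel /= -/(pt _) gpt.
  by exists (g' w); rewrite ?g'K// /Omega_kernel /= -/(pt _) g'pt.
- split=> w w'; first by rewrite /Omega_nabla -!/(pt _) !gpt.
  rewrite /Omega_Delta -!/(pt _) -!/(lv _) !gpt.
  by split=> -[t l]; split=> //; apply/(glv w w' t).
- by move=> v; rewrite rhoE; exact: (perm_group_id pH).
- move=> v w; rewrite !rhoE; exists idfun => //; exact: (perm_group_id pPN).
Qed.

Lemma group_G_partition :
  @partition_on {classic Omega Y} setT GG (Omega_kernel Y) nab Del.
Proof.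
split=> //.
- have /(@finite_seqP {classic Omega Y})[s sP] : finite_set (Omega_kernel Y).
    have p0 (a : Y ord0) : tag (Tagged Y a) = ord0 -> 0 = 0 by [].
    apply: (@sub_finite_set _ _ ((fun a => mk (p0 a)) @` setT)).
      move=> w wk; have := wk; rewrite /Omega_kernel /= -/(pt w) => wk'.
      have lw := OmegaP wk'; move: wk' lw; case E : (pt w) => [i a] /= ii.
      rewrite ii in a E *; move=> lw; exists a => //.
      by apply: Omega_eq; rewrite ?E ?lw.
    exact/finite_image/(gd_finite data).
  by exists s => w wk; have : [set` s] w by rewrite -sP.
- by move=> g w Gg /(group_G_kernel w Gg).1.
- by move=> w w' [w0 ww]; rewrite /nab -ww; split.
- by move=> w w' u [w0 ww] [_ wu]; split=> //; rewrite ww.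
- by move=> w w' [w0 t l]; rewrite /Del -t -l.
- by move=> w w' u [w0 t l] [_ t' l']; split=> //; rewrite ?t ?l.
- by move=> w w' [].
- by move=> w w' [w0 _]; split.
- move=> g w w' Gg [w0 t]; split; last exact: (group_G_tag _ _ Gg).1.
  by move=> /(group_G_kernel w Gg).2.
- move=> g w w' Gg [w0 t l]; split; last exact: (group_G_level Gg t).1.
    by move=> /(group_G_kernel w Gg).2.
  exact: (group_G_tag _ _ Gg).1.
- have /choice[o oP] (i : 'I_k.+1) : exists o : option {classic Omega Y},
      i <> ord0 -> exists2 w, o = Some w & tag (pt w) = i.
    have [i0|i0] := pselect (i = ord0); first by exists None.
    have [a] := gd_inhabited data (introN eqP i0).
    have p0 : tag (Tagged Y a) = ord0 -> 0 = 0 by [].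
    by exists (Some (mk p0)) => _; exists (mk p0).
  exists (pmap o (enum 'I_k.+1)) => w [w0 _].
  have [w' ow' tw'] := oP _ w0; exists w'; last by split=> //.
  by rewrite mem_pmap -ow' map_f// mem_enum.
move=> x [x0 _]; set i := tag (pt x) in x0 *.
have pr n : tag (pt x) = ord0 -> n = 0 by [].
exists (fun n => mk (pr n)); split.
- by move=> n; split.
- by move=> n m [].
- by move=> y [_ xy]; exists (lv y); split.
move=> phi [psi phiK psiK].
have pg (al : nat -> nat) (w : Omega Y) : tag (pt w) = ord0 ->
    (if tag (pt w) == i then al (lv w) else lv w) = 0.
  by move=> w0; case: eqP => [wi|_]; [case: x0; rewrite -wi|exact: OmegaP].
pose g al w : Omega Y := mk (pg al w).
have lg al w : lv (g al w) = if tag (pt w) == i then al (lv w) else lv w by [].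
have gK al be : cancel al be -> cancel (g al) (g be).
  move=> alK w; apply: Omega_eq => //.
  rewrite lg (_ : pt (g al w) = pt w)// lg.
  by case: (tag (pt w) == i); rewrite ?alK.
exists (g phi); split.
- apply: group_G_vertical => //; first by exists (g psi); exact: gK.
  move=> w w' ww; rewrite !lg ww.
  by case: (tag (pt w') == i); split=> // [->|/(can_inj phiK)].
- move=> w nw; apply: Omega_eq => //; rewrite lg; case: eqP => // wi.
  by case: nw; split.
- by move=> n; split=> //; rewrite lg eqxx.
Qed.

Section Component.
Variable x : Omega Y.
Hypothesis xx : Del x x.

Let i := tag (pt x).
Let j := lv x.

Let pf (a : Y i) : tag (Tagged Y a) = ord0 -> j = 0.
Proof. by have [x0 _ _] := xx; move=> /x0. Qed.

Let f (a : Y i) : Omega Y := mk (pf (a := a)).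

Let f_inj : injective f.
Proof. move=> a b /(congr1 pt); exact: (@Tagged_inj _ Y). Qed.

Let range_f : range f = Del x.
Proof.
apply/seteqP; split=> [_ [a _ <-]|w [w0 t l]]; first by have [] := xx; split.
move: t l; rewrite -/i -/j; case E : (pt w) => [i' a] /= t.
move: a E; rewrite -t => a E l; exists a => //.
by apply: Omega_eq; rewrite ?E.
Qed.

(** A permutation supported on copy j of block i has a trivial section along an
    index vector avoiding j, so all its sections lie in the product of the
    N_i. *)
Lemma group_G_component : ext f (N i) = local_subgroup GG (Del x).
Proof.
have [x0 _ _] := xx.
have pE := (@perm_group_ext (Y i) {classic Omega Y} f f_inj (N i)).1 (pN i).
apply/seteqP; split=> g.
  move=> Eg; have [g' [Eg' gK g'K]] := perm_group_inverse pE Eg.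
  have stab h w : ext f (N i) h -> tag (pt (h w)) = tag (pt w) /\ lv (h w) = lv w.
    move=> [hf [nu Nnu hE]].
    case: (@rangeP (Y i) {classic Omega Y} f w) => [[a ->]|nw].
      by rewrite hE.
    by rewrite hf.
  have secE h v a : ext f (N i) h -> sec v (rho v h a) = h (sec v a).
    move=> Eh; have [t l] := stab h (sec v a) Eh; apply: Omega_eq => //.
    by rewrite l /lv /sec /= t.
  have rhoN h v : ext f (N i) h -> prod_group N (rho v h).
    move=> Eh; have [h' [Eh' hK h'K]] := perm_group_inverse pE Eh.
    split.
      exists (rho v h') => a.
        by rewrite {1}/rho /= -/(sec _ _) secE// hK.
      by rewrite {1}/rho /= -/(sec _ _) secE// h'K.
    have [hf [nu Nnu hE]] := Eh.
    move=> i'; have [[ii vj]|nii] := pselect (i' = i /\ val v i' = j).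
      rewrite ii in vj *; exists nu => // a; rewrite /rho /=.
      have -> : Omega_section v (Tagged Y a) = f a.
        by apply: Omega_eq; rewrite // /lv /= vj.
      by rewrite hE.
    exists idfun; first exact: (perm_group_id (pN i')).
    move=> a; rewrite /rho /= hf// => -[b _ E]; apply: nii.
    have E2 : j = val v i' := congr1 lv E.
    by split; [exact: (esym (congr1 (fun w => tag (pt w)) E))|rewrite -E2].
  split; last by rewrite -range_f; have [] := Eg.
  split.
  - by exists g'.
  - have kg h w : ext f (N i) h -> Omega_kernel Y w -> Omega_kernel Y (h w).
      by move=> Eh; rewrite /Omega_kernel /= -!/(pt _); have [-> _] := stab h w Eh.
    apply/seteqP; split=> [_ [w wk <-]|w wk]; first exact: kg.
    by exists (g' w); rewrite ?g'K//; exact: kg.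
  - split=> w w'; have [t1 l1] := stab g w Eg; have [t2 l2] := stab g w' Eg.
      by rewrite /Omega_nabla -!/(pt _) t1 t2.
    by rewrite /Omega_Delta -!/(pt _) -!/(lv _) t1 t2 l1 l2.
  - by move=> v; apply/PNH/rhoN.
  move=> v w; have [r' [Nr' rK r'K]] := perm_group_inverse pPN (rhoN _ w Eg).
  exists (r' \o rho v g); first exact: (perm_group_comp pPN Nr' (rhoN _ v Eg)).
  by apply/funext => a; rewrite /= r'K.
move=> [Gg gx]; split; first by rewrite range_f.
have [bg _ _ _ gmod] := Gg.
have vP n : index_vectors k (fun i' => if i' == i then n else 0).
  by rewrite /index_vectors /=; case: eqP => // /esym /x0.
pose v n : index_vectors k := exist (fun u => u \in index_vectors k) _ (mem_set (vP n)).
(* v j.+1 avoids copy j, outside of which g is the identity *)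
have rho1 : rho (v j.+1) g = idfun.
  apply/funext => a; rewrite /rho /= gx// => -[_ t l].
  by move: l; rewrite /lv /= -/(lv x) -/j -t eqxx => /n_Sn.
have [h Nh] := gmod (v j) (v j.+1); rewrite rho1 => hE.
have [_ /(_ i)[nu Nnu nuE]] := Nh; exists nu => // a.
have Dfa : Del x (f a) by rewrite -range_f; exists a.
have [_ _ l] := id_off_stab (bij_inj bg) gx Dfa.
apply: Omega_eq; last by rewrite -l.
rewrite /pt /= -nuE; have := congr1 (@^~ (Tagged Y a)) hE => /= <-.
rewrite /rho /=; congr (val (g _)).1; apply: Omega_eq => //.
by rewrite /lv /= eqxx.
Qed.

Lemma class_H_on_component m : class_H_upto m (N i) ->
  @class_H_on m {classic Omega Y} (Del x) (local_subgroup GG (Del x)).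
Proof.
rewrite -group_G_component -range_f => NH.
exact: (class_H_transfer m (X := {classic Omega Y}) (N i) f_inj).1.
Qed.

End Component.

Lemma class_H_on_group_G m : perm_group GG -> class_H_upto m.+1 H ->
  (forall i, i != ord0 -> class_H_upto m.+1 (N i)) ->
  @class_H_on m.+2 {classic Omega Y} setT GG.
Proof.
move=> pG [_ clH _] NH; split=> //; first by move=> g _ z [].
  apply: group_G_closed; last exact/closed_groupE/clH/(perm_group_sub pH).
  move=> i; have [->|i0] := eqVneq i ord0; last first.
    have [_ cN _] := NH i i0.
    exact/closed_groupE/cN/(perm_group_sub (pN i)).
  rewrite (gd_trivial data) => g bg gid; apply/funext => a.
  by have [h -> <-] := gid [:: a]; rewrite ?mem_head.
exists (Omega_kernel Y), nab, Del; split; first exact: group_G_partition.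
move=> x xx; apply: class_H_on_component => //; apply: NH.
by have [x0 _ _] := xx; exact/eqP.
Qed.

End GroupG.

(** * Every group in H_n is some G(H; N_0, ..., N_k) *)

Section LiftSet.
Variables (Z : Type) (X : eqType) (f : Z -> X).
Hypothesis fI : injective f.

Lemma lift_inj : injective (@lift_fun Z X f).
Proof.
move=> h h' E; apply/funext => z; apply: fI.
by rewrite -!(lift_funE fI) E.
Qed.

Lemma bij_liftP h : bijective (lift_fun f h) <-> bijective h.
Proof.
split=> [bh|[h' hK h'K]]; last by exists (lift_fun f h'); exact: lift_cancel.
by have [k bk /lift_inj ->] := id_off_lift fI bh (@lift_fun_off _ _ f h).
Qed.

Lemma ext_lift_set (T : set (X -> X)) :
  (forall q, T q -> bijective q) -> (forall q, T q -> id_off (range f) q) ->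
  ext f [set h | T (lift_fun f h)] = T.
Proof.
move=> Tb To; apply/seteqP; split=> q; first by move=> /(extP fI)[h Th ->].
move=> Tq; have [h _ qE] := id_off_lift fI (Tb _ Tq) (To _ Tq).
by rewrite qE in Tq *; exact: (ext_lift fI).
Qed.

End LiftSet.

Lemma ext_bij (Z X : Type) (e : Z -> X) (e' : X -> Z) (G : set (Z -> Z)) :
  cancel e e' -> cancel e' e ->
  range e = setT /\ ext e G = [set e \o g \o e' | g in G].
Proof.
move=> eK e'K; have re : range e = setT.
  by apply/seteqP; split=> // x _; exists (e' x).
split=> //; apply/seteqP; split=> g.
  move=> [_ [h Gh hE]]; exists h => //; apply/funext => x.
  by rewrite /= -hE e'K.
move=> [h Gh <-]; split; first by rewrite re => x [].
by exists h => // z; rewrite /= eK.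
Qed.

Section Assembly.
Variables (X : eqType) (G : set (X -> X)) (K : set X) (nab Del : X -> X -> Prop).
Variables (k : nat) (idx : X -> 'I_k.+1) (lev : X -> nat) (up : X -> nat -> X)
  (pr : X -> X).
Hypotheses (pG : perm_group G) (cG : fin_closed G).
Hypothesis (P : partition_on setT G K nab Del).
Hypothesis (co : coordinates G K nab Del idx lev up pr).
Variable e : nat.
Hypotheses (e_gt0 : 0 < e)
  (expo : forall g x, G g -> Del x (g x) -> G (on (Del x) (iter e g))).

Local Notation block i := (block (base lev) idx i).
Local Notation top := (top G lev up pr).
Local Notation bottom := (bottom G idx lev).
Local Notation bottom_product := (bottom_product G idx lev).
Local Notation slice := (slice idx lev up pr).

(** The set Y_i is copy 0 of block i. *)
Definition fiber (i : 'I_k.+1) : Type := block i.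

Definition fiber_val (i : 'I_k.+1) (a : fiber i) : X := val a.

Definition fiber_point (a : {i & fiber i}) : X := fiber_val (tagged a).

Definition fiber_group (i : 'I_k.+1) : set (fiber i -> fiber i) :=
  [set h | bottom i (lift_fun (@fiber_val i) h)].

Definition top_fiber_group : set ({i & fiber i} -> {i & fiber i}) :=
  [set h | top (lift_fun fiber_point h)].

Let pB i : perm_group (bottom i) := bottom_group idx lev pG i.
Let fiberP i (a : fiber i) : lev (fiber_val a) = 0 /\ idx (fiber_val a) = i.
Proof. exact: (set_valP a). Qed.

Let fiber_val_inj i : injective (@fiber_val i).
Proof. exact: val_inj. Qed.

Let range_fiber_val i : range (@fiber_val i) = block i.
Proof.
apply/seteqP; split=> [_ [a _ <-]|x Bx]; first exact: fiberP.
by exists (exist _ x (mem_set Bx)).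
Qed.

Let idx_fiber a : idx (fiber_point a) = tag a.
Proof. by have [_] := fiberP (tagged a). Qed.

Let lev_fiber a : lev (fiber_point a) = 0.
Proof. by have [] := fiberP (tagged a). Qed.

Let fiber_point_inj : injective fiber_point.
Proof.
move=> [i a] [j b] E; have := congr1 idx E; rewrite !idx_fiber /= => ij.
by subst j; congr existT; exact: fiber_val_inj.
Qed.

Let mk_fiber i x (Bx : block i x) : fiber i := exist _ x (mem_set Bx).

Let range_fiber_point : range fiber_point = base lev.
Proof.
apply/seteqP; split=> [_ [a _ <-]|x lx]; first exact: lev_fiber.
have Bx : block (idx x) x by [].
by exists (Tagged fiber (mk_fiber Bx)).
Qed.

Let ext_fiber_group i : ext (@fiber_val i) (@fiber_group i) = bottom i.
Proof.
apply: ext_lift_set => //; first by move=> q; exact: (perm_group_sub (pB i)).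
by move=> q; rewrite range_fiber_val; exact: bottom_id_off.
Qed.

Let ext_top_fiber : ext fiber_point top_fiber_group = top.
Proof.
apply: ext_lift_set => //; first by move=> q [].
by move=> q [_ + _]; rewrite range_fiber_point.
Qed.

Let prod_fiberP h :
  prod_group fiber_group h <-> bottom_product (lift_fun fiber_point h).
Proof.
have onE i g : (forall a, h (Tagged fiber a) = Tagged fiber (g a)) ->
    on (block i) (lift_fun fiber_point h) = lift_fun (@fiber_val i) g.
  move=> hE; apply/funext => x; have [Bx|nB] := pselect (block i x).
    have -> : x = fiber_val (mk_fiber Bx) by [].
    rewrite (lift_funE (@fiber_val_inj i)).
    rewrite onT; last exact: fiberP.
    by rewrite (lift_funE fiber_point_inj h (Tagged fiber (mk_fiber Bx))) hE.
  by rewrite onF// lift_fun_off// range_fiber_val.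
split=> [[bh hN]|[bh hb hB]].
  split; first exact/bij_liftP.
    by rewrite -range_fiber_point; exact: lift_fun_off.
  by move=> i; have [g Ng /onE ->] := hN i.
split; first exact/(bij_liftP fiber_point_inj).
move=> i; have := hB i; rewrite -ext_fiber_group => -[_ [g Ng gE]].
exists g => // a; apply: fiber_point_inj.
rewrite -(lift_funE fiber_point_inj) -[RHS](gE a) onT//; exact: fiberP.
Qed.

Let prod_ext : ext fiber_point (prod_group fiber_group) = bottom_product.
Proof.
have -> : prod_group fiber_group = [set h | bottom_product (lift_fun fiber_point h)].
  by apply/seteqP; split=> h /prod_fiberP.
apply: ext_lift_set => //; first by move=> q [].
by move=> q [_ + _]; rewrite range_fiber_point.
Qed.

Lemma coordinates_group_G_data : group_G_data top_fiber_group fiber_group.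
Proof.
split.
- have [s sP] := part_Kfin P.
  have [f fP] : exists f : X -> option {classic fiber ord0},
      forall a, f (fiber_val a) = Some a.
    have /choice[f fP] x : exists o : option {classic fiber ord0},
        forall a, fiber_val a = x -> o = Some a.
      have [[a ax]|na] := pselect (exists a : fiber ord0, fiber_val a = x).
        by exists (Some a) => b; rewrite -ax => /fiber_val_inj ->.
      by exists None => a ax; case: na; exists a.
    by exists f => a; exact: fP.
  apply: (@sub_finite_set _ _ [set` pmap f s]); last exact: finite_seq.
  move=> a _ /=; rewrite (@mem_pmap X {classic fiber ord0}) -fP map_f//.
  by apply: sP; apply/(co_K co); have [] := fiberP a.
- move=> i /eqP i0; have [x xi] := co_inhabited co i0.
  have Bx : block i (pr x) by split; [exact: (co_lev_pr co x)|rewrite (co_idx_pr co)].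
  by constructor; exact: mk_fiber Bx.
- apply/seteqP; split=> h; rewrite /fiber_group /bottom eqxx /id_group /=.
    by rewrite -(lift_idfun (@fiber_val_inj ord0)) => /(lift_inj (@fiber_val_inj _)).
  by move=> ->; exact: (lift_idfun (@fiber_val_inj ord0)).
- move=> i _; apply/(perm_group_ext (@fiber_val_inj i)).
  by rewrite ext_fiber_group; exact: pB.
- apply/(perm_group_ext fiber_point_inj); rewrite ext_top_fiber.
  exact: (top_group pG P co).
- have stab h a : top_fiber_group h -> tag (h a) = ord0 <-> tag a = ord0.
    move=> Th; rewrite -!idx_fiber -(lift_funE fiber_point_inj).
    exact: (top_kernel_preserving pG P co Th (lev_fiber a)).
  have pH : perm_group top_fiber_group.
    apply/(perm_group_ext fiber_point_inj); rewrite ext_top_fiber.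
    exact: (top_group pG P co).
  move=> h Th; apply/seteqP; split=> [_ [a a0 <-]|a a0]; first exact/stab.
  have [h' [Th' hK h'K]] := perm_group_inverse pH Th.
  by exists (h' a); [exact/stab|exact: h'K].
- split.
  + apply/(perm_group_ext fiber_point_inj); rewrite prod_ext.
    exact: (block_product_group (base lev) idx pB).
  + by move=> h /prod_fiberP /(bottom_product_top pG cG P co).
  move=> h h' f Th hK h'K /prod_fiberP Nf; apply/prod_fiberP.
  rewrite -(lift_comp fiber_point_inj (h \o f) h') -(lift_comp fiber_point_inj h f).
  by apply: (top_normalizes_bottom pG P co Th _ _ Nf).1; exact: lift_cancel.
Qed.

Lemma class_H_fiber_group m i :
  (forall x, Del x x -> class_H_on m.+1 (Del x) (local_subgroup G (Del x))) ->
  class_H_upto m.+1 (@fiber_group i).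
Proof.
move=> comp; apply: (class_H_transfer _ _ (@fiber_val_inj i)).2.
rewrite ext_fiber_group range_fiber_val.
exact: (class_H_on_bottom pG P co).
Qed.

Lemma class_H_top_fiber_group m :
  (forall x, Del x x -> class_H_on m.+1 (Del x) (local_subgroup G (Del x))) ->
  class_H_upto m.+1 top_fiber_group.
Proof.
move=> comp; apply: (class_H_transfer _ _ fiber_point_inj).2.
rewrite ext_top_fiber range_fiber_point.
exact: (class_H_on_top pG cG P co).
Qed.

Definition coordinate (w : Omega fiber) : X := up (fiber_point (val w).1) (val w).2.

Let pt (w : Omega fiber) := (val w).1.
Let lv (w : Omega fiber) := (val w).2.

Let lvP w : tag (pt w) = ord0 -> lv w = 0.
Proof. exact: (set_valP w). Qed.

Let idx_co w : idx (coordinate w) = tag (pt w).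
Proof. by rewrite /coordinate (co_idx_up co)// idx_fiber. Qed.

Let pr_co w : pr (coordinate w) = fiber_point (pt w).
Proof. by rewrite /coordinate (co_pr_up co). Qed.

Let lev_co w : lev (coordinate w) = lv w.
Proof.
have [w0|w0] := pselect (tag (pt w) = ord0).
  by rewrite (co_lev0 co) ?idx_co// lvP.
by rewrite /coordinate (co_lev_up co)// idx_fiber.
Qed.

Let coordinate_inj : injective coordinate.
Proof.
move=> w w' E; have E1 := congr1 pr E; have E2 := congr1 lev E.
rewrite !pr_co in E1; rewrite !lev_co in E2; move/fiber_point_inj in E1.
apply: val_inj; rewrite [LHS]surjective_pairing [RHS]surjective_pairing.
by congr pair.
Qed.

Let coordinate_surj x : exists w, coordinate w = x.
Proof.
have Bx : block (idx x) (pr x).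
  by split; [exact: (co_lev_pr co x)|rewrite (co_idx_pr co)].
have p : tag (Tagged fiber (mk_fiber Bx)) = ord0 -> lev x = 0 by exact: (co_lev0 co).
exists (exist _ (Tagged fiber (mk_fiber Bx), lev x) (mem_set p)).
exact: (co_up_pr co).
Qed.

Section Conjugation.
Variable c' : X -> Omega fiber.
Hypotheses (cK : cancel coordinate c') (c'K : cancel c' coordinate).

Let slice_rho s (v : index_vectors k) :
  lift_fun fiber_point (rho v s) = slice (val v) (coordinate \o s \o c').
Proof.
apply/funext => x; case: (rangeP fiber_point x) => [[a ->]|nx]; last first.
  by rewrite lift_fun_off// slice_id_off// -range_fiber_point.
rewrite (lift_funE fiber_point_inj) (slice_base _ _ _ _ _ (lev_fiber a)) idx_fiber.
have -> : up (fiber_point a) (val v (tag a)) = coordinate (Omega_section v a) by [].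
by rewrite /= cK pr_co.
Qed.

Let index_vectorP (v : 'I_k.+1 -> nat) : exists w : index_vectors k,
  forall s, slice v s = slice (val w) s.
Proof.
have p : index_vectors k (fun i => if i == ord0 then 0 else v i) by [].
exists (exist (fun u => u \in index_vectors k) _ (mem_set p)) => s.
apply/funext => a; rewrite /slice /=; case: eqP => // la.
case: eqP => // a0; first by rewrite !(co_up_kernel co).
Qed.

(** Conjugation by [coordinate] turns the sections rho_v into slices. *)
Lemma group_G_conj s :
  group_G top_fiber_group fiber_group s <-> G (coordinate \o s \o c').
Proof.
set t := coordinate \o s \o c'.
have tE w : t (coordinate w) = coordinate (s w) by rewrite /t /= cK.
split=> [Gs|Gt].
  have [bs sk _ sT sN] := Gs.
  have rt : respects_levels idx lev t.
    split.
    - apply: bij_comp; last by exists coordinate.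
      by apply: bij_comp => //; exists c'.
    - move=> x; rewrite -(c'K x) tE !idx_co; exact: (group_G_kernel _ Gs).
    - move=> x y; rewrite -(c'K x) -(c'K y) !tE !idx_co.
      exact: (group_G_tag _ _ Gs).
    - move=> x y; rewrite -(c'K x) -(c'K y) !tE !idx_co !lev_co.
      exact: (group_G_level Gs).
  apply: (group_of_slices pG cG P co rt).
    move=> v; have [w ->] := index_vectorP v.
    by rewrite -slice_rho; exact: sT.
  move=> v v'; have [w ->] := index_vectorP v; have [w' ->] := index_vectorP v'.
  have [h /prod_fiberP Nh E] := sN w w'.
  exists (lift_fun fiber_point h) => //.
  by rewrite -!slice_rho (lift_comp fiber_point_inj) E.
have [bt t0 ti tl] := group_respects_levels pG P co Gt.
have bs : bijective s.
  have -> : s = c' \o t \o coordinate by apply/funext => w; rewrite /t /= !cK.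
  apply: bij_comp; last by exists c'.
  by apply: bij_comp => //; exists coordinate.
have kE w : Omega_kernel fiber w <-> Omega_kernel fiber (s w).
  by rewrite /Omega_kernel /= -!/(pt _) -!idx_co -tE.
split=> //.
- apply/seteqP; split=> [_ [w wk <-]|w wk]; first exact: (kE w).1.
  have [s' sK s'K] := bs; exists (s' w) => //.
  by apply: (kE _).2; rewrite s'K.
- split=> w w'.
    by rewrite /Omega_nabla -!/(pt _) -!idx_co -!tE.
  rewrite /Omega_Delta -!/(pt _) -!/(lv _) -!idx_co -!lev_co -!tE.
  split=> -[i l].
    by split; [exact: (ti _ _).1|exact: (tl _ _ i).1].
  have i' := (ti _ _).2 i.
  by split=> //; exact: (tl _ _ i').2.
- move=> v; rewrite /top_fiber_group /= slice_rho.
  exact: (slice_top pG cG P co e_gt0 expo).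
move=> v w; have [nu Nnu E] := slice_modulo pG cG P co e_gt0 expo (val v) (val w) Gt.
have [bnu nub _] := Nnu; rewrite -range_fiber_point in nub.
have [h _ nuE] := id_off_lift fiber_point_inj bnu nub.
exists h; first by apply/prod_fiberP; rewrite -nuE.
apply: (lift_inj fiber_point_inj).
by rewrite -(lift_comp fiber_point_inj) !slice_rho -nuE.
Qed.

End Conjugation.

Lemma coordinates_isomorphic :
  isomorphic_group G (group_G top_fiber_group fiber_group).
Proof.
have [c' cK c'K] := inj_surj_bij coordinate_inj coordinate_surj.
exists c', coordinate; split=> //; apply/seteqP; split=> s.
  move=> [g Gg <-]; apply/(group_G_conj cK c'K).
  suff -> : coordinate \o (c' \o g \o coordinate) \o c' = g by [].
  by apply/funext => x; rewrite /= !c'K.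
move=> /(group_G_conj cK c'K) Gt; exists (coordinate \o s \o c') => //.
by apply/funext => w; rewrite /= !cK.
Qed.

End Assembly.

Lemma class_H_upto_on m (X : Type) (G : set (X -> X)) :
  class_H_upto m G <-> @class_H_on m {classic X} setT G.
Proof.
have [re xe] := @ext_bij X {classic X} id id G (fun _ => erefl) (fun _ => erefl).
have -> : (setT : set {classic X}) = range (id : X -> {classic X}) by [].
have -> : G = ext (id : X -> {classic X}) G.
  rewrite xe; apply/seteqP; split=> g; first by exists g.
  by move=> [h Gh <-].
rewrite -[X in class_H_upto m X](_ : G = _).
  exact: (@class_H_transfer m X {classic X} id G).
by rewrite xe; apply/seteqP; split=> g; [exists g|move=> [h Gh <-]].
Qed.

Theorem theorem3p41 (n : nat) (X : Type) (G : set (X -> X)) :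
  class_H n G <-> class_H' n G.
Proof.
rewrite /class_H; elim: n X G => [|n IHn] X G.
  rewrite class_H_upto_on; split.
    move=> [pG _ _ [K [nab [Del [P comp]]]]]; split=> //.
    have [s sK] := part_Kfin P.
    apply: (@sub_finite_set _ _ [set` s]); last exact: finite_seq.
    move=> x _ /=; apply: sK; apply: contrapT => nK.
    (* a point outside K would have a component in the empty class H_(-1) *)
    exact: (comp x (part_Del_refl P Logic.I nK)).
  move=> [pG /(@finite_seqP {classic X})[s sX]].
  apply: (@class_H_on_finite _ _ _ _ s) => //.
  + by move=> x _; have : [set` s] x by rewrite -sX.
  + by move=> g _ x [].
split.
  move=> /class_H_upto_on[pG _ cG [K [nab [Del [P comp']]]]]; split=> //.
  have comp x : Del x x -> class_H_on n.+1 (Del x) (local_subgroup G (Del x)).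
    exact: comp'.
  have [e e0 expo] := class_H_on_component_power pG P comp.
  have [k [idx [lev [up [pr co]]]]] := coordinates_exist pG cG P e0 expo.
  exists k, (@fiber {classic X} k idx lev),
    (@top_fiber_group {classic X} G k idx lev up pr),
    (@fiber_group {classic X} G k idx lev); split.
  - exact: (coordinates_group_G_data pG cG P co).
  - by move=> i _; apply/IHn; exact: (class_H_fiber_group pG P co).
  - by apply/IHn; exact: (class_H_top_fiber_group pG cG P co).
  - exact: (coordinates_isomorphic pG cG P co e0 expo).
move=> [pG [k [Y [H [N [data NH HH [e [e' [eK e'K eG]]]]]]]]].
have [re xe] := ext_bij G eK e'K; rewrite eG in xe.
apply: (@class_H_transfer _ X {classic Omega Y} e G (can_inj eK)).2.
rewrite re xe; apply: (class_H_on_group_G data).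
- by rewrite -xe; apply/(@perm_group_ext X {classic Omega Y} e (can_inj eK)).
- exact/IHn.
- by move=> i i0; apply/IHn; exact: NH.
Qed.
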